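(* Let $\mathcal{H}$ be a planar grid diagram of size $N$, decomposed along the vertical line $Z=\{x=k-\frac14\}$ as $\mathcal{H}=\mathcal{H}^A\cup_Z\mathcal{H}^D$, where $\mathcal{H}^A$ (respectively $\mathcal{H}^D$) is a partial planar grid diagram with width $k$ (respectively $N+1-k$) and height $N+1$. Then $$\mathit{CP}^-(\mathcal{H})\cong \mathit{CPA}^-(\mathcal{H}^A)\otimes_{\mathcal{A}_{N,k}}\mathit{CPD}^-(\mathcal{H}^D)$$ as $(\mathbb{Z}\oplus\mathbb{Z})$-graded chain complexes over $\mathbb{A}=\mathbb{F}[U_1,\dots,U_N]$ (the two gradings being the Alexander grading $A$ and the Maslov grading $\mu$).
   Context: **Ground ring.** $\mathbb{F}$ is the field with two elements, $\mathbb{A}=\mathbb{F}[U_1,\dots,U_N]$. All differentials and actions are $\mathbb{A}$-linear. Gradings: $A(U_i)=-1$, $\mu(U_i)=-2$. **Planar grid diagrams.** A planar grid diagram $\mathcal{H}=(\mathbb{R}^2,\mathbb{X},\mathbb{O})$ of size $N$ consists of points $X_i=(i-\frac12,\sigma_{\mathbb{X}}(i)-\frac12)$ and $O_i=(i-\frac12,\sigma_{\mathbb{O}}(i)-\frac12)$, $i=1,\dots,N$, for permutations $\sigma_{\mathbb{X}},\sigma_{\mathbb{O}}\in S_N$. Let $\alpha_i=\{y=i\}$, $\beta_i=\{x=i\}$ for $i=0,\dots,N$. For a region $R$ in the plane, $O_i(R)$ (resp. $X_i(R)$) is $1$ if $O_i$ (resp. $X_i$) lies in the interior of $R$ and $0$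 otherwise; $\mathbb{X}(R)=\sum_i X_i(R)$ and $U(R)=\prod_i U_i^{O_i(R)}$ (sums and products over the markings present in the diagram at hand). For finite sets $E,F\subset\mathbb{R}^2$, $\mathcal{I}(E,F)$ is the number of pairs $(e,f)\in E\times F$ with $e_1<f_1$ and $e_2<f_2$. **Rectangles.** For sets of points $\mathbf{x}=\{x_m\}$, $\mathbf{y}=\{y_m\}$ (one point on each of a given set of $\beta$-lines, on distinct $\alpha$-lines), $\mathrm{Rect}^\circ(\mathbf{x},\mathbf{y})$ is empty unless $\mathbf{x}$ and $\mathbf{y}$ differ on exactly two $\beta$-lines; then it is the set (with at most one element) of rectangles $R$ with sides on $\alpha$- and $\beta$-lines whose lower-left and upper-right corners are the two points of $\mathbf{x}\setminus\mathbf{y}$, whose upper-left and lower-right corners are the two points of $\mathbf{y}\setminus\mathbf{x}$, and whose interior contains no point of $\mathbf{x}$. **$\mathit{CP}^-(\mathcal{H})$.** It is freely generated over $\mathbb{A}$ by the set $\mathfrak{S}(\mathcal{H})$ of $(N+1)$-tuples $\mathbf{x}=\{x_i\in\alpha_{\sigma(i)}\cap\beta_i\}_{i=0}^N$, $\sigma$ a permutation of $\{0,\dots,N\}$, with $$\partial\mathbf{x}=\sum_{\mathbf{y}}\ \sum_{R\in\mathrm{Rect}^\circ(\mathbf{x},\mathbf{y}),\ \mathbb{X}(R)=0}U(R)\,\mathbf{y},$$ $A(\mathbf{x})=\mathcal{I}(\mathbb{X},\mathbf{x})-\mathcal{I}(\mathbb{O},\mathbf{x})$, $\mu(\mathbf{x})=\mathcal{I}(\mathbf{x},\mathbf{x})-2\mathcal{I}(\mathbb{O},\mathbf{x})$.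 **Slicing.** $\mathcal{H}^A$ is the part of $\mathcal{H}$ to the left of $Z=\{x=k-\frac14\}$; it contains $\beta_0,\dots,\beta_{k-1}$ and the markings $\mathbb{X}^A=\{X_1,\dots,X_k\}$, $\mathbb{O}^A=\{O_1,\dots,O_k\}$. $\mathcal{H}^D$ is the part to the right; it contains $\beta_k,\dots,\beta_N$ and $\mathbb{X}^D=\{X_{k+1},\dots,X_N\}$, $\mathbb{O}^D=\{O_{k+1},\dots,O_N\}$. $\mathfrak{S}(\mathcal{H}^A)$ is the set of $\mathbf{x}^A=\{x_i\in\alpha_{\sigma(i)}\cap\beta_i\}_{i=0}^{k-1}$ with $\sigma=\sigma_{\mathbf{x}^A}:\{0,\dots,k-1\}\to\{0,\dots,N\}$ injective; $\mathfrak{S}(\mathcal{H}^D)$ is the set of $\mathbf{x}^D=\{x_i\in\alpha_{\sigma(i)}\cap\beta_i\}_{i=k}^{N}$ with $\sigma=\sigma_{\mathbf{x}^D}:\{k,\dots,N\}\to\{0,\dots,N\}$ injective. **The algebra $\mathcal{A}_{N,k}$.** It is the free $\mathbb{A}$-module on upward-veering strand diagrams, i.e. on bijections $f:S\to T$ between $k$-element subsets of $\{0,\dots,N\}$ with $f(i)\ge i$ for all $i\in S$. Let $\mathrm{cr}(f)$ be the number of pairs $i<j$ in $S$ with $f(i)>f(j)$. The product of $f:S\to T$ and $g:S'\to T'$ (in the order $f\cdot g$: first $f$, then $g$) is $g\circ f$ if $T=S'$ and $\mathrm{cr}(g\circ f)=\mathrm{cr}(f)+\mathrm{cr}(g)$,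 and $0$ otherwise. The differential is $\partial f=\sum f'$, summed over those pairs $i<j$ in $S$ with $f(i)>f(j)$ for which the map $f'$ obtained from $f$ by exchanging the values at $i$ and $j$ (smoothing the crossing) satisfies $\mathrm{cr}(f')=\mathrm{cr}(f)-1$. $I_S$ is the identity of $S$; the $I_S$ generate the subalgebra $\mathcal{I}_{N,k}$. For $i<j$, $i\in S$, $j\notin S$, $\rho_{S,i,j}$ is the map $S\to(S\setminus i)\cup j$ sending $i\mapsto j$ and fixing all other elements; $\rho_{i,j}=\sum_S\rho_{S,i,j}$. The $I_S$ and $\rho_{S,i,j}$ generate $\mathcal{A}_{N,k}$ as an $\mathbb{A}$-algebra. Gradings on $\mathcal{A}_{N,k}$: let $L_X$ (resp. $L_O$) be the set of $y$-coordinates of points of $\mathbb{X}^A$ (resp. $\mathbb{O}^A$), equivalently the half-integers in $\{\frac12,\dots,N-\frac12\}$ that are not $y$-coordinates of points of $\mathbb{X}^D$ (resp. $\mathbb{O}^D$). For a strand diagram $a=f$, let $L_X(a)=\sum_{i\in S}\#\{\ell\in L_X: i<\ell<f(i)\}$, similarly $L_O(a)$; put $A(a)=L_X(a)-L_O(a)$, $\mu(a)=\mathrm{cr}(a)-2L_O(a)$. **Type $A$ module.** $\mathit{CPA}^-(\mathcal{H}^A)$ is freely generated over $\mathbb{A}$ by $\mathfrak{S}(\mathcal{H}^A)$, with $\partial\mathbf{x}^A=\sum_{\mathbf{y}^A}\sum_{R\in\mathrm{Rect}^\circ(\mathbf{x}^A,\mathbf{y}^A),\,\mathbb{X}(R)=0}U(R)\,\mathbf{y}^A$.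 It is a right $\mathcal{A}_{N,k}$-module via: $\mathbf{x}^AI_S=\mathbf{x}^A$ if $S=\mathrm{Im}(\sigma_{\mathbf{x}^A})$ and $0$ otherwise; and $\mathbf{x}^A\rho_{i,j}=\sum_{\mathbf{y}^A}\sum_{H\in\mathrm{Half}^\circ(\mathbf{x}^A,\mathbf{y}^A;\rho_{i,j}),\,\mathbb{X}(H)=0}U(H)\,\mathbf{y}^A$. Here $\mathrm{Half}^\circ(\mathbf{x}^A,\mathbf{y}^A;\rho_{i,j})$ is empty unless $\mathbf{x}^A,\mathbf{y}^A$ agree on all but one $\beta$-line $\beta_m$; then it consists of the rectangle $H$ with lower-left corner $x_m$, upper-left corner $y_m$ and right edge the segment of $Z$ from $y=i$ to $y=j$, if such a rectangle exists and its interior contains no point of $\mathbf{x}^A$. Gradings: $A(\mathbf{x}^A)=\mathcal{I}(\mathbb{X}^A,\mathbf{x}^A)-\mathcal{I}(\mathbb{O}^A,\mathbf{x}^A)$, $\mu(\mathbf{x}^A)=\mathcal{I}(\mathbf{x}^A,\mathbf{x}^A)-2\mathcal{I}(\mathbb{O}^A,\mathbf{x}^A)$. **Type $D$ module.** $\mathcal{I}_{N,k}$ acts on the left on $\mathbb{A}\langle\mathfrak{S}(\mathcal{H}^D)\rangle$ by $I_S\mathbf{x}^D=\mathbf{x}^D$ if $S\cap\mathrm{Im}(\sigma_{\mathbf{x}^D})=\emptyset$ and $0$ otherwise; $\mathit{CPD}^-(\mathcal{H}^D)=\mathcal{A}_{N,k}\otimes_{\mathcal{I}_{N,k}}\mathbb{A}\langle\mathfrak{S}(\mathcal{H}^D)\rangle$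 as a left module, with $$\partial\mathbf{x}^D=\sum_{\mathbf{y}^D}\ \sum_{R\in\mathrm{Rect}^\circ(\mathbf{x}^D,\mathbf{y}^D),\,\mathbb{X}(R)=0}U(R)\,\mathbf{y}^D+\sum_{\mathbf{y}^D}\sum_{i<j}\ \sum_{H\in\mathrm{Half}^\circ(\rho_{i,j};\mathbf{x}^D,\mathbf{y}^D),\,\mathbb{X}(H)=0}U(H)\,\rho_{i,j}\mathbf{y}^D,$$ extended by the Leibniz rule $\partial(a\mathbf{x}^D)=(\partial a)\mathbf{x}^D+a\,\partial\mathbf{x}^D$. Here $\mathrm{Half}^\circ(\rho_{i,j};\mathbf{x}^D,\mathbf{y}^D)$ is empty unless $\mathbf{x}^D,\mathbf{y}^D$ agree on all but one $\beta$-line $\beta_m$; then it consists of the rectangle $H$ with upper-right corner $x_m$, lower-right corner $y_m$ and left edge the segment of $Z$ from $y=i$ to $y=j$, if such a rectangle exists and its interior contains no point of $\mathbf{x}^D$. Gradings: $A(\mathbf{x}^D)=\mathcal{I}(\mathbb{X},\mathbf{x}^D)-\mathcal{I}(\mathbb{O},\mathbf{x}^D)$, $\mu(\mathbf{x}^D)=\mathcal{I}(\mathbf{x},\mathbf{x}^D)-2\mathcal{I}(\mathbb{O},\mathbf{x}^D)$ for any $\mathbf{x}\in\mathfrak{S}(\mathcal{H})$ extending $\mathbf{x}^D$ (independent of the choice), and $A(a\mathbf{x}^D)=A(a)+A(\mathbf{x}^D)$, $\mu(a\mathbf{x}^D)=\mu(a)+\mu(\mathbf{x}^D)$. The tensor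 product carries the differential $\partial(p\otimes q)=\partial p\otimes q+p\otimes\partial q$ and the sum gradings. *)

(* Defs.v *)
From HB Require Import structures.
From mathcomp Require Import all_boot all_order all_algebra.
From mathcomp Require Import perm generic_quotient ring_quotient.
From mathcomp Require Import freeg mpoly.
From Stdlib Require Import ClassicalEpsilon.

Set Implicit Arguments.
Unset Strict Implicit.
Unset Printing Implicit Defensive.

Import Order.TTheory GRing.Theory Num.Theory.
Local Open Scope ring_scope.
Local Open Scope quotient_scope.

(* The free module on G is [{freeg G / R}]; [<< x >>] is the
   basis element x and [fglift f] the linear extension of f : G -> M. *)

Section FreegLinear.
Variables (R : comNzRingType) (K : choiceType) (M : lmodType R) (f : K -> M).

Lemma fgliftD (D1 D2 : {freeg K / R}) :
  fglift f (D1 + D2) = fglift f D1 + fglift f D2.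
Proof.
have add := @lift_is_additive R K M f.
have f0 : fglift f 0 = 0 by rewrite -(subrr 0) add subrr.
have fN D : fglift f (- D) = - fglift f D by rewrite -sub0r add f0 sub0r.
by rewrite -[in LHS](opprK D2) add fN opprK.
Qed.

Lemma fglift0 : fglift f 0 = 0.
Proof. by apply: (addIr (fglift f 0)); rewrite -fgliftD !add0r. Qed.

Lemma fgliftZ c (D : {freeg K / R}) : fglift f (c *: D) = c *: fglift f D.
Proof.
have scaleU k z : c *: << k *g z >> = << c * k *g z >> :> {freeg K / R}.
  by apply/eqP/freeg_eqP => x; rewrite coeffZ !coeffU mulrA.
rewrite -(freeg_sumE D); elim: (dom D) => [|z s IHs].
  by rewrite !big_nil scaler0 !fglift0 scaler0.
by rewrite !big_cons scalerDr !fgliftD IHs scaleU !liftU scalerDr scalerA.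
Qed.

End FreegLinear.

Section Tensor.
Variables (R : comNzRingType) (M P : lmodType R) (B : Type).
Variables (ract : M -> B -> M) (lact : B -> P -> P).

Local Notation pre := {freeg (M * P)%type / R}.
Local Notation "p '(x)' q" := (<< (p, q) >> : pre) (at level 30).

Inductive tensor_rel : pre -> Prop :=
| TRaddl p p' q : tensor_rel ((p + p') (x) q - p (x) q - p' (x) q)
| TRaddr p q q' : tensor_rel (p (x) (q + q') - p (x) q - p (x) q')
| TRscalel c p q : tensor_rel ((c *: p) (x) q - c *: (p (x) q))
| TRscaler c p q : tensor_rel (p (x) (c *: q) - c *: (p (x) q))
| TRbalance p b q : tensor_rel (ract p b (x) q - p (x) lact b q)
| TR0 : tensor_rel 0
| TRadd u v : tensor_rel u -> tensor_rel v -> tensor_rel (u + v)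
| TRscale c u : tensor_rel u -> tensor_rel (c *: u).

Definition tensor_ker : pred pre :=
  fun u => if excluded_middle_informative (tensor_rel u) then true else false.

Lemma tensor_kerP u : reflect (tensor_rel u) (u \in tensor_ker).
Proof.
rewrite /tensor_ker unfold_in; case: excluded_middle_informative => h.
  exact: ReflectT.
exact: ReflectF.
Qed.

Fact tensor_ker_zmod : zmod_closed tensor_ker.
Proof.
split; first by apply/tensor_kerP; exact: TR0.
move=> u v /tensor_kerP hu /tensor_kerP hv; apply/tensor_kerP.
by apply: TRadd => //; rewrite -scaleN1r; apply: TRscale.
Qed.

HB.instance Definition _ :=
  GRing.isZmodClosed.Build pre tensor_ker tensor_ker_zmod.

Definition tensor_sub : zmodClosed pre := GRing.ZmodClosed.clone _ tensor_ker _.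
Definition tensor := Quotient.quot tensor_sub.
HB.instance Definition _ := GRing.Zmodule.on tensor.
HB.instance Definition _ := Quotient.on tensor.

Definition tcls (u : pre) : tensor := \pi_tensor u.
Definition trepr (t : tensor) : pre := repr t.

Lemma tclsK t : tcls (trepr t) = t.
Proof. exact: reprK. Qed.

Lemma tensor_eqP u v :
  tcls u = tcls v <-> tensor_rel (u - v).
Proof.
have piE' : (u - v \in tensor_ker) = (tcls u == tcls v).
  exact: (Quotient.idealrBE tensor_sub u v).
split=> [/eqP|/tensor_kerP]; rewrite -?piE'; first by move/tensor_kerP.
by rewrite piE' => /eqP.
Qed.

Lemma tclsD u v :
  tcls (u + v) = tcls u + tcls v.
Proof. exact: (Quotient.pi_add tensor_sub u v). Qed.

Lemma tcls0 : tcls 0 = 0.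
Proof. by apply: (addIr (tcls 0)); rewrite -tclsD !add0r. Qed.

Definition tensor_scale (c : R) (t : tensor) : tensor :=
  tcls (c *: trepr t).

Lemma tclsZ c u : tensor_scale c (tcls u) = tcls (c *: u).
Proof.
by apply/tensor_eqP; rewrite -scalerBr; apply: TRscale; apply/tensor_eqP; rewrite tclsK.
Qed.

Fact tensor_scalerA a b t :
  tensor_scale a (tensor_scale b t) = tensor_scale (a * b) t.
Proof. by rewrite -[t]tclsK !tclsZ scalerA. Qed.
Fact tensor_scale1r : left_id 1 tensor_scale.
Proof. by move=> t; rewrite -[t]tclsK tclsZ scale1r. Qed.
Fact tensor_scalerDr : right_distributive tensor_scale +%R.
Proof.
by move=> c t t'; rewrite -[t]tclsK -[t']tclsK -tclsD !tclsZ scalerDr tclsD.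
Qed.
Fact tensor_scalerDl t : {morph tensor_scale^~ t : a b / a + b}.
Proof. by move=> a b; rewrite -[t]tclsK !tclsZ scalerDl tclsD. Qed.

HB.instance Definition _ := GRing.Zmodule_isLmodule.Build R tensor
  tensor_scalerA tensor_scale1r tensor_scalerDr tensor_scalerDl.

Definition tens (p : M) (q : P) : tensor := tcls (p (x) q).

Lemma tensDl p p' q : tens (p + p') q = tens p q + tens p' q.
Proof.
by rewrite -tclsD; apply/tensor_eqP; rewrite opprD addrA; apply: TRaddl.
Qed.
Lemma tensDr p q q' : tens p (q + q') = tens p q + tens p q'.
Proof.
by rewrite -tclsD; apply/tensor_eqP; rewrite opprD addrA; apply: TRaddr.
Qed.
Lemma tensZl c p q : tens (c *: p) q = c *: tens p q.
Proof.
by rewrite -[RHS]/(tensor_scale _ _) tclsZ; apply/tensor_eqP; apply: TRscalel.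
Qed.
Lemma tensZr c p q : tens p (c *: q) = c *: tens p q.
Proof.
by rewrite -[RHS]/(tensor_scale _ _) tclsZ; apply/tensor_eqP; apply: TRscaler.
Qed.
Lemma tensB p b q : tens (ract p b) q = tens p (lact b q).
Proof. by apply/tensor_eqP; apply: TRbalance. Qed.

(* The map out of the tensor product induced by [f]; it has the expected
   meaning when [f] is bilinear and balanced, see [tens_liftE]. *)
Definition tens_lift (Q : lmodType R) (f : M -> P -> Q) (t : tensor) : Q :=
  fglift (fun pq : M * P => f pq.1 pq.2) (trepr t).

Definition balanced (Q : lmodType R) (f : M -> P -> Q) : Prop :=
  [/\ forall q c p p', f (c *: p + p') q = c *: f p q + f p' q,
      forall p c q q', f p (c *: q + q') = c *: f p q + f p q'
    & forall p b q, f (ract p b) q = f p (lact b q)].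

Section Lift.
Variables (Q : lmodType R) (f : M -> P -> Q) (fB : balanced f).

Lemma tens_lift_cls u :
  tens_lift f (tcls u) = fglift (fun pq : M * P => f pq.1 pq.2) u.
Proof.
rewrite /tens_lift; set F := fglift _.
have FD (a b : pre) : F (a + b) = F a + F b by apply: fgliftD.
have FZ c (a : pre) : F (c *: a) = c *: F a by apply: fgliftZ.
have FN (a : pre) : F (- a) = - F a by apply/eqP; rewrite -addr_eq0 -FD addNr /F fglift0.
have FU p q : F (p (x) q) = f p q by rewrite /F liftU scale1r.
have [fl fr fb] := fB.
have f0q q : f 0 q = 0.
  by have := fl q 1 0 0; rewrite !scale1r addr0 => /eqP; rewrite -subr_eq subrr => /eqP.
have fp0 p : f p 0 = 0.
  by have := fr p 1 0 0; rewrite !scale1r addr0 => /eqP; rewrite -subr_eq subrr => /eqP.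
have flD q p p' : f (p + p') q = f p q + f p' q.
  by have := fl q 1 p p'; rewrite !scale1r.
have frD p q q' : f p (q + q') = f p q + f p q'.
  by have := fr p 1 q q'; rewrite !scale1r.
have F_ker a : tensor_rel a -> F a = 0.
  elim=> [p p' q|p q q'|c p q|c p q|p b q||a1 b1 _ IH1 _ IH2|c a1 _ IH1].
  - by rewrite !FD !FN !FU flD -addrA -opprD subrr.
  - by rewrite !FD !FN !FU frD -addrA -opprD subrr.
  - by rewrite FD FN FZ !FU -[c *: p]addr0 fl f0q addr0 subrr.
  - by rewrite FD FN FZ !FU -[c *: q]addr0 fr fp0 addr0 subrr.
  - by rewrite FD FN !FU fb subrr.
  - by rewrite /F fglift0.
  - by rewrite FD IH1 IH2 addr0.
  - by rewrite FZ IH1 scaler0.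
apply/eqP; rewrite -subr_eq0 -FN -FD; apply/eqP/F_ker/tensor_eqP.
by rewrite tclsK.
Qed.

Lemma tens_liftE p q : tens_lift f (tens p q) = f p q.
Proof. by rewrite tens_lift_cls liftU scale1r. Qed.

Lemma tens_lift_linear c t t' :
  tens_lift f (c *: t + t') = c *: tens_lift f t + tens_lift f t'.
Proof.
rewrite -[t]tclsK -[t']tclsK -[c *: _]/(tensor_scale _ _) tclsZ -tclsD.
by rewrite !tens_lift_cls fgliftD fgliftZ.
Qed.

End Lift.

Lemma tensor_ind (S : tensor -> Prop) :
  S 0 -> (forall p q, S (tens p q)) ->
  (forall t t', S t -> S t' -> S (t + t')) -> forall t, S t.
Proof.
move=> S0 St SD t; rewrite -[t]tclsK -(freeg_sumE (trepr t)).
elim: (dom _) => [|[p q] s IHs]; first by rewrite big_nil tcls0.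
rewrite big_cons tclsD; apply: SD => //.
set c := coeff _ _; have -> : << c *g (p, q) >> = c *: (p (x) q).
  by apply/eqP/freeg_eqP => x; rewrite coeffZ !coeffU mul1r.
by rewrite -tclsZ -[tensor_scale _ _]/(c *: tens p q) -tensZl.
Qed.

End Tensor.

Section TensorGrading.
Variables (R : comNzRingType) (M P : lmodType R) (B : Type).
Variables (ract : M -> B -> M) (lact : B -> P -> P).
Variables (homM : int * int -> M -> Prop) (homP : int * int -> P -> Prop).

Inductive tens_hom : int * int -> tensor ract lact -> Prop :=
| TensHom0 e : tens_hom e 0
| TensHomD e t t' : tens_hom e t -> tens_hom e t' -> tens_hom e (t + t')
| TensHomU e e' p q :
    homM e p -> homP e' q -> tens_hom (e + e') (tens ract lact p q).

End TensorGrading.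

Section BigradedComplex.
Variable N : nat.
Local Notation A := {mpoly 'F_2[N]}.

(* [bg_hom (a, m) v]: v is homogeneous of Alexander grading a and Maslov
   grading m (0 is homogeneous of every bidegree). *)
Record bigraded := Bigraded {
  bg_car :> lmodType A;
  bg_d : bg_car -> bg_car;
  bg_hom : int * int -> bg_car -> Prop }.

Record is_complex (C : bigraded) : Prop := IsComplex {
  cx_linear c (u v : C) : bg_d (c *: u + v) = c *: bg_d u + bg_d v;
  cx_dd (u : C) : bg_d (bg_d u) = 0;
  cx_hom0 e : bg_hom e (0 : C);
  cx_homD e (u v : C) : bg_hom e u -> bg_hom e v -> bg_hom e (u + v);
  cx_homU i e (u : C) : bg_hom e u -> bg_hom (e + (-1, -2)) ('X_i *: u);
  cx_homd e (u : C) : bg_hom e u -> bg_hom (e + (0, -1)) (bg_d u);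
  cx_span (u : C) : exists (s : seq (int * int)) (c : int * int -> C),
    [/\ uniq s, forall e, bg_hom e (c e) & u = \sum_(e <- s) c e];
  cx_indep (s : seq (int * int)) (c : int * int -> C) :
    uniq s -> (forall e, bg_hom e (c e)) -> \sum_(e <- s) c e = 0 ->
    forall e, e \in s -> c e = 0 }.

Definition complex_iso (C D : bigraded) : Prop :=
  [/\ is_complex C, is_complex D
    & exists phi : {linear C -> D},
      [/\ bijective phi,
          forall u, phi (bg_d u) = bg_d (phi u)
        & forall e u, bg_hom e u <-> bg_hom e (phi u)]].

Definition free_hom (K : choiceType) (deg : K -> int * int)
    (e : int * int) (v : {freeg K / A}) : Prop :=
  forall g (m : 'X_{1..N}), m \in msupp (coeff g v) ->
    e = deg g - ((mdeg m)%:Z, (2 * mdeg m)%:Z).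

End BigradedComplex.

(* All plane coordinates are multiplied by 4, so that they are integers;
   columns, rows and markings are numbered from 0, so that the marking O_(c+1)
   is [Opt H c], at abscissa c + 1/2. *)
Definition point := (int * int)%type.
Definition line (i : nat) : int := (4 * i)%:Z.
Definition mark (c : nat) : int := (4 * c + 2)%:Z.
Definition Zline (k : nat) : int := (4 * k)%:Z - 1.

Definition below (e f : point) : bool := (e.1 < f.1) && (e.2 < f.2).

Definition Icount (E F : seq point) : int := \sum_(e <- E) (count (below e) F)%:Z.

Record rectangle := Rectangle { rleft : int; rright : int; rbot : int; rtop : int }.

Definition interior (R : rectangle) (p : point) : bool :=
  (rleft R < p.1 < rright R) && (rbot R < p.2 < rtop R).

Record grid (N : nat) := Grid { permX : 'S_N; permO : 'S_N }.

Section Markings.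
Variables (N : nat) (H : grid N).
Local Notation A := {mpoly 'F_2[N]}.

Definition Xpt (c : 'I_N) : point := (mark c, mark (permX H c)).
Definition Opt (c : 'I_N) : point := (mark c, mark (permO H c)).

(* [D] is the set of markings present in the (partial) diagram. *)
Variable D : {set 'I_N}.

Definition Xpts : seq point := [seq Xpt c | c <- enum D].
Definition Opts : seq point := [seq Opt c | c <- enum D].

Definition Xcount (R : rectangle) : nat := (\sum_(c in D) interior R (Xpt c))%N.
Definition Uweight (R : rectangle) : A := \prod_(c in D) 'X_c ^+ interior R (Opt c).

(* Sets G of generators of a (partial) diagram whose beta-lines are indexed by
   I: [col m] is the number of the line m, and [ht x m] the number of the
   alpha-line containing the point of x on the line m. *)
Variables (I : finType) (col : I -> 'I_N.+1).

Definition pt (x : I -> 'I_N.+1) (m : I) : point := (line (col m), line (x m)).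
Definition pts (x : I -> 'I_N.+1) : seq point := [seq pt x m | m <- enum I].

Definition empty_of (x : I -> 'I_N.+1) (R : rectangle) : bool :=
  [forall m, ~~ interior R (pt x m)].

Definition rect (x : I -> 'I_N.+1) (a b : I) : rectangle :=
  Rectangle (line (col a)) (line (col b)) (line (x a)) (line (x b)).

(* [rect x a b] belongs to Rect(x, y) *)
Definition is_rect (x y : I -> 'I_N.+1) (a b : I) : bool :=
  [&& (col a < col b)%N, (x a < x b)%N, y a == x b, y b == x a,
      [forall m, (m != a) && (m != b) ==> (y m == x m)]
    & empty_of x (rect x a b)].

Variables (G : finType) (ht : G -> I -> 'I_N.+1).

Definition rect_sum (V : lmodType A) (gen : G -> V) (x : G) : V :=
  \sum_(y : G) \sum_(a : I) \sum_(b : I |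
      is_rect (ht x) (ht y) a b && (Xcount (rect (ht x) a b) == 0%N))
    Uweight (rect (ht x) a b) *: gen y.

Definition rect_diff : {freeg G / A} -> {freeg G / A} :=
  fglift (rect_sum (fun y => << y >>)).

End Markings.

Section Grid.
Variables (N : nat) (H : grid N).
Local Notation A := {mpoly 'F_2[N]}.
Local Notation full := [set: 'I_N].

Definition full_ht (x : 'S_N.+1) : 'I_N.+1 -> 'I_N.+1 := x.
Definition full_pts (x : 'S_N.+1) : seq point := pts id (full_ht x).

Definition degCP (x : 'S_N.+1) : int * int :=
  (Icount (Xpts H full) (full_pts x) - Icount (Opts H full) (full_pts x),
   Icount (full_pts x) (full_pts x) - 2 * Icount (Opts H full) (full_pts x)).

Definition CP : bigraded N :=
  Bigraded (rect_diff H full id full_ht) (free_hom degCP).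

Variable k : nat.

Definition markA : {set 'I_N} := [set c : 'I_N | (c < k)%N].
Definition markD : {set 'I_N} := [set c : 'I_N | (k <= c)%N].

(* A strand diagram S -> T is a partial function of {0..N} with domain S and
   range T. *)
Definition pfun := {ffun 'I_N.+1 -> option 'I_N.+1}.
Definition dom_of (f : pfun) : {set 'I_N.+1} := [set i | f i != None].
Definition cod_of (f : pfun) : {set 'I_N.+1} := [set j | [exists i, f i == Some j]].

Definition is_strand (f : pfun) : bool :=
  [&& #|dom_of f| == k,
      [forall i, forall j, (f i != None) && (f i == f j) ==> (i == j)]
    & [forall i, if f i is Some j then (i <= j)%N else true]].

Definition strand := {f : pfun | is_strand f}.

Definition crossing (f : pfun) (i j : 'I_N.+1) : bool :=
  (i < j)%N && (if (f i, f j) is (Some a, Some b) then (b < a)%N else false).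
Definition cr (f : pfun) : nat := #|[set p : 'I_N.+1 * 'I_N.+1 | crossing f p.1 p.2]|.

(* h is the (nonzero) product of f and g, first f and then g *)
Definition is_product (f g h : pfun) : bool :=
  [&& cod_of f == dom_of g, [forall i, h i == obind g (f i)]
    & cr h == (cr f + cr g)%N].

(* f' is the smoothing of the crossing i < j of f *)
Definition is_smoothing (f f' : pfun) (i j : 'I_N.+1) : bool :=
  [&& crossing f i j, f' i == f j, f' j == f i,
      [forall l, (l != i) && (l != j) ==> (f' l == f l)]
    & (cr f').+1 == cr f].

Definition alg := {freeg strand / A}.
HB.instance Definition _ := GRing.Lmodule.on alg.

Definition alg_mul (a b : alg) : alg :=
  fglift (fun f : strand => fglift (fun g : strand =>
    \sum_(h : strand | is_product (val f) (val g) (val h)) << h >> : alg) b) a.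

Definition alg_diff : alg -> alg :=
  fglift (fun f : strand => \sum_(f' : strand) \sum_(i : 'I_N.+1)
    \sum_(j : 'I_N.+1 | is_smoothing (val f) (val f') i j) << f' >> : alg).

Definition ksub := {S : {set 'I_N.+1} | #|S| == k}.

Definition idem (S : ksub) : alg :=
  \sum_(f : strand | [forall i, val f i == if i \in val S then Some i else None])
    << f >>.

Definition alg_one : alg := \sum_(S : ksub) idem S.

Definition rhoS (S : ksub) (i j : 'I_N.+1) : alg :=
  \sum_(f : strand | [forall l, val f l ==
      if l \in val S then Some (if l == i then j else l) else None]) << f >>.

Definition rho (i j : 'I_N.+1) : alg :=
  \sum_(S : ksub | (i \in val S) && (j \notin val S)) rhoS S i j.

Definition strand_count (perm : 'S_N) (f : pfun) : nat :=
  (\sum_(i : 'I_N.+1) \sum_(c in markA)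
    if f i is Some j then ((line i < mark (perm c) < line j)%R : nat) else 0)%N.

Definition deg_strand (f : strand) : int * int :=
  ((strand_count (permX H) (val f))%:Z - (strand_count (permO H) (val f))%:Z,
   (cr (val f))%:Z - 2 * (strand_count (permO H) (val f))%:Z).

Definition IA := {m : 'I_N.+1 | (m < k)%N}.
Definition genA := {x : {ffun IA -> 'I_N.+1} | injectiveb x}.
Definition htA (x : genA) : IA -> 'I_N.+1 := val x.
Definition colA : IA -> 'I_N.+1 := val.
Definition ptsA (x : genA) : seq point := pts colA (htA x).
Definition imA (x : genA) : {set 'I_N.+1} := [set htA x m | m : IA].

Definition CPA := {freeg genA / A}.
HB.instance Definition _ := GRing.Lmodule.on CPA.

Definition diffA : CPA -> CPA := rect_diff H markA colA htA.

Definition halfrectA (m : IA) (i j : 'I_N.+1) : rectangle :=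
  Rectangle (line (colA m)) (Zline k) (line i) (line j).

Definition is_halfA (x y : genA) (i j : 'I_N.+1) (m : IA) : bool :=
  [&& (i < j)%N, htA x m == i, htA y m == j,
      [forall l, (l != m) ==> (htA y l == htA x l)]
    & empty_of colA (htA x) (halfrectA m i j)].

(* The last two clauses determine [act], since the I_S and the rho_(S,i,j) =
   I_S rho_(i,j) generate the algebra. *)
Record is_CPA_action (act : CPA -> alg -> CPA) : Prop := IsCPAAction {
  act_linear_l a c p p' : act (c *: p + p') a = c *: act p a + act p' a;
  act_linear_r p c a a' : act p (c *: a + a') = c *: act p a + act p a';
  act_one p : act p alg_one = p;
  act_mul p a b : act p (alg_mul a b) = act (act p a) b;
  act_idem (x : genA) (S : ksub) :
    act << x >> (idem S) = if imA x == val S then << x >> else 0;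
  act_rho (x : genA) (i j : 'I_N.+1) : (i < j)%N ->
    act << x >> (rho i j) =
    \sum_(y : genA) \sum_(m : IA | is_halfA x y i j m
                          && (Xcount H markA (halfrectA m i j) == 0%N))
      Uweight H markA (halfrectA m i j) *: << y >> }.

Definition degA (x : genA) : int * int :=
  (Icount (Xpts H markA) (ptsA x) - Icount (Opts H markA) (ptsA x),
   Icount (ptsA x) (ptsA x) - 2 * Icount (Opts H markA) (ptsA x)).

Definition ID := {m : 'I_N.+1 | (k <= m)%N}.
Definition genD := {x : {ffun ID -> 'I_N.+1} | injectiveb x}.
Definition htD (x : genD) : ID -> 'I_N.+1 := val x.
Definition colD : ID -> 'I_N.+1 := val.
Definition ptsD (x : genD) : seq point := pts colD (htD x).
Definition imD (x : genD) : {set 'I_N.+1} := [set htD x m | m : ID].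

Definition modD := {freeg genD / A}.
HB.instance Definition _ := GRing.Lmodule.on modD.

(* The subalgebra of idempotents is free on the I_S; [idem_incl] is its
   inclusion. *)
Definition idem_alg := {freeg ksub / A}.
Definition idem_incl (e : idem_alg) : alg := fglift idem e.

Definition idem_ract (a : alg) (e : idem_alg) : alg := alg_mul a (idem_incl e).
Definition idem_lact (e : idem_alg) (v : modD) : modD :=
  fglift (fun S : ksub => fglift (fun x : genD =>
    if [disjoint val S & imD x] then << x >> else 0 : modD) v) e.

Definition CPD := tensor idem_ract idem_lact.
HB.instance Definition _ := GRing.Lmodule.on CPD.

Definition tensD (a : alg) (v : modD) : CPD := tens idem_ract idem_lact a v.

Definition lactD_map (b a : alg) (v : modD) : CPD := tensD (alg_mul b a) v.
Definition lactD (b : alg) : CPD -> CPD := tens_lift (lactD_map b).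

Definition halfrectD (m : ID) (i j : 'I_N.+1) : rectangle :=
  Rectangle (Zline k) (line (colD m)) (line i) (line j).

Definition is_halfD (x y : genD) (i j : 'I_N.+1) (m : ID) : bool :=
  [&& (i < j)%N, htD x m == j, htD y m == i,
      [forall l, (l != m) ==> (htD y l == htD x l)]
    & empty_of colD (htD x) (halfrectD m i j)].

(* The differential on the generators x^D = 1 (x) x^D *)
Definition deltaD (v : modD) : CPD :=
  fglift (fun x : genD =>
    rect_sum H markD colD htD (fun y => tensD alg_one << y >>) x +
    \sum_(y : genD) \sum_(i : 'I_N.+1) \sum_(j : 'I_N.+1)
      \sum_(m : ID | is_halfD x y i j m
                     && (Xcount H markD (halfrectD m i j) == 0%N))
      Uweight H markD (halfrectD m i j) *: tensD (rho i j) << y >>) v.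

Definition diffD_map (a : alg) (v : modD) : CPD :=
  tensD (alg_diff a) v + lactD a (deltaD v).
Definition diffD : CPD -> CPD := tens_lift diffD_map.

(* The Maslov grading uses an extension z of x to the whole diagram; it does
   not depend on z. *)
Definition degD (x : genD) : int * int :=
  (Icount (Xpts H full) (ptsD x) - Icount (Opts H full) (ptsD x),
   if [pick z : 'S_N.+1 | [forall m, z (colD m) == htD x m]] is Some z
   then Icount (full_pts z) (ptsD x) - 2 * Icount (Opts H full) (ptsD x)
   else 0).

Definition CPD_hom : int * int -> CPD -> Prop :=
  tens_hom (free_hom deg_strand) (free_hom degD).

Variable act : CPA -> alg -> CPA.

Definition tensAD := tensor act lactD.

Definition diffAD_map (p : CPA) (q : CPD) : tensAD :=
  tens act lactD (diffA p) q + tens act lactD p (diffD q).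
Definition diffAD : tensAD -> tensAD := tens_lift diffAD_map.

Definition CPA_CPD : bigraded N :=
  Bigraded diffAD (tens_hom (free_hom degA) CPD_hom).

End Grid.

(* Main.v *)
From HB Require Import structures.
Require Import Defs.
From mathcomp Require Import all_boot all_order all_algebra.
From mathcomp Require Import freeg mpoly perm zify.

(* Every combinatorial count in the statement is an instance of one distance:
   the number of pairs of lines that two height functions order differently.
   The ascents of a generator are its distance to the reversed order of the
   columns, and the crossings of a strand diagram f are the distance between x
   and f o x.  Empty rectangles are the transpositions lowering the first
   distance by one; products of strands and the action on the type A module are
   nonzero exactly when the triangle inequality is an equality.  The
   multiplicities of rectangles and half-strips are differences of a potential,
   so the weights only depend on the initial and final generators.  With this,
   the Leibniz rule for the type A module is checked one pair of lines at a
   time, and d^2 = 0 on CP follows from a Leibniz rule for the product with an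
   elementary transposition s, namely d(xs) = (dx)s + x.

   The action on the type A module is unique because every nontrivial strand
   diagram factors as a rho moving its highest moving strand, followed by a
   simpler diagram.  The isomorphism sends x to x^A (x) (1 (x) x^D), its inverse
   glues x^A a and x^D; a rectangle crossing Z is cut into a half-strip on either
   side, which are matched by the balancing relation. *)

Set Implicit Arguments.
Unset Strict Implicit.
Unset Printing Implicit Defensive.

Import Order.TTheory GRing.Theory Num.Theory.
Local Open Scope ring_scope.

(** * Kendall distance *)

Section KendallDistance.
Variable I : finType.
Implicit Types (u v w x y : I -> nat) (t : {perm I}) (a b m l : I).

(** The theorem quantifies over every action satisfying the axioms on idempotents and on the [rho],
    so nothing can be computed with [act] until it is identified with a closed formula; this is why
    uniqueness comes before the pairing. The closed formula is one distance condition times one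
    weight, which replaces the case analysis on the relative position of two regions: conditions are
    compared by triangle inequalities, and weights telescope along any path. The square of the
    differential of CP thereby reduces to an unweighted statement on the symmetric group. There
    [flat_diff] is the sum over lower covers in the Bruhat order whose length function is the number
    of ascents, and [crossing_mul] is right multiplication by a generator of the nilCoxeter algebra.
    The differential of the tensor product is not squared directly: it is shown to be well defined,
    and the axioms of a complex are transported from CP through the bijection. *)

Definition kdist u v : nat :=
  (\sum_m \sum_l ((u m < u l) && (v l < v m))%N)%N.

Lemma eq_kdist u u' v v' : u =1 u' -> v =1 v' -> kdist u v = kdist u' v'.
Proof.
by move=> eu ev; apply: eq_bigr => m _; apply: eq_bigr => l _; rewrite !eu !ev.
Qed.

Lemma kdistC u v : kdist u v = kdist v u.
Proof.
rewrite /kdist exchange_big; apply: eq_bigr => m _; apply: eq_bigr => l _.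
by rewrite andbC.
Qed.

Lemma kdistxx u : kdist u u = 0%N.
Proof. by apply: big1 => m _; apply: big1 => l _; lia. Qed.

Lemma kdist_perm u v t : kdist (u \o t) (v \o t) = kdist u v.
Proof.
rewrite /kdist [RHS](reindex_inj (@perm_inj _ t)); apply: eq_bigr => m _ /=.
by rewrite [RHS](reindex_inj (@perm_inj _ t)).
Qed.

(** A pair reversed from [u] to [v] and back from [v] to [w] counts twice in the sum of the two
    distances and not at all in [kdist u w]; every other pair contributes equally to both sides. *)
Lemma kdist_triangle_eqP u v w :
    injective u -> injective v -> injective w ->
  (kdist u w <= kdist u v + kdist v w)%N /\
  ((kdist u w == kdist u v + kdist v w)%N =
   [forall m, forall l, ~~ [&& u m < u l, v l < v m & w m < w l]%N]).
Proof.
move=> injU injV injW.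
pose bad m l : nat := [&& u m < u l, v l < v m & w m < w l]%N.
have key : (kdist u v + kdist v w = kdist u w + \sum_m \sum_l (bad m l).*2)%N.
  have -> : (kdist u v + kdist v w =
     \sum_m \sum_l (((u m < u l) && (v l < v m))
                    + ((v m < v l) && (w l < w m))))%N.
    by rewrite /kdist -big_split; apply: eq_bigr => m _; rewrite -big_split.
  (* The identity holds only for (m, l) and (l, m) taken together: a pair restored by [w] is counted
     the second time in the opposite order. *)
  have sym (F G : I -> I -> nat) :
      (forall m l, F m l + F l m = G m l + G l m)%N ->
      (\sum_m \sum_l F m l = \sum_m \sum_l G m l)%N.
    have dbl (F' : I -> I -> nat) : ((\sum_m \sum_l F' m l).*2 =
        \sum_m \sum_l (F' m l + F' l m))%N.
      rewrite -addnn {2}exchange_big -big_split; apply: eq_bigr => m _.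
      by rewrite -big_split.
    move=> FG; apply: double_inj; rewrite !dbl.
    by apply: eq_bigr => m _; apply: eq_bigr => l _.
  rewrite /kdist -big_split /=; under [RHS]eq_bigr do rewrite -big_split /=.
  apply: sym => m l; rewrite /bad.
  have [->|/eqP ml] := eqVneq m l; first by lia.
  have un e := ml (injU m l e); have vn e := ml (injV m l e).
  have wn e := ml (injW m l e); lia.
split; first by lia.
rewrite key -{1}[kdist u w]addn0 eqn_add2l eq_sym sum_nat_eq0.
apply: eq_forallb => m; rewrite sum_nat_eq0; apply: eq_forallb => l.
by rewrite double_eq0 /bad; case: [&& _, _ & _].
Qed.

Lemma kdist_triangle u v w : injective u -> injective v -> injective w ->
  (kdist u w <= kdist u v + kdist v w)%N.
Proof. by move=> iu iv iw; have [] := kdist_triangle_eqP iu iv iw. Qed.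

Lemma kdist_triangle_eq u v w : injective u -> injective v -> injective w ->
  (kdist u w == kdist u v + kdist v w)%N =
   [forall m, forall l, ~~ [&& u m < u l, v l < v m & w m < w l]%N].
Proof. by move=> iu iv iw; have [] := kdist_triangle_eqP iu iv iw. Qed.

(** The pair a, b accounts for one; a third line contributes two if it lies between a and b in both
    orders, and nothing otherwise; pairs avoiding a and b are unchanged. *)
Lemma kdist_swap u v a b : injective u -> injective v ->
    (u a < u b)%N -> (v b < v a)%N ->
  kdist u v = (kdist u (v \o tperm a b) +
    (\sum_(m | (u a < u m < u b) && (v b < v m < v a)) 1).*2.+1)%N.
Proof.
move=> iu iv uab vba; set t := tperm a b.
have nab : b != a by apply: contraTneq uab => ->; rewrite ltnn.
pose F m l := ((u m < u l) && (v l < v m))%N : nat.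
pose G m l := ((u m < u l) && (v (t l) < v (t m)))%N : nat.
pose B m : nat := ((u a < u m < u b) && (v b < v m < v a))%N.
have split2 (f : I -> nat) :
    (\sum_m f m = f a + (f b + \sum_(m | (m != a) && (m != b)) f m))%N.
  by rewrite (bigD1 a) //= (bigD1 b) //=.
have ne m : (m != a) && (m != b) ->
    [/\ t m = m, u m <> u a, u m <> u b, v m <> v a & v m <> v b].
  case/andP=> /eqP ma /eqP mb; split; try by move/iu.
  - by rewrite tpermD // eq_sym; apply/eqP.
  - by move/iv.
  - by move/iv.
have [ta tb] : t a = b /\ t b = a by rewrite /t tpermL tpermR.
have -> : (\sum_(m | (u a < u m < u b) && (v b < v m < v a)) 1 =
           \sum_(m | (m != a) && (m != b)) B m)%N.
  rewrite big_mkcond split2 /= !ltnn /= !andbF /= !add0n.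
  by apply: eq_bigr => m _; rewrite /B; case: ifP.
have e1 : (F a a + F a b + F b a + F b b = 1)%N by rewrite /F; lia.
have e2 : (G a a + G a b + G b a + G b b = 0)%N by rewrite /G ta tb; lia.
have rows m : (m != a) && (m != b) ->
    (F m a + F m b + F a m + F b m = G m a + G m b + G a m + G b m + (B m).*2)%N.
  by case/ne=> tm ? ? ? ?; rewrite /F /G /B ta tb tm; lia.
have total (f : I -> I -> nat) : (\sum_m \sum_l f m l =
    f a a + f a b + f b a + f b b +
    \sum_(m | (m != a) && (m != b)) (f m a + f m b + f a m + f b m) +
    \sum_(m | (m != a) && (m != b)) \sum_(l | (l != a) && (l != b)) f m l)%N.
  rewrite split2 (split2 (f a)) (split2 (f b)).
  under [X in (_ + (_ + X))%N]eq_bigr => m _ do rewrite split2.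
  by rewrite !big_split /=; lia.
rewrite -[kdist u v]/(\sum_m \sum_l F m l)%N.
rewrite -[kdist _ _]/(\sum_m \sum_l G m l)%N !total e1 e2 (eq_bigr _ rows).
rewrite big_split /= -[in RHS]muln2 big_distrl /=.
under [X in (1 + (_ + X))%N]eq_bigr do rewrite -muln2.
have -> : (\sum_(m | (m != a) && (m != b)) \sum_(l | (l != a) && (l != b)) F m l =
    \sum_(m | (m != a) && (m != b)) \sum_(l | (l != a) && (l != b)) G m l)%N.
  apply: eq_bigr => m /ne[tm _ _ _ _]; apply: eq_bigr => l /ne[tl _ _ _ _].
  by rewrite /F /G tm tl.
lia.
Qed.

Lemma comp_tperm_inj v a b : injective v -> injective (v \o tperm a b).
Proof. by move=> iv; apply: inj_comp => //; apply: perm_inj. Qed.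

Lemma comp_tpermK v a b : (v \o tperm a b) \o tperm a b =1 v.
Proof. by move=> m /=; rewrite tpermK. Qed.

Lemma kdist_swap_cmp u v a b : injective u -> injective v -> a != b ->
  if (u a < u b)%N == (v b < v a)%N
  then (kdist u (v \o tperm a b) < kdist u v)%N
  else (kdist u v < kdist u (v \o tperm a b))%N.
Proof.
move=> iu iv ab.
wlog uab : a b ab / (u a < u b)%N => [W|].
  have nu : u a <> u b by move/iu/eqP; rewrite (negPf ab).
  have nv : v a <> v b by move/iv/eqP; rewrite (negPf ab).
  have [ab'|ba] := orP (orbN (u a < u b)%N); first exact: W.
  have := W b a; rewrite eq_sym tpermC => /(_ ab).
  have ba' : (u b < u a)%N by lia.
  by move=> /(_ ba'); case: ifP => c1; case: ifP => c2; lia.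
rewrite uab; case: ltnP => [vba|vab] /=; first
  by rewrite (kdist_swap iu iv uab vba); lia.
(* If [u] and [v] order a, b alike, then [u] and the exchanged function disagree on them, and the
   formula applies to that function. *)
have iv' := @comp_tperm_inj v a b iv.
have := kdist_swap iu iv' uab; rewrite /= tpermL tpermR => -> //.
  by rewrite (eq_kdist (frefl u) (comp_tpermK v a b)); lia.
have nv : v a <> v b by move/iv/eqP; rewrite (negPf ab).
by lia.
Qed.

(* A, B, C are the pairwise distances of w, x, y, and primes record the effect
   of the transposition of a and b on the second argument; by the triangle
   inequality the three conditions below are those under which the
   corresponding terms of the Leibniz rule do not vanish. *)
Lemma kdist_leibniz w x y a b :
    injective w -> injective x -> injective y -> a != b ->
  let t := tperm a b in
  let A := kdist w x in let A' := kdist w (x \o t) in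
  let B := kdist x y in let B' := kdist x (y \o t) in
  let C := kdist w y in let C' := kdist w (y \o t) in
  ((C == A + B) && (C'.+1 == C) =
   ((A'.+1 == A) && (C' == A' + B)) (+) ((B'.+1 == B) && (C' == A + B')))%N.
Proof.
move=> iw ix iy ab t A A' B B' C C'.
have nx : x a <> x b by move/ix/eqP; rewrite (negPf ab).
have ny : y a <> y b by move/iy/eqP; rewrite (negPf ab).
have nw : w a <> w b by move/iw/eqP; rewrite (negPf ab).
have t1 : (C <= A + B)%N by apply: kdist_triangle.
have t2 : (C' <= A' + B)%N.
  by rewrite /B -(kdist_perm x y t); apply: kdist_triangle => //;
    apply: comp_tperm_inj.
have t3 : (C' <= A + B')%N by apply: kdist_triangle => //; apply: comp_tperm_inj.
have := kdist_swap_cmp iw ix ab; rewrite -/t -/A -/A'.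
have := kdist_swap_cmp iw iy ab; rewrite -/t -/C -/C'.
have := kdist_swap_cmp ix iy ab; rewrite -/t -/B -/B'.
(* If [w] and [y] disagree on a, b, exactly one of the pairs w, x and x, y does, and its term is
   equivalent to the left side. If they agree, the left side is false and the two terms on the right
   are equal. *)
move: A A' B B' C C' t1 t2 t3.
case: (ltngtP (x a) (x b)) nx => // _ _; case: (ltngtP (y a) (y b)) ny => // _ _;
case: (ltngtP (w a) (w b)) nw => // _ _ /=; lia.
Qed.

End KendallDistance.

(** * Linear maps on free modules and tensor products *)

Section LinearMaps.
Variables (R : comNzRingType) (M P : lmodType R) (F : M -> P).
Hypothesis linF : linear F.

Lemma lin0 : F 0 = 0.
Proof. by have := linF (-1) 0 0; rewrite scaleN1r oppr0 addr0 scaleN1r addNr. Qed.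

Lemma linD u v : F (u + v) = F u + F v.
Proof. by have := linF 1 u v; rewrite !scale1r. Qed.

Lemma linZ c u : F (c *: u) = c *: F u.
Proof. by have := linF c u 0; rewrite !addr0 lin0 addr0. Qed.

Lemma lin_sum (I : Type) (r : seq I) (S : pred I) (G : I -> M) :
  F (\sum_(i <- r | S i) G i) = \sum_(i <- r | S i) F (G i).
Proof. by apply: big_morph; [exact: linD | exact: lin0]. Qed.

End LinearMaps.

Section FreegModule.
Variables (R : comNzRingType) (K : choiceType).
Implicit Types (v : {freeg K / R}) (x : K) (c : R).

Lemma scale_freegU c x : c *: << x >> = << c *g x >> :> {freeg K / R}.
Proof. by apply/eqP/freeg_eqP => z; rewrite coeffZ !coeffU mul1r. Qed.

Lemma freeg_sum_dom v : v = \sum_(x <- dom v) coeff x v *: << x >>.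
Proof.
by rewrite -[LHS]freeg_sumE; apply: eq_bigr => x _; rewrite scale_freegU.
Qed.

Variable M : lmodType R.

Lemma fglift_linear (f : K -> M) : linear (fglift f).
Proof. by move=> c u v; rewrite fgliftD fgliftZ. Qed.

Lemma fgliftU (f : K -> M) x : fglift f << x >> = f x.
Proof. by rewrite liftU scale1r. Qed.

Lemma fglift_ext (F G : {freeg K / R} -> M) : linear F -> linear G ->
  (forall x, F << x >> = G << x >>) -> F =1 G.
Proof.
move=> lF lG FG v; rewrite (freeg_sum_dom v) (lin_sum lF) (lin_sum lG).
by apply: eq_bigr => x _; rewrite (linZ lF) (linZ lG) FG.
Qed.

Lemma fglift_sum v (f : K -> M) :
  fglift f v = \sum_(x <- dom v) coeff x v *: f x.
Proof.
rewrite {1}(freeg_sum_dom v) (lin_sum (@fglift_linear f)).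
by apply: eq_bigr => x _; rewrite (linZ (@fglift_linear f)) fgliftU.
Qed.

Lemma fglift_lin_fun (P : lmodType R) (f : P -> K -> M) :
  (forall x, linear (f^~ x)) -> forall v, linear (fun p => fglift (f p) v).
Proof.
move=> lf v c p q; rewrite !fglift_sum scaler_sumr -big_split.
apply: eq_bigr => x _ /=; have /= -> := lf x c p q.
by rewrite scalerDr !scalerA mulrC.
Qed.

End FreegModule.

Section TensorModule.
Variables (R : comNzRingType) (M P : lmodType R) (B : Type).
Variables (ract : M -> B -> M) (lact : B -> P -> P).

Lemma tens_linr p : linear (tens ract lact p).
Proof. by move=> c q q'; rewrite tensDr tensZr. Qed.

Lemma tens_linl q : linear ((tens ract lact)^~ q).
Proof. by move=> c p p'; rewrite tensDl tensZl. Qed.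

Lemma tensor_ext (Q : lmodType R) (F G : tensor ract lact -> Q) :
  linear F -> linear G ->
  (forall p q, F (tens ract lact p q) = G (tens ract lact p q)) -> F =1 G.
Proof.
move=> lF lG FG; apply: tensor_ind => [|p q|t t' Ft Ft'].
- by rewrite (lin0 lF) (lin0 lG).
- exact: FG.
- by rewrite (linD lF) (linD lG) Ft Ft'.
Qed.

Lemma tens_lift_lin (Q : lmodType R) (f : M -> P -> Q) :
  balanced ract lact f -> linear (tens_lift f : tensor ract lact -> Q).
Proof. by move=> fB c t t'; apply: tens_lift_linear. Qed.

Lemma tens_lift_linl (C Q : lmodType R) (f : C -> M -> P -> Q)
    (t : tensor ract lact) :
  (forall p q, linear (fun c => f c p q)) -> linear (fun c => tens_lift (f c) t).
Proof.
move=> lf; apply: (@fglift_lin_fun _ _ _ _ (fun c (pq : M * P) => f c pq.1 pq.2)).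
by move=> [p q]; apply: lf.
Qed.

End TensorModule.

(** * Characteristic two and homogeneous elements of free modules *)

Section Char2.
Variable N : nat.
Local Notation A := {mpoly 'F_2[N]}.

Lemma mpolyF2_addr1 : 1 + 1 = 0 :> A.
Proof. by rewrite -[1]/(1%:MP) -mpolyCD (_ : 1 + 1 = 0 :> 'F_2) //;
  apply/val_inj. Qed.

Lemma mpolyF2_char2 (M : lmodType A) (v : M) : v + v = 0.
Proof. by rewrite -[v]scale1r -scalerDl mpolyF2_addr1 scale0r. Qed.

Lemma natr_addb (b1 b2 : bool) : ((b1 (+) b2)%:R : A) = b1%:R + b2%:R.
Proof. by case: b1; case: b2; rewrite ?addr0 ?add0r // mpolyF2_addr1. Qed.

Lemma F2_neq0 (c : 'F_2) : c != 0 -> c = 1.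
Proof. by case: c => [[|[|]]] // ? _; apply/val_inj. Qed.

(** The amount by which a monomial lowers the bidegree, each variable having bidegree (-1, -2). *)
Definition mbideg (m : 'X_{1..N}) : int * int := ((mdeg m)%:Z, (2 * mdeg m)%:Z).

Lemma mbidegD m m' : mbideg (m + m')%MM = mbideg m + mbideg m'.
Proof. by rewrite /mbideg mdegD mulnDr !PoszD. Qed.

End Char2.

Section FreeHom.
Variables (N : nat) (K : choiceType) (deg : K -> int * int).
Local Notation A := {mpoly 'F_2[N]}.
Implicit Types (v : {freeg K / A}) (e : int * int).

Lemma free_hom0 e : free_hom deg e (0 : {freeg K / A}).
Proof. by move=> g m; rewrite coeff0 msupp0. Qed.

Lemma free_homD e v w :
  free_hom deg e v -> free_hom deg e w -> free_hom deg e (v + w).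
Proof.
move=> hv hw g m; rewrite coeffD => /msuppD_le; rewrite mem_cat.
by case/orP; [apply: hv | apply: hw].
Qed.

Lemma free_homX e m v :
  free_hom deg e v -> free_hom deg (e - mbideg m) ('X_[m] *: v).
Proof.
move=> hv g m'; rewrite coeffZ mulrC (perm_mem (msuppMX _ _)).
case/mapP=> m1 /hv -> ->; rewrite -!/(mbideg _) (mbidegD m m1).
by rewrite opprD addrA addrAC.
Qed.

Lemma free_homU g : free_hom deg (deg g) (<< g >> : {freeg K / A}).
Proof.
move=> g' m; rewrite coeffU mul1r; case: eqP => [->|_]; last by rewrite msupp0.
by rewrite msupp1 inE => /eqP ->; rewrite mdeg0 muln0 subr0.
Qed.

(** Closure under sums and monomials is enough for [homQ], since a nonzero coefficient in the field
    with two elements is 1. *)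
Lemma fglift_hom (Q : lmodType A) (homQ : int * int -> Q -> Prop)
    (f : K -> Q) e0 e v :
  (forall e', homQ e' 0) ->
  (forall e' p q, homQ e' p -> homQ e' q -> homQ e' (p + q)) ->
  (forall e' m q, homQ e' q -> homQ (e' - mbideg m) ('X_[m] *: q)) ->
  (forall x, homQ (deg x + e0) (f x)) ->
  free_hom deg e v -> homQ (e + e0) (fglift f v).
Proof.
move=> h0 hD hX hf hv; rewrite fglift_sum; apply: big_ind => //; first exact: hD.
move=> x _; rewrite [coeff x v]mpolyE scaler_suml big_seq_cond.
apply: big_ind => //; first exact: hD.
move=> m /andP[mx _]; rewrite (hv _ _ mx) addrAC.
move: mx; rewrite mcoeff_msupp => /F2_neq0 ->; rewrite scale1r.
exact: hX.
Qed.

(** A generator and a monomial determine a bidegree, so components of different bidegrees have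
    disjoint supports. *)
Lemma free_hom_indep (s : seq (int * int)) (c : int * int -> {freeg K / A}) :
  uniq s -> (forall e, free_hom deg e (c e)) -> \sum_(e <- s) c e = 0 ->
  forall e, e \in s -> c e = 0.
Proof.
move=> us hc sum0 e es; apply/eqP/freeg_eqP => g; rewrite coeff0.
apply/mpolyP => m; rewrite mcoeff0; apply/eqP;
  rewrite -[_ == 0]negbK -mcoeff_msupp.
apply/negP => me; have e_def := hc _ _ _ me.
have : (coeff g (\sum_(e <- s) c e))@_m = 0 by rewrite sum0 coeff0 mcoeff0.
rewrite raddf_sum raddf_sum (bigD1_seq e) //= big1 => [|e' ne].
  by rewrite addr0 => /eqP; rewrite -[_ == 0]negbK -mcoeff_msupp me.
apply/eqP; rewrite -[_ == 0]negbK -mcoeff_msupp; apply/negP => /hc e'_def.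
by rewrite e'_def e_def eqxx in ne.
Qed.

Lemma free_hom_span v : exists (s : seq (int * int)) (c
  : int * int -> {freeg K / A}),
  [/\ uniq s, forall e, free_hom deg e (c e) & v = \sum_(e <- s) c e].
Proof.
pose d (x : K) (m : 'X_{1..N}) : int * int := deg x - mbideg m.
(* The terms of v are grouped by the bidegrees that occur among them. *)
exists (undup [seq d x m | x <- dom v, m <- msupp (coeff x v)]).
exists (fun e => \sum_(x <- dom v) \sum_(m <- msupp (coeff x v) | d x m == e)
  ('X_[m] : A) *: << x >>); split; first exact: undup_uniq.
  move=> e; apply: big_ind => [||x _]; [exact: free_hom0|exact: free_homD|].
  apply: big_ind => [||m /eqP<-]; [exact: free_hom0|exact: free_homD|].
  exact/free_homX/free_homU.
rewrite exchange_big /= {1}(freeg_sum_dom v) big_seq [RHS]big_seq.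
apply: eq_bigr => x xv; rewrite (exchange_big_dep xpredT) //=.
rewrite {1}[coeff x v]mpolyE scaler_suml big_seq [RHS]big_seq.
apply: eq_bigr => m mx; rewrite -big_filter.
have -> : [seq i <- undup [seq d x m | x <- dom v, m <- msupp (coeff x v)]
             | d x m == i] = [:: d x m].
  apply/perm_small_eq => //; apply: uniq_perm => //.
    by rewrite filter_uniq // undup_uniq.
  move=> e; rewrite mem_filter mem_undup inE eq_sym.
  case: eqP => // ->; apply/allpairsPdep; by exists x, m.
rewrite big_seq1; move: mx; rewrite mcoeff_msupp => /F2_neq0 ->.
by rewrite scale1r.
Qed.

End FreeHom.

(** * Rectangles, lengths and multiplicities *)

Section Diagram.
Variables (N : nat) (H : grid N) (D : {set 'I_N}).
Variables (I : finType) (col : I -> 'I_N.+1).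
Hypothesis col_inj : injective col.
Local Notation A := {mpoly 'F_2[N]}.
Implicit Types (x y z : I -> 'I_N.+1) (P : 'S_N) (c : 'I_N).

Definition hgt x (m : I) : nat := x m.
(* Reversing the columns makes the ascending pairs of a generator, which are the
   corners of rectangles, into disagreements. *)
Definition rcol (m : I) : nat := (N - col m)%N.
Definition asc x : nat := kdist rcol (hgt x).

Lemma rcol_inj : injective rcol.
Proof.
move=> m l e; apply/col_inj/val_inj; move: e; rewrite /rcol /=.
by have := ltn_ord (col m); have := ltn_ord (col l); lia.
Qed.

Lemma hgt_inj x : injective x -> injective (hgt x).
Proof. by move=> ix m l /val_inj /ix. Qed.

(* The multiplicity of a rectangle or half-strip at the marking of column c is
   the variation of [pot] between its initial and final generators. *)
Definition pot P c x : nat := (\sum_(m | (col m <= c)%N) (P c < x m)%N)%N.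

(** The weight of a domain from x to y: zero if it meets an X marking, and otherwise with its
    multiplicities at the O markings as exponents. The truncated subtraction is exact when
    [pot_le x y]. *)
Definition wt x y : A :=
  if [forall c in D, pot (Defs.permX H) c x == pot (Defs.permX H) c y]
  then \prod_(c in D) 'X_c ^+ (pot (permO H) c y - pot (permO H) c x) else 0.

Definition pot_le x y := forall P c, c \in D -> (pot P c x <= pot P c y)%N.

(** Exponents telescope; as potentials never decrease, equality at an X marking between x and z
    forces equality at y. *)
Lemma wt_mul x y z : pot_le x y -> pot_le y z -> wt x y * wt y z = wt x z.
Proof.
move=> xy yz; rewrite /wt.
pose E u v := [forall c in D, pot (Defs.permX H) c u == pot (Defs.permX H) c v].
rewrite -!/(E _ _); have -> : E x z = E x y && E y z.
  rewrite /E; apply/forall_inP/andP => [exz|[/forall_inP exy /forall_inP eyz] c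
    cD].
    by split; apply/forall_inP => c cD; move/eqP: (exz c cD) => ?;
      have := xy (Defs.permX H) c cD; have := yz (Defs.permX H) c cD; lia.
  by rewrite (eqP (exy c cD)) eyz.
case: (E x y); last by rewrite mul0r.
case: (E y z); last by rewrite mulr0.
rewrite -big_split; apply: eq_bigr => c cD /=; rewrite -exprD.
by congr (_ ^+ _); have := xy (permO H) c cD; have := yz (permO H) c cD; lia.
Qed.

Lemma eq_pot P c x y : x =1 y -> pot P c x = pot P c y.
Proof. by move=> xy; apply: eq_bigr => m _; rewrite xy. Qed.

Lemma eq_wt x x' y y' : x =1 x' -> y =1 y' -> wt x y = wt x' y'.
Proof.
move=> ex ey; rewrite /wt; congr (if _ then _ else _).
  by apply: eq_forallb => c; rewrite (eq_pot _ _ ex) (eq_pot _ _ ey).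
by apply: eq_bigr => c _; rewrite (eq_pot _ _ ex) (eq_pot _ _ ey).
Qed.

Lemma eq_pot_le x x' y y' : x =1 x' -> y =1 y' -> pot_le x y -> pot_le x' y'.
Proof. by move=> ex ey h P c cD; rewrite -(eq_pot _ _ ex) -(eq_pot _ _ ey) h. Qed.

Lemma wtxx x : wt x x = 1.
Proof.
rewrite /wt; case: forall_inP => [_|[c _]//].
by rewrite big1 // => c _; rewrite subnn.
Qed.

(** The common criterion for rectangles and half-strips. *)
Lemma wt_region x y (R : rectangle) :
  (forall P c, c \in D ->
     pot P c y = (interior R (mark c, mark (P c)) + pot P c x)%N) ->
  pot_le x y /\ (Xcount H D R == 0%N)%:R * Uweight H D R = wt x y.
Proof.
move=> hR; split=> [P c cD|]; first by rewrite hR // leq_addl.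
rewrite /wt /Xcount /Uweight sum_nat_eq0.
rewrite (_ : [forall c in D, pot (Defs.permX H) c x == _] =
             [forall c in D, (interior R (Xpt H c) : nat) == 0%N]); last first.
  apply/eq_forallb => c; apply: implyb_id2l => cD; rewrite hR //.
  by rewrite -{1}[pot _ _ x]add0n eqn_add2r eq_sym.
case: ifP => _; last by rewrite mul0r.
rewrite mul1r; apply: eq_bigr => c cD; rewrite hR //.
by rewrite addnK.
Qed.

(** A marking sits half a unit after the line of the same number, hence one weak and one strict
    inequality in each direction. *)
Lemma interior_rect x a b c (p : nat) :
  interior (rect col x a b) (mark c, mark p) =
  ((col a <= c < col b) && (x a <= p < x b))%N.
Proof. by rewrite /interior /rect /line /mark /=; lia. Qed.

Lemma pot_swap P c x a b : (col a < col b)%N -> (x a < x b)%N ->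
  pot P c (x \o tperm a b) =
  (interior (rect col x a b) (mark c, mark (P c)) + pot P c x)%N.
Proof.
move=> cab xab; rewrite interior_rect.
have nab : b != a by apply: contraTneq cab => ->; rewrite ltnn.
have split2 (f : I -> nat) : (\sum_(m | (col m <= c)%N) f m =
    (if col a <= c then f a else 0) + ((if col b <= c then f b else 0) +
    \sum_(m | (m != a) && (m != b)) if col m <= c then f m else 0))%N.
  by rewrite big_mkcond (bigD1 a) //= (bigD1 b).
rewrite /pot !split2 /= tpermL tpermR.
rewrite (eq_bigr (fun m => if (col m <= c)%N then (P c < x m : nat)%N else 0%N)).
  by case: (leqP (col a) c) => ?; case: (leqP (col b) c) => ?; lia.
by move=> m /andP[ma mb]; rewrite tpermD // eq_sym.
Qed.

Lemma wt_rect x a b : (col a < col b)%N -> (x a < x b)%N ->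
  pot_le x (x \o tperm a b) /\
  (Xcount H D (rect col x a b) == 0%N)%:R * Uweight H D (rect col x a b) =
    wt x (x \o tperm a b).
Proof. by move=> cab xab; apply: wt_region => P c _; apply: pot_swap. Qed.

Lemma asc_swap_gt x a b : injective x -> (col a < col b)%N ->
  (asc (x \o tperm a b) < asc x)%N -> (x a < x b)%N.
Proof.
move=> ix cab; have nab : a != b by apply: contraTneq cab => ->; rewrite ltnn.
have := kdist_swap_cmp rcol_inj (hgt_inj ix) nab.
rewrite (_ : (rcol a < rcol b)%N = false); last first.
  by rewrite /rcol; have := ltn_ord (col a); lia.
have nx : (x a : nat) <> x b by move/val_inj/ix/eqP; rewrite (negPf nab).
rewrite -[kdist rcol (hgt x)]/(asc x) -[kdist _ _]/(asc (x \o tperm a b)).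
rewrite -[hgt x b]/(x b : nat) -[hgt x a]/(x a : nat).
by case: (ltngtP (x a) (x b)) nx => //= _ _; lia.
Qed.

(** By [kdist_swap] an exchange along a rectangle lowers the number of ascents by one plus twice the
    number of points inside it. *)
Lemma is_rectE x y a b : injective x ->
  is_rect col x y a b =
  [&& (col a < col b)%N, [forall m, y m == x (tperm a b m)]
    & (asc (x \o tperm a b)).+1 == asc x].
Proof.
move=> ix; rewrite /is_rect; case: ltnP => //= cab.
have nab : b != a by apply: contraTneq cab => ->; rewrite ltnn.
have yE : [&& y a == x b, y b == x a
            & [forall m, (m != a) && (m != b) ==> (y m == x m)]] =
          [forall m, y m == x (tperm a b m)].
  apply/and3P/forallP => [[ya yb /forallP ym] m|ym].
    by case: tpermP => [->|->|/eqP ma /eqP mb] //; have := ym m; rewrite ma mb.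
  split; first by have := ym a; rewrite tpermL.
    by have := ym b; rewrite tpermR.
  apply/forallP => m; apply/implyP => /andP[ma mb].
  by have := ym m; rewrite tpermD // eq_sym.
rewrite -yE; apply/idP/idP.
  case/and5P => xab -> -> -> /forallP em /=.
  have wba : (rcol b < rcol a)%N by rewrite /rcol; have := ltn_ord (col b); lia.
  have := kdist_swap rcol_inj (hgt_inj ix) wba xab.
  rewrite big1 => [|m /andP[w1 w2]]; last first.
    exfalso; apply/negP: (em m); rewrite negbK /interior /= /line.
    move: w1 w2; rewrite /rcol /hgt.
    by have := ltn_ord (col b); have := ltn_ord (col m); lia.
  by rewrite tpermC -/(asc x) => ->; rewrite addn1.
case/andP=> /and3P[-> -> ->] /eqP h.
have xab : (x a < x b)%N by apply: asc_swap_gt => //; rewrite -h.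
rewrite xab /=; apply/forallP => m; apply/negP => em.
have wba : (rcol b < rcol a)%N by rewrite /rcol; have := ltn_ord (col b); lia.
have := kdist_swap rcol_inj (hgt_inj ix) wba xab.
rewrite tpermC -/(asc x) -[kdist _ (_ \o _)]/(asc (x \o tperm a b)) -h.
rewrite (bigD1 m); last first.
  move: em; rewrite /interior /rect /pt /line /rcol /hgt /=.
  by have := ltn_ord (col b); have := ltn_ord (col a); lia.
by rewrite /=; lia.
Qed.

Variables (G : finType) (ht : G -> I -> 'I_N.+1) (swap : G -> I -> I -> G).
Hypothesis ht_inj : forall x : G, injective (ht x).
Hypothesis ht_eq : forall x y : G, ht x =1 ht y -> x = y.
Hypothesis ht_swap : forall (x : G) a b, ht (swap x a b) =1 ht x \o tperm a b.

Definition rect_coef (x y : G) : A :=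
  ((asc (ht y)).+1 == asc (ht x))%:R * wt (ht x) (ht y).

Lemma eq_asc x y : x =1 y -> asc x = asc y.
Proof. by move=> xy; apply: eq_kdist => // m; rewrite /hgt xy. Qed.

(** The two columns determine the final generator, and a drop in ascents already forces the corners
    to be in rising position. *)
Lemma rect_sumE (V : lmodType A) (gen : G -> V) (x : G) :
  rect_sum H D col ht gen x =
  \sum_a \sum_(b | (col a < col b)%N)
    rect_coef x (swap x a b) *: gen (swap x a b).
Proof.
rewrite /rect_sum exchange_big; apply: eq_bigr => a _ /=.
rewrite (exchange_big_dep xpredT) //= [RHS]big_mkcond; apply: eq_bigr => b _.
case: ifP => cab; last first.
  by apply: big1 => y; rewrite is_rectE // cab.
rewrite (eq_bigl (fun y : G => (y == swap x a b) &&
  (((asc (ht y)).+1 == asc (ht x)) &&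
    (Xcount H D (rect col (ht x) a b) == 0%N)))); last first.
  move=> y; rewrite is_rectE // cab /= andbA; congr (_ && _).
  apply/andP/andP => [[/forallP e l]|[/eqP -> l]].
    have -> : y = swap x a b.
      by apply: ht_eq => m; rewrite ht_swap; apply/eqP.
    by rewrite eqxx (eq_asc (ht_swap x a b)).
  by split; [apply/forallP => m; rewrite ht_swap | rewrite -(eq_asc (ht_swap x
    a b))].
rewrite big_mkcondr big_pred1_eq /rect_coef.
case: eqP => [h|_] /=; last by rewrite mul0r scale0r.
have xab : (ht x a < ht x b)%N.
  by apply: asc_swap_gt => //; rewrite -h (eq_asc (ht_swap x a b)).
rewrite mul1r (eq_wt (frefl _) (ht_swap x a b)) -(wt_rect cab xab).2.
by case: eqP => _; rewrite ?mul1r // mul0r scale0r.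
Qed.

Lemma rect_coef_pot_le (x : G) a b : (col a < col b)%N ->
  ((asc (ht (swap x a b))).+1 == asc (ht x)) ->
  pot_le (ht x) (ht (swap x a b)).
Proof.
move=> cab; rewrite (eq_asc (ht_swap x a b)) => /eqP h.
have xab : (ht x a < ht x b)%N by apply: asc_swap_gt => //; rewrite -h.
apply: eq_pot_le (wt_rect cab xab).1 => //.
by move=> m; rewrite ht_swap.
Qed.
End Diagram.

(** * Bidegrees of generators and of weights *)

Section Degrees.
Variables (N : nat) (H : grid N) (D : {set 'I_N}).
Variables (I : finType) (col : I -> 'I_N.+1).
Local Notation A := {mpoly 'F_2[N]}.
Implicit Types (x y : I -> 'I_N.+1) (P : 'S_N).

Definition gdeg x : int * int :=
  (Icount (Xpts H D) (pts col x) - Icount (Opts H D) (pts col x),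
   Icount (pts col x) (pts col x) - 2 * Icount (Opts H D) (pts col x)).

(** Only heights are compared, so this is invariant under permuting the points; removing the points
    to the left of each marking, which [potsum] counts, leaves [Icount]. *)
Definition tot P x : nat := (\sum_(c in D) \sum_m (P c < x m)%N)%N.
Definition potsum P x : nat := (\sum_(c in D) pot col P c x)%N.

Lemma Icount_marks P x :
  Icount [seq (mark (c : 'I_N), mark (P c)) | c <- enum D] (pts col x) =
  (tot P x)%:Z - (potsum P x)%:Z.
Proof.
pose S := (\sum_(c in D) \sum_m ((c < col m) && (P c < x m)))%N.
have -> : tot P x = (potsum P x + S)%N.
  rewrite -big_split; apply: eq_bigr => c _ /=.
  rewrite /pot [X in (X + _)%N]big_mkcond -big_split; apply: eq_bigr => m _ /=.
  by case: (leqP (col m) c) => _; rewrite ?addn0.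
have -> : (potsum P x + S)%N%:Z - (potsum P x)%:Z = S%:Z by lia.
rewrite /Icount big_map big_enum /= (big_morph Posz PoszD (erefl _));
  apply: eq_bigr => c _.
rewrite -sum1_count big_mkcond big_map big_enum; congr Posz.
apply: eq_bigr => m _; rewrite -[if _ then _ else _]/(nat_of_bool _);
  congr nat_of_bool.
by rewrite /below /pt /mark /line /=; lia.
Qed.

Lemma Icount_pts x : Icount (pts col x) (pts col x) = (asc col x)%:Z.
Proof.
rewrite /Icount big_map big_enum /asc kdistC (big_morph Posz PoszD (erefl _)).
apply: eq_bigr => m _; rewrite -sum1_count big_mkcond big_map big_enum;
  congr Posz.
apply: eq_bigr => l _; rewrite -[if _ then _ else _]/(nat_of_bool _);
  congr nat_of_bool.
rewrite /below /pt /line /rcol /hgt /=.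
by have := ltn_ord (col m); have := ltn_ord (col l); lia.
Qed.

(** The degree of the weight cancels the variation of [potsum]. The remaining [tot] terms vanish for
    rectangles and give the degree of the strand diagram for the action. *)
Lemma gdeg_step x y (n := (potsum (permO H) y - potsum (permO H) x)%N) :
  pot_le D col x y -> wt H D col x y != 0 ->
  gdeg y - (n%:Z, (2 * n)%:Z) = gdeg x +
   ((tot (Defs.permX H) y)%:Z - (tot (Defs.permX H) x)%:Z
      - ((tot (permO H) y)%:Z - (tot (permO H) x)%:Z),
    (asc col y)%:Z - (asc col x)%:Z
      - 2 * ((tot (permO H) y)%:Z - (tot (permO H) x)%:Z)).
Proof.
move=> xy; rewrite /wt; case: forall_inP => [eX _|]; last by rewrite eqxx.
have eX' : potsum (Defs.permX H) x = potsum (Defs.permX H) y.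
  by apply: eq_bigr => c /eX /eqP.
have le : (potsum (permO H) x <= potsum (permO H) y)%N.
  by apply: leq_sum => c; apply: xy.
rewrite /gdeg !Icount_pts ![Icount (Xpts _ _) _]Icount_marks.
rewrite ![Icount (Opts _ _) _]Icount_marks; congr (_, _) => /=; lia.
Qed.

Lemma wtX x y : pot_le D col x y ->
  wt H D col x y = 0 \/ exists2 m : 'X_{1..N}, wt H D col x y = 'X_[m] &
   mdeg m = (potsum (permO H) y - potsum (permO H) x)%N.
Proof.
move=> xy; rewrite /wt; case: ifP => _; last by left.
right; exists (\sum_(c in D) (U_(c) *+ (pot col (permO H) c y - pot col (permO
  H) c x)))%MM.
  rewrite (big_morph (fun m => 'X_[m]) (@mpolyXD _ _) (mpolyX0 _ _)).
  by apply: eq_bigr => c _; rewrite -mpolyXn.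
rewrite mdeg_sum /potsum; apply: (canRL (addnK _)).
rewrite -big_split; apply: eq_bigr => c cD /=.
by rewrite mdegMn mdeg1 mul1n subnK // xy.
Qed.

Lemma free_hom_wt (K : choiceType) (deg : K -> int * int) (g : K) x y e
    (n := (potsum (permO H) y - potsum (permO H) x)%N) :
  pot_le D col x y ->
  (wt H D col x y != 0 -> e = deg g - (n%:Z, (2 * n)%:Z)) ->
  free_hom deg e (wt H D col x y *: << g >> : {freeg K / A}).
Proof.
move=> /wtX[-> _|[m -> md]]; first by rewrite scale0r; apply: free_hom0.
have nX : 'X_[m] != 0 :> A.
  by apply/negP => /eqP X0; have := msuppX 'F_2 m; rewrite X0 msupp0.
move=> /(_ nX) ->; rewrite /n -md.
exact/free_homX/free_homU.
Qed.

End Degrees.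

(** * The grid complex *)

Section GridComplex.
Variable N : nat.
Local Notation A := {mpoly 'F_2[N]}.
Local Notation G := 'S_N.+1.
Local Notation ord := 'I_N.+1.
Implicit Types (x y z : G) (a b i j : ord).

Definition swapS x a b : G := (tperm a b * x)%g.

Lemma ht_swapS x a b : full_ht (swapS x a b) =1 full_ht x \o tperm a b.
Proof. by move=> m; rewrite /full_ht /swapS permM. Qed.

Lemma full_ht_inj x : injective (full_ht x).
Proof. exact: perm_inj. Qed.

Lemma full_ht_eq x y : full_ht x =1 full_ht y -> x = y.
Proof. by move/permP. Qed.

Local Notation ascS x := (asc id (full_ht x)).

(* The differential of CP with all weights set to 1, and the right product
   with the elementary transposition of two consecutive values. *)
Definition flat_diff : {freeg G / A} -> {freeg G / A} := fglift (fun x : G =>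
  \sum_(a : ord) \sum_(b : ord | (a < b)%N)
    ((ascS (swapS x a b)).+1 == ascS x)%:R *: << swapS x a b >>).

Definition crossing_mul i j : {freeg G / A} -> {freeg G / A} := fglift (fun x :
  G =>
  (ascS (x * tperm i j)%g == (ascS x).+1)%:R *: << (x * tperm i j)%g >>).

Lemma tperm_pair a b a0 b0 : (a < b)%N -> a0 != b0 ->
  ((tperm a b : G) == tperm a0 b0) =
  ((a == if (a0 < b0)%N then a0 else b0) && (b == if (a0 < b0)%N then b0 else
    a0)).
Proof.
move=> ab nab0; apply/eqP/andP => [e|[/eqP -> /eqP ->]]; last first.
  by case: ifP => // _; rewrite tpermC.
have ea : tperm a0 b0 a = b by rewrite -e tpermL.
move: ea ab; case: tpermP => [->|->|_ _ ->]; last by rewrite ltnn.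
  by move=> -> ab; rewrite ab.
by move=> -> ab; rewrite ltnNge (ltnW ab).
Qed.

Lemma kdist_consecutive x a b : x b = (x a).+1 :> nat ->
  kdist (hgt (full_ht x)) (hgt (full_ht (swapS x a b))) = 1%N.
Proof.
move=> xab; have ab' : (hgt (full_ht x) a < hgt (full_ht x) b)%N.
  by rewrite /hgt /full_ht xab.
have hti z : injective (hgt (full_ht z)) by apply/hgt_inj/full_ht_inj.
have ba' : (hgt (full_ht (swapS x a b)) b < hgt (full_ht (swapS x a b)) a)%N.
  by rewrite /hgt !ht_swapS /= tpermL tpermR.
rewrite (kdist_swap (hti x) (hti _) ab' ba') big1 => [|m].
  rewrite (@eq_kdist _ _ _ _ (hgt (full_ht x)) (frefl _)) ?kdistxx // => m.
  by rewrite /= /hgt ht_swapS /= tpermK.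
by rewrite /hgt /full_ht xab; lia.
Qed.

(** This is [kdist_leibniz] for the reversed columns, x and y = xs, where the middle distance is 1.
    The term lowering that distance survives only for the transposition taking y back to x, and this
    produces v. *)
Lemma flat_diff_crossing i j : j = i.+1 :> nat -> forall v,
  flat_diff (crossing_mul i j v) + crossing_mul i j (flat_diff v) = v.
Proof.
move=> ij; have nij : i != j by apply/eqP => e; move: ij; rewrite e; lia.
have lfd := @fglift_linear A G {freeg G / A}.
apply: fglift_ext => [c u v|c u v|x] //.
  by rewrite /crossing_mul /flat_diff !lfd scalerDr addrACA.
rewrite /crossing_mul /flat_diff !fgliftU (linZ (lfd _)) fgliftU.
set s := tperm i j; pose y := (x * s)%g.
pose a0 := (x^-1)%g i; pose b0 := (x^-1)%g j.
have xa0 : x a0 = i by rewrite permKV.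
have xb0 : x b0 = j by rewrite permKV.
have nab0 : a0 != b0 by apply: contra_neq nij => e; rewrite -xa0 -xb0 e.
have yE : y = swapS x a0 b0.
  by rewrite /y /s -[i in tperm i j]xa0 -[j in tperm _ j]xb0 -tpermJ conjgE
    mulVKg.
have rci := @rcol_inj N ord id (fun _ _ h => h).
have hti z : injective (hgt (full_ht z)) by apply/hgt_inj/full_ht_inj.
have B1 : kdist (hgt (full_ht x)) (hgt (full_ht y)) = 1%N.
  by rewrite yE kdist_consecutive // xa0 xb0.
pose T3 a b := tperm a b == tperm a0 b0 :> G.
pose T1 a b := (ascS y == (ascS x).+1) && ((ascS (swapS y a b)).+1 == ascS y).
pose T2 a b := ((ascS (swapS x a b)).+1 == ascS x) &&
  (ascS (swapS y a b) == (ascS (swapS x a b)).+1).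
have TE a b : (a < b)%N -> T1 a b = T2 a b (+) T3 a b.
  move=> ab; have nab : a != b by apply: contraTneq ab => ->; rewrite ltnn.
  have sw z : kdist (rcol id) (hgt (full_ht z) \o tperm a b) = ascS (swapS z a b).
    by apply: eq_kdist => // m; rewrite /hgt ht_swapS.
  have := kdist_leibniz rci (hti x) (hti y) nab; rewrite /= B1 !addn1 !sw.
  rewrite -![kdist (rcol id) _]/(ascS _) /T1 => ->; congr (_ (+) _); rewrite /T3.
  (* A zero distance after the exchange means that x and y disagreed on a, b; exchanging the
     consecutive values i and j reverses no other pair. *)
  set B' := kdist _ _; apply/idP/idP => [/andP[/eqP[B0] _]|/eqP tE].
    have := kdist_swap_cmp (hti x) (hti y) nab; rewrite -/B' B0 B1.
    case: ifP => // /eqP; rewrite /hgt /full_ht /y !permM => xy _.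
    have nx : (x a : nat) <> x b by move/val_inj/perm_inj/eqP;
      rewrite (negPf nab).
    suff [[xa xb]|[xa xb]] : x a = i /\ x b = j \/ x a = j /\ x b = i.
    - by rewrite /a0 /b0 -xa -xb !permK.
    - by rewrite /a0 /b0 -xa -xb !permK tpermC.
    have ne (u v : ord) : u <> v -> (u : nat) <> v by move=> uv /val_inj.
    move: xy nx; rewrite /s; case: (tpermP i j (x a)) => [->|->|/ne xai /ne xaj];
      case: (tpermP i j (x b)) => [->|->|/ne xbi /ne xbj];
      first [by left | by right | by lia].
  have yx : hgt (full_ht y) \o tperm a b =1 hgt (full_ht x).
    by move=> m; rewrite /= tE /hgt yE ht_swapS /= tpermK.
  rewrite /B' (eq_kdist (frefl _) yx) kdistxx eqxx addn0 -sw.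
  by rewrite (eq_kdist (frefl _) yx); exact: eqxx.
have swM a b : swapS y a b = (swapS x a b * s)%g by rewrite /swapS /y mulgA.
rewrite -/y scaler_sumr (lin_sum (lfd _)) -big_split /=.
(* The sum runs over a < b, so the surviving transposition is met once, at its ordered pair. *)
pose a1 := if (a0 < b0)%N then a0 else b0; pose b1 := if (a0 < b0)%N then b0
  else a0.
have ab1 : (a1 < b1)%N.
  by rewrite /a1 /b1; case: (ltngtP a0 b0) nab0 => // /val_inj ->; rewrite eqxx.
transitivity (\sum_(a : ord) \sum_(b : ord | (a < b)%N) (T3 a b)%:R *: << swapS
  y a b >>
  : {freeg G / A}).
  apply: eq_bigr => a _; rewrite scaler_sumr (lin_sum (lfd _)) -big_split.
  apply: eq_bigr => b ab /=; rewrite (linZ (lfd _)) fgliftU -swM !scalerA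
    -scalerDl.
  rewrite -!natrM !mulnb; congr (_ *: _).
  rewrite -/(T1 a b) -[X in _ + X%:R]/(nat_of_bool (T2 a b)) TE // natr_addb.
  by rewrite addrAC -natr_addb addbb add0r.
have T3E a b : (a < b)%N -> T3 a b = (a == a1) && (b == b1).
  by move=> ab; rewrite /T3 tperm_pair.
have row a : \sum_(b : ord | (a < b)%N) (T3 a b)%:R *: << swapS y a b >> =
    if a == a1 then << swapS y a1 b1 >> else 0 :> {freeg G / A}.
  rewrite (eq_bigr (fun b => if (a == a1) && (b == b1) then << swapS y a1 b1 >>
    else 0)).
    case: eqP => [->|_]; last exact: big1.
    rewrite -big_mkcondr (big_pred1 b1) // => b /=.
    by case: (eqVneq b b1) => [->|]; rewrite ?ab1 ?andbF.
  move=> b ab; rewrite T3E //; case: eqP => [->|_] /=; last by rewrite scale0r.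
  by case: eqP => [->|_] /=; rewrite ?scale1r ?scale0r.
rewrite (eq_bigr _ (fun a _ => row a)) -big_mkcond big_pred1_eq.
have te : tperm a1 b1 = tperm a0 b0 by apply/eqP; rewrite tperm_pair // !eqxx.
by congr << _ >>; rewrite /swapS te yE /swapS mulgA tperm2 mul1g.
Qed.

(** Steps of one compose, so the inverse of x is decreasing and x reverses the order. *)
Lemma asc_eq0 x :
    (forall i j, j = i.+1 :> nat -> ((x^-1)%g j <= (x^-1)%g i)%N) ->
  ascS x = 0%N.
Proof.
move=> hx; have mono d : forall i j, j = (i + d)%N :> nat ->
  ((x^-1)%g j <= (x^-1)%g i)%N.
  elim: d => [|d IHd] i j; first by rewrite addn0 => /val_inj ->.
  rewrite addnS => ij; have lt : (i + d < N.+1)%N by have := ltn_ord j; lia.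
  by apply: leq_trans (hx (Ordinal lt) j ij) (IHd i (Ordinal lt) erefl).
apply: big1 => m _; apply: big1 => l _; apply/eqP; rewrite eqb0; apply/negP.
rewrite /rcol /hgt /full_ht => /andP[ml lt].
have := mono (x m - x l)%N (x l) (x m); rewrite subnKC ?(ltnW lt) // =>
  /(_ erefl).
by rewrite !permK; have := ltn_ord m; have := ltn_ord l; move: ml;
  rewrite /id; lia.
Qed.

(** Induction on ascents. If two consecutive values ascend, x = R z with one ascent fewer in z,
    where R is [crossing_mul]; then dR = 1 + Rd gives ddx = dz + dz + R(ddz) = 0. Otherwise x has no
    ascents and dx = 0. *)
Lemma flat_diff_sq v : flat_diff (flat_diff v) = 0.
Proof.
have lfd : linear flat_diff by apply: fglift_linear.
have lR i j : linear (crossing_mul i j) by apply: fglift_linear.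
pose Z (v : {freeg G / A}) : {freeg G / A} := 0.
move: v; apply: (@fglift_ext _ _ _ _ Z) => [c u v|c u v|x].
- by rewrite !lfd.
- by rewrite /Z scaler0 addr0.
rewrite /Z; have [n] := ubnP (ascS x); elim: n x => // n IHn x xn.
have rci := @rcol_inj N ord id (fun _ _ h => h).
have hti z : injective (hgt (full_ht z)) by apply/hgt_inj/full_ht_inj.
case: (boolP [exists i : ord, exists j : ord, (j == i.+1 :> nat) &&
  ((x^-1)%g i < (x^-1)%g j)%N]);
    last first.
  move=> nij; rewrite {2}/flat_diff fgliftU big1 ?(lin0 lfd) // => a _.
  apply: big1 => b ab; rewrite (@asc_eq0 x) ?scale0r // => i j ij.
  rewrite leqNgt; apply: contra nij => lt.
  by apply/existsP; exists i; apply/existsP; exists j; rewrite ij eqxx.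
case/existsP=> i /existsP[j /andP[/eqP ij lt]].
pose a := (x^-1)%g i; pose b := (x^-1)%g j; pose z := (x * tperm i j)%g.
have xa : x a = i by rewrite permKV.
have xb : x b = j by rewrite permKV.
have zE : z = swapS x a b.
  by rewrite /z -xa -xb -tpermJ conjgE mulVKg.
have zx : (ascS z).+1 = ascS x.
  have t : (ascS x <= ascS z + 1)%N.
    by rewrite -(@kdist_consecutive x a b) ?xa ?xb // kdistC -zE;
      apply: kdist_triangle.
  have nab : a != b by apply: contraTneq lt; rewrite -/a -/b => ->; rewrite ltnn.
  have := kdist_swap_cmp rci (hti x) nab.
  have -> : kdist (rcol id) (hgt (full_ht x) \o tperm a b) = ascS z.
    by apply: eq_kdist => // m; rewrite /hgt zE ht_swapS.
  rewrite -[kdist _ _]/(ascS x) {1 2}/hgt /full_ht xa xb /rcol.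
  have -> : (N - id a < N - id b)%N = false by move: lt; rewrite -/a -/b /=; lia.
  by rewrite ij ltnNge leqnSn /= => h; apply/eqP; rewrite eqn_leq h; move: t;
    rewrite addn1.
have xE : << x >> = crossing_mul i j << z >> :> {freeg G / A}.
  by rewrite /crossing_mul fgliftU /z -mulgA tperm2 mulg1 -/z zx eqxx scale1r.
have anti u : flat_diff (crossing_mul i j u) = u + crossing_mul i j (flat_diff u).
  apply: (addIr (crossing_mul i j (flat_diff u))).
  by rewrite (flat_diff_crossing ij u) -addrA mpolyF2_char2 addr0.
rewrite xE anti (linD lfd) anti IHn ?(lin0 (lR _ _)) ?addr0 ?mpolyF2_char2 //.
by rewrite -ltnS zx.
Qed.
End GridComplex.

(** * The weighted differential of CP *)

Section GridComplexIsComplex.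
Variables (N : nat) (H : grid N).
Local Notation A := {mpoly 'F_2[N]}.
Local Notation full := [set: 'I_N].
Local Notation G := 'S_N.+1.
Local Notation ord := 'I_N.+1.
Implicit Types (x y z : G).

Local Notation dCP := (rect_diff H full id (@full_ht N)).
Local Notation coef := (rect_coef H full id (@full_ht N)).

Lemma tot_perm D (P : 'S_N) (x y : ord -> ord) (t : {perm ord}) :
  y =1 x \o t -> tot D P y = tot D P x.
Proof.
move=> e; apply: eq_bigr => c _; rewrite [RHS](reindex_inj (@perm_inj _ t)).
by apply: eq_bigr => m _; rewrite e.
Qed.

Lemma rect_diffU x : dCP << x >> =
  \sum_(a : ord) \sum_(b : ord | (a < b)%N)
    coef x (swapS x a b) *: << swapS x a b >>.
Proof.
rewrite /rect_diff fgliftU; apply: rect_sumE.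
- by move=> ? ?.
- exact: full_ht_inj.
- exact: full_ht_eq.
- exact: ht_swapS.
Qed.

Lemma swapS_pot_le x (a b : ord) : (a < b)%N ->
  (asc id (full_ht (swapS x a b))).+1 == asc id (full_ht x) ->
  pot_le full id (full_ht x) (full_ht (swapS x a b)).
Proof.
apply: rect_coef_pot_le => //; first exact: full_ht_inj.
exact: ht_swapS.
Qed.

Lemma rect_diff_linear : linear dCP.
Proof. exact: fglift_linear. Qed.

Lemma rect_diff_sq u : dCP (dCP u) = 0.
Proof.
have ld := rect_diff_linear.
have lf : linear (@flat_diff N) by apply: fglift_linear.
pose Z (v : {freeg G / A}) : {freeg G / A} := 0.
move: u; apply: (@fglift_ext _ _ _ _ Z) => [c u v|c u v|x].
- by rewrite !ld.
- by rewrite /Z scaler0 addr0.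
(* By [wt_mul] the weight of a two-step path from x depends only on its end z, so the weighted
   square is W applied to the unweighted one. *)
pose W := fglift (fun z : G => wt H full id (full_ht x) (full_ht z) *: << z >>
   : {freeg G / A}).
have lW : linear W by apply: fglift_linear.
rewrite /Z -(lin0 lW) -(flat_diff_sq << x >>) [in LHS]rect_diffU.
rewrite [in RHS]/flat_diff [X in W (_ X)]fgliftU -/(@flat_diff N).
rewrite (lin_sum ld) (lin_sum lf) (lin_sum lW); apply: eq_bigr => a _.
rewrite (lin_sum ld) (lin_sum lf) (lin_sum lW); apply: eq_bigr => b ab.
set y := swapS x a b; rewrite (linZ ld) (linZ lf) (linZ lW) /rect_coef.
case: eqP => [hxy|_]; last by rewrite mul0r !scale0r.
have xy : pot_le full id (full_ht x) (full_ht y) by apply: swapS_pot_le => //;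
  apply/eqP.
rewrite mul1r scale1r rect_diffU /flat_diff fgliftU scaler_sumr (lin_sum lW).
apply: eq_bigr => c _; rewrite scaler_sumr (lin_sum lW); apply: eq_bigr => d cd.
rewrite (linZ lW) /W fgliftU /rect_coef.
case: eqP => [hyz|_]; last by rewrite mul0r !scale0r scaler0.
have yz : pot_le full id (full_ht y) (full_ht (swapS y c d)).
  by apply: swapS_pot_le => //; apply/eqP.
by rewrite mul1r scale1r scalerA wt_mul.
Qed.

Lemma degCPE x : degCP H x = gdeg H full id (full_ht x).
Proof. by []. Qed.

Lemma rect_diff_hom e u : free_hom (degCP H) e u ->
  free_hom (degCP H) (e + (0, -1)) (dCP u).
Proof.
apply: fglift_hom; [exact: free_hom0|exact: free_homD|exact: free_homX|] => x.
have := rect_diffU x; rewrite /rect_diff fgliftU => ->.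
apply: big_ind => [||a _]; [exact: free_hom0|exact: free_homD|].
apply: big_ind => [||b ab]; [exact: free_hom0|exact: free_homD|].
rewrite /rect_coef; case: eqP => [hxy|_]; last by rewrite mul0r scale0r;
  apply: free_hom0.
have xy : pot_le full id (full_ht x) (full_ht (swapS x a b)).
  by apply: swapS_pot_le => //; apply/eqP.
rewrite mul1r; apply: free_hom_wt => // /(gdeg_step xy).
rewrite !degCPE => ->; congr (_ + _).
by rewrite -hxy !(tot_perm _ _ (ht_swapS x a b)); congr (_, _); lia.
Qed.

Lemma CP_is_complex : is_complex (CP H).
Proof.
split=> /=.
- exact: rect_diff_linear.
- exact: rect_diff_sq.
- exact: free_hom0.
- exact: free_homD.
- move=> i e u /(@free_homX _ _ _ _ U_(i)%MM _); rewrite /mbideg mdeg1 muln1.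
  by congr free_hom; congr (_ + _).
- exact: rect_diff_hom.
- exact: free_hom_span.
- exact: free_hom_indep.
Qed.

End GridComplexIsComplex.

(** * The type A module *)

Section Symmetrization.
Variables (I : finType) (V : nmodType) (u v : I -> nat) (F : I -> I -> V).

(** Every unordered pair is counted once whichever injective function orients it; this exchanges
    orientation by height for orientation by column. *)
Lemma sum_ltn_sym : injective u -> injective v -> (forall a b, F a b = F b a) ->
  \sum_a \sum_(b | (u a < u b)%N) F a b = \sum_a \sum_(b | (v a < v b)%N) F a b.
Proof.
move=> iu iv sF.
have split (w w' : I -> nat) : injective w' ->
   \sum_a \sum_(b | (w a < w b)%N) F a b =
   \sum_a \sum_(b | (w a < w b)%N && (w' a < w' b)%N) F a b +
   \sum_a \sum_(b | (w a < w b)%N && (w' b < w' a)%N) F a b.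
  move=> iw'; rewrite -big_split; apply: eq_bigr => a _ /=.
  rewrite (bigID (fun b => (w' a < w' b)%N)); congr (_ + _).
  apply: eq_bigl => b; apply: andb_id2l => ab; rewrite -leqNgt leq_eqVlt.
  by case: eqP => // /iw' e; rewrite e ltnn in ab.
rewrite (split u v iv) (split v u iu); congr (_ + _).
  by apply: eq_bigr => a _; apply: eq_bigl => b; rewrite andbC.
rewrite [RHS](exchange_big_dep xpredT) //=; apply: eq_bigr => a _.
by apply: eq_big => [b|b _]; [rewrite andbC | rewrite sF].
Qed.

End Symmetrization.

Lemma sum_inj_im (I J : finType) (V : nmodType) (f : I -> J) (F : J -> V) :
  injective f -> (forall j, j \notin [set f i | i : I] -> F j = 0) ->
  \sum_j F j = \sum_i F (f i).
Proof.
move=> fi F0; rewrite (bigID (mem [set f i | i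
  : I])) /= addrC big1 => [|j /F0 //].
rewrite add0r big_imset /=; last by move=> ? ? _ _; apply: fi.
by apply: eq_bigl.
Qed.

Section TypeA.
Variables (N k : nat).
Hypothesis hk : (k <= N)%N.
Local Notation ord := 'I_N.+1.
Local Notation IA := (IA N k).
Local Notation genA := (genA N k).
Local Notation strand := (strand N k).
Local Notation colA := (@colA N k).
Local Notation hA x := (hgt (htA x)).
Implicit Types (x y z : genA) (f g h : strand).

Lemma colA_inj : injective colA.
Proof. exact: val_inj. Qed.

Lemma htA_inj x : injective (htA x).
Proof. by case: x => x xi; apply/injectiveP. Qed.

Lemma hA_inj x : injective (hA x).
Proof. exact/hgt_inj/htA_inj. Qed.

Lemma htA_eq x y : htA x =1 htA y -> x = y.
Proof. by move=> e; apply/val_inj/ffunP. Qed.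

Lemma genA_of_inj (u : IA -> ord) : injective u -> exists x : genA, htA x =1 u.
Proof.
move=> iu; have iu' : injectiveb (finfun u).
  by apply/injectiveP => m l; rewrite !ffunE => /iu.
by exists (exist _ (finfun u) iu') => m; rewrite /htA /= ffunE.
Qed.

Lemma swapA_subproof x (a b : IA) : injectiveb [ffun m => htA x (tperm a b m)].
Proof.
by apply/injectiveP => m l; rewrite !ffunE => /htA_inj/perm_inj.
Qed.

Definition swapA x (a b : IA) : genA :=
  exist (fun u : {ffun IA -> ord} => injectiveb u) _ (swapA_subproof x a b).

Lemma ht_swapA x a b : htA (swapA x a b) =1 htA x \o tperm a b.
Proof. by move=> m; rewrite /htA /= ffunE. Qed.

Lemma card_IA : #|{: IA}| = k.
Proof.
rewrite card_sig -sum1_card (eq_bigl (fun i : ord => (i < k)%N)) //.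
by rewrite (big_ord_narrow (leq_trans hk (leqnSn N))) sum1_card card_ord.
Qed.

Lemma card_imA x : #|imA x| = k.
Proof. by rewrite card_imset ?card_IA //; apply: htA_inj. Qed.

Lemma genA_of_set (S : {set ord}) : #|S| = k -> exists x, imA x = S.
Proof.
move=> cS; have e : #|{: IA}| = #|S| by rewrite card_IA.
have [x xE] : exists x, htA x =1 (fun m => enum_val (cast_ord e (enum_rank m))).
  by apply: genA_of_inj => m l /enum_val_inj/cast_ord_inj/enum_rank_inj.
exists x; apply/eqP; rewrite eqEcard cS card_imA leqnn andbT.
by apply/subsetP => _ /imsetP[m _ ->]; rewrite xE enum_valP.
Qed.

(** The heights of y are f composed with those of x. A strand diagram is thus read as a pair of
    generators, its strands being indexed by the columns, and the distances become available. *)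
Definition links x (f : pfun N) y : bool :=
  (dom_of f == imA x) && [forall m, f (htA x m) == Some (htA y m)].

Lemma linksP x (f : pfun N) y :
  reflect (dom_of f = imA x /\ forall m, f (htA x m)
    = Some (htA y m)) (links x f y).
Proof.
apply: (iffP andP) => [[/eqP -> /forallP e]|[-> e]]; split=> //.
  by move=> m; apply/eqP.
by apply/forallP => m; rewrite e.
Qed.

Lemma links_fun x (f : pfun N) y y' : links x f y -> links x f y' -> y = y'.
Proof.
move=> /linksP[_ e] /linksP[_ e']; apply: htA_eq => m.
by have := e m; rewrite e' => -[].
Qed.

Lemma links_inj x (f f' : pfun N) y : links x f y -> links x f' y -> f = f'.
Proof.
move=> /linksP[d e] /linksP[d' e']; apply/ffunP => i.
have [|] := boolP (i \in imA x); first by case/imsetP=> m _ ->; rewrite e e'.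
move=> ni; have := ni; rewrite -d inE negbK => /eqP ->.
by move: ni; rewrite -d' inE negbK => /eqP ->.
Qed.

Lemma strandP f : [/\ #|dom_of (val f)| = k,
  forall i j, val f i != None -> val f i = val f j -> i = j
  & forall i j, val f i = Some j -> (i <= j)%N].
Proof.
case: f => f /and3P[/eqP cf /forallP fi /forallP fu] /=;
  split=> // [i j ni e|i j e].
  by apply/eqP; move/forallP: (fi i) => /(_ j); rewrite ni e eqxx.
by have := fu i; rewrite e.
Qed.

Lemma links_exists x f : dom_of (val f) = imA x -> exists y, links x (val f) y.
Proof.
move=> d; have [_ fi _] := strandP f.
have ex m : {j | val f (htA x m) = Some j}.
  have : htA x m \in dom_of (val f) by rewrite d imset_f.
  by rewrite inE; case: (val f _) => // j _; exists j.
have [|y yE] := @genA_of_inj (fun m => sval (ex m)).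
  move=> m l; case: (ex m) => i im; case: (ex l) => j jl /= ij.
  by apply: (@htA_inj x); apply: fi; rewrite im // ij jl.
exists y; apply/linksP; split=> // m.
by rewrite yE; case: (ex m).
Qed.

Lemma links_le x f y m : links x (val f) y -> (htA x m <= htA y m)%N.
Proof. by have [_ _ fu] := strandP f; case/linksP=> _ /(_ m)/fu. Qed.

Lemma strand_exists x y : (forall m, htA x m <= htA y m)%N ->
  exists f, links x (val f) y.
Proof.
move=> xy; pose F : pfun N :=
  [ffun i => omap (htA y) [pick m | htA x m == i]].
have Fx m : F (htA x m) = Some (htA y m).
  rewrite ffunE; case: pickP => [l /eqP /htA_inj ->//|/(_ m)].
  by rewrite eqxx.
have F0 i : i \notin imA x -> F i = None.
  rewrite ffunE; case: pickP => //= l /eqP <-; by rewrite imset_f.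
have dF : dom_of F = imA x.
  apply/setP => i; rewrite inE; have [|/F0 -> //] := boolP (i \in imA x).
  by case/imsetP=> m _ ->; rewrite Fx.
have Fim i : F i != None -> exists m, i = htA x m.
  have [/imsetP[m _ ->]|/F0 ->//] := boolP (i \in imA x); by exists m.
have sF : is_strand k F.
  apply/and3P; split; first by rewrite dF card_imA.
    apply/forallP => i; apply/forallP => j; apply/implyP => /andP[ni /eqP e].
    have [l jl] : exists l, j = htA x l by apply: Fim; rewrite -e.
    have [m im] := Fim i ni; move: e; rewrite im jl !Fx => -[/htA_inj ->].
    exact: eqxx.
  apply/forallP => i; case Fi : (F i) => [j|] //.
  have [m im] : exists m, i = htA x m by apply: Fim; rewrite Fi.
  by move: Fi; rewrite im Fx => -[<-].
by exists (exist _ F sF); apply/linksP.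
Qed.

Lemma links_cod x (f : pfun N) y : links x f y -> cod_of f = imA y.
Proof.
case/linksP=> d e; apply/setP => j; rewrite inE.
apply/existsP/imsetP => [[i /eqP fi]|[m _ ->]]; last by exists (htA x m);
  rewrite e.
have : i \in imA x by rewrite -d inE fi.
case/imsetP=> m _ im; exists m => //.
by move: fi; rewrite im e => -[].
Qed.

Lemma links_cr x (f : pfun N) y : links x f y -> cr f = kdist (hA x) (hA y).
Proof.
case/linksP=> d e; rewrite /cr -sum1_card.
transitivity (\sum_i \sum_j (crossing f i j : nat))%N.
  rewrite pair_big /= big_mkcond; apply: eq_bigr => -[i j] _ /=.
  by rewrite inE; case: (crossing _ _ _).
have f0 i : i \notin imA x -> f i = None.
  by rewrite -d inE negbK => /eqP.
rewrite (@sum_inj_im _ _ nat (htA x)); first last.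
- by move=> i /f0 fi; apply: big1 => j _; rewrite /crossing fi andbF.
- exact: htA_inj.
apply: eq_bigr => m _; rewrite (@sum_inj_im _ _ nat (htA x)); first last.
- by move=> j /f0 fj; rewrite /crossing fj; case: (f _) => [?|]; rewrite andbF.
- exact: htA_inj.
by apply: eq_bigr => l _; rewrite /crossing !e.
Qed.

Lemma links_pot_le x f y D : links x (val f) y -> pot_le D colA (htA x) (htA y).
Proof.
move=> xfy P c _; apply: leq_sum => m _.
by case: ltnP => // Px; rewrite (leq_trans Px (links_le m xfy)).
Qed.

End TypeA.

(** * The action by strand diagrams *)

Section Action.
Variables (N k : nat).
Hypothesis hk : (k <= N)%N.
Variable H : grid N.
Local Notation A := {mpoly 'F_2[N]}.
Local Notation ord := 'I_N.+1.
Local Notation IA := (IA N k).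
Local Notation genA := (genA N k).
Local Notation strand := (strand N k).
Local Notation alg := (alg N k).
Local Notation CPA := (CPA N k).
Local Notation colA := (@colA N k).
Local Notation hA x := (hgt (htA x)).
Local Notation ascA x := (asc colA (htA x)).
Local Notation wtA x y := (wt H (markA N k) colA (htA x) (htA y)).
Local Notation mA := (markA N k).
Implicit Types (x y z : genA) (f g h : strand).

Let rcA_inj : injective (rcol colA) := rcol_inj (@colA_inj N k).

Lemma ascA_kdist x : ascA x = kdist (rcol colA) (hA x).
Proof. by []. Qed.

(** At most one y occurs. The condition says that the reversed columns, x and y give equality in the
    triangle inequality, and the weight is that of the region swept out by all strands. *)
Definition strand_act_gen x f : CPA := \sum_(y | links x (val f) y)
  ((ascA y == ascA x + cr (val f))%N%:R * wtA x y) *: << y >>.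

Definition strand_act (p : CPA) (a : alg) : CPA :=
  fglift (fun x => fglift (strand_act_gen x) a : CPA) p.

Lemma strand_act_linl a : linear (strand_act^~ a).
Proof. exact: fglift_linear. Qed.

Lemma strand_act_linr p : linear (strand_act p).
Proof.
move=> c a b; rewrite /strand_act !fglift_sum scaler_sumr -big_split.
by apply: eq_bigr => x _; rewrite /= fglift_linear scalerDr !scalerA mulrC.
Qed.

Lemma strand_actU x f : strand_act << x >> << f >> = strand_act_gen x f.
Proof. by rewrite /strand_act !fgliftU. Qed.

Lemma strand_act_genE x f y : links x (val f) y ->
  strand_act_gen x f = ((ascA y == ascA x + kdist (hA x) (hA y))%N%:R * wtA x
    y) *: << y >>.
Proof.
move=> xfy; rewrite -(links_cr xfy) /strand_act_gen (big_pred1 y) // => y'.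
by apply/idP/eqP => [/links_fun/(_ xfy)|->].
Qed.

Lemma strand_act_gen0 x f : dom_of (val f) != imA x -> strand_act_gen x f = 0.
Proof.
by move=> nd; apply: big_pred0 => y; apply/negP => /linksP[d _];
  rewrite d eqxx in nd.
Qed.

Lemma sum_strand_eq (V : nmodType) x y (F : pfun N) (e : strand -> V) :
  (forall m, htA x m <= htA y m)%N -> links x F y ->
  exists2 f, links x (val f) y &
    \sum_(f : strand | [forall i, val f i == F i]) e f = e f.
Proof.
move=> xy xFy; have [f xfy] := strand_exists hk xy; exists f => //.
rewrite (big_pred1 f) // => g; apply/forallP/eqP => [gF|-> i]; last first.
  by rewrite (links_inj xFy xfy).
apply/val_inj; rewrite -(links_inj xFy xfy) /=; apply/ffunP => i.
by apply/eqP.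
Qed.

Lemma strand_act_idem x (S : ksub N k) :
  strand_act << x >> (idem S) = if imA x == val S then << x >> else 0.
Proof.
rewrite /idem (lin_sum (strand_act_linr _)).
under eq_bigr do rewrite strand_actU.
case: eqP => [xS|nS]; last first.
  apply: big1 => f /forallP fS; apply: strand_act_gen0; apply/eqP => d; apply: nS.
  rewrite -d; apply/setP => i; rewrite inE (eqP (fS i)).
  by case: ifP.
pose F : pfun N := [ffun i => if i \in val S then Some i else None].
have xF : links x F x.
  apply/linksP; split; last by move=> m; rewrite ffunE -xS imset_f.
  by apply/setP => i; rewrite xS inE ffunE; case: ifP.
rewrite (eq_bigl (fun f : strand => [forall i, val f i == F i])); last first.
  by move=> f; apply: eq_forallb => i; rewrite ffunE.
have [f xfx ->] := sum_strand_eq (strand_act_gen x) (fun m => leqnn (htA x m)) xF.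
by rewrite (strand_act_genE xfx) kdistxx addn0 eqxx wtxx mul1r scale1r.
Qed.

Lemma strand_act_one p : strand_act p (alg_one N k) = p.
Proof.
move: p; apply: fglift_ext => [||x] //; first exact: strand_act_linl.
rewrite /alg_one (lin_sum (strand_act_linr _)).
have cx : #|imA x| == k by rewrite card_imA.
rewrite (bigD1 (exist _ (imA x) cx)) //= strand_act_idem eqxx big1 ?addr0 // =>
  S nS.
rewrite strand_act_idem ifN_eq //; apply: contra_neq nS => e.
by apply/val_inj; rewrite /= e.
Qed.

Lemma alg_mulU f g : alg_mul << f >> << g >> =
  \sum_(h : strand | is_product (val f) (val g) (val h)) << h >> :> alg.
Proof. by rewrite /alg_mul !fgliftU. Qed.

Lemma alg_mul_linl (b : alg) : linear ((@alg_mul N k)^~ b).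
Proof. exact: fglift_linear. Qed.

Lemma alg_mul_linr (a : alg) : linear (@alg_mul N k a).
Proof.
move=> c b b'; rewrite /alg_mul !fglift_sum scaler_sumr -big_split.
by apply: eq_bigr => x _; rewrite /= fglift_linear scalerDr !scalerA mulrC.
Qed.

Lemma links_product x y z f g (h : pfun N) :
  links x (val f) y -> links y (val g) z -> links x h z ->
  is_product (val f) (val g) h =
    (kdist (hA x) (hA z) == kdist (hA x) (hA y) + kdist (hA y) (hA z))%N.
Proof.
move=> xfy ygz xhz; rewrite /is_product (links_cr xfy) (links_cr ygz) (links_cr
  xhz).
rewrite (links_cod xfy) (proj1 (linksP _ _ _ ygz)) eqxx /=.
have -> // : [forall i, h i == obind (val g) (val f i)].
apply/forallP => i; have [dh eh] := linksP _ _ _ xhz.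
have [df ef] := linksP _ _ _ xfy; have [dg eg] := linksP _ _ _ ygz.
have [/imsetP[m _ ->]|ni] := boolP (i \in imA x); first by rewrite eh ef /= eg.
have := ni; rewrite -dh inE negbK => /eqP ->.
by move: ni; rewrite -df inE negbK => /eqP ->.
Qed.

Lemma product_links x y z f g (h : pfun N) :
  links x (val f) y -> links y (val g) z -> is_product (val f) (val g) h ->
  links x h z.
Proof.
move=> /linksP[df ef] /linksP[_ eg] /and3P[_ /forallP hfg _].
apply/linksP; split=> [|m]; last by rewrite (eqP (hfg _)) ef /= eg.
apply/setP => i; rewrite inE (eqP (hfg i)).
have [/imsetP[m _ ->]|ni] := boolP (i \in imA x); first by rewrite ef /= eg.
by move: ni; rewrite -df inE negbK => /eqP ->.
Qed.

(** With x, y, z linked by f and g, both sides are multiples of z whose weights agree by [wt_mul];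
    only the conditions on distances remain to be compared. *)
Lemma strand_act_mul p a b : strand_act p (alg_mul a b)
  = strand_act (strand_act p a) b.
Proof.
move: p; apply: fglift_ext => [||x].
- exact: strand_act_linl.
- by move=> c p p'; rewrite strand_act_linl strand_act_linl.
move: a; apply: fglift_ext => [||f].
- by move=> c a a'; rewrite alg_mul_linl strand_act_linr.
- by move=> c a a'; rewrite strand_act_linr strand_act_linl.
move: b; apply: fglift_ext => [||g].
- by move=> c b b'; rewrite alg_mul_linr strand_act_linr.
- exact: strand_act_linr.
rewrite alg_mulU (lin_sum (strand_act_linr _)) strand_actU.
under eq_bigr do rewrite strand_actU.
have [d|nd] := eqVneq (dom_of (val f)) (imA x); last first.
  rewrite strand_act_gen0 // (lin0 (strand_act_linl _)) big1 // =>
    h /and3P[/eqP cf /forallP hfg _].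
  apply: strand_act_gen0; apply: contra nd => /eqP dh.
  rewrite eq_sym eqEcard -dh; have [-> _ _] := strandP h;
    have [-> _ _] := strandP f.
  rewrite leqnn andbT; apply/subsetP => i; rewrite !inE (eqP (hfg i)).
  by case: (val f i).
have [y xfy] := links_exists d; rewrite (strand_act_genE xfy) (linZ
  (strand_act_linl _)) strand_actU.
have [dg|ng] := eqVneq (dom_of (val g)) (imA y); last first.
  rewrite strand_act_gen0 // scaler0; apply: big1 => h /and3P[/eqP e _ _].
  by rewrite -e (links_cod xfy) eqxx in ng.
have [z ygz] := links_exists dg; rewrite (strand_act_genE ygz).
have xz m : (htA x m <= htA z m)%N by apply: leq_trans (links_le m xfy)
  (links_le m ygz).
have [h xhz] := strand_exists hk xz.
rewrite big_mkcond (bigD1 h) //= big1 ?addr0 => [|h' nh]; last first.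
  case: ifP => // /(product_links xfy ygz) xh'z; case/eqP: nh.
  exact/val_inj/(links_inj xh'z xhz).
rewrite (links_product xfy ygz xhz) (strand_act_genE xhz) !ascA_kdist.
have hi u := @hA_inj N k u.
have t1 := kdist_triangle (hi x) (hi y) (hi z).
have t2 := kdist_triangle rcA_inj (hi x) (hi y).
have t3 := kdist_triangle rcA_inj (hi x) (hi z).
have t4 := kdist_triangle rcA_inj (hi y) (hi z).
rewrite -(wt_mul H (links_pot_le (D := mA) xfy) (links_pot_le ygz)).
set K := kdist _ (hA z) in t3 t4 *; move: t1 t2 t3 t4.
rewrite scalerA mulrACA -natrM mulnb.
move: (kdist (hA x) (hA z)) (kdist (hA x) (hA y)) (kdist (hA y) (hA z)) => a b c.
move: (kdist _ (hA x)) (kdist _ (hA y)) K => p q r t1 t2 t3 t4.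
(* Both sides say r = p + b + c, since r <= q + c <= p + b + c and r <= p + a <= p + b + c. *)
have -> : (q == p + b)%N && (r == q + c)%N = (a == b + c)%N &&
  (r == p + a)%N by lia.
by case: eqP => _ //=; rewrite mul0r scale0r.
Qed.

Definition bumped x (m : IA) (j : ord) y :=
  forall l, htA y l = if l == m then j else htA x l.

Lemma bumped_exists x (m : IA) (j : ord) : j \notin imA x ->
  exists y, bumped x m j y.
Proof.
move=> jx; apply: genA_of_inj => l l'.
case: eqP => [->|_]; case: eqP => [->|_] //; last exact: htA_inj.
  by move=> e; case/negP: jx; rewrite e imset_f.
by move=> e; case/negP: jx; rewrite -e imset_f.
Qed.

(** Stated for any linear e killing diagrams of the wrong domain, so that it serves both
    [strand_act] and an unknown action. *)
Lemma sum_rho (V : lmodType A) (e : alg -> V) x y m (i j : ord) (r : strand) :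
    linear e -> (forall f, dom_of (val f) != imA x -> e << f >> = 0) ->
    (i < j)%N -> htA x m = i -> bumped x m j y -> j \notin imA x ->
    links x (val r) y ->
  e (rho k i j) = e << r >>.
Proof.
move=> le e0 ij xm xy jx xry; have cx : #|imA x| == k by rewrite card_imA.
have ix : i \in imA x by rewrite -xm imset_f.
rewrite /rho (lin_sum le) (bigD1 (exist _ (imA x) cx)) /= ?ix //.
rewrite [X in _ + X]big1 ?addr0 => [|S /andP[_ nS]].
  rewrite /rhoS (lin_sum le) /=.
  pose F : pfun N := [ffun l => if l \in imA x then Some (if l == i then j else
    l) else None].
  have xFy : links x F y.
    apply/linksP; split=> [|l]; first by apply/setP => l; rewrite inE ffunE;
      case: ifP.
    by rewrite ffunE imset_f // xy -xm (inj_eq (@htA_inj _ _ x)); case: ifP.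
  have le_xy l : (htA x l <= htA y l)%N.
    by rewrite xy; case: eqP => // ->; rewrite xm ltnW.
  rewrite (eq_bigl (fun f : strand => [forall i, val f i == F i])); last first.
    by move=> f; apply: eq_forallb => l; rewrite ffunE.
  have [f xfy ->] := sum_strand_eq (fun f => e << f >>) le_xy xFy.
  by congr (e << _ >>); apply/val_inj/(links_inj xfy xry).
rewrite /rhoS (lin_sum le) big1 // => f /forallP fS; apply: e0.
apply: contra_neq nS => d; apply/val_inj; rewrite /= -d; apply/setP => l.
by rewrite inE (eqP (fS l)); case: ifP.
Qed.

(** Only the point on m moves, so a pair violating equality consists of m and a point to its right
    with height between i and j. All columns lie left of Z, so this is a point inside the
    half-strip. *)
Lemma bumped_coef x m (i j : ord) y : (i < j)%N -> htA x m
  = i -> bumped x m j y ->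
  (ascA y == ascA x + kdist (hA x) (hA y))%N%:R * wtA x y =
  (empty_of colA (htA x) (halfrectA m i j))%:R *
    ((Xcount H mA (halfrectA m i j) == 0%N)%:R * Uweight H mA (halfrectA m i j)).
Proof.
move=> ij xm xy; congr (_ * _); last first.
  have region := @wt_region N H mA _ colA (htA x) (htA y) (halfrectA m i j).
  apply/esym/(proj2 (region _)) => P c; rewrite inE => ck.
  have bump (f g : IA -> nat) n : (forall l, l != m -> f l = g l) ->
      (f m = n + g m -> \sum_l f l = n + \sum_l g l)%N.
    move=> fg fm; rewrite !(bigD1 m (P := xpredT)) //= fm -addnA; congr (_ + _)%N.
    by congr (_ + _)%N; apply: eq_bigr.
  rewrite /pot big_mkcond [in RHS]big_mkcond; apply: bump => [l nl|].
    by rewrite xy (negPf nl).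
  rewrite xy eqxx xm /interior /halfrectA /= /mark /Zline /line.
  by case: (leqP (colA m) c) => cm; lia.
congr (nat_of_bool _)%:R; rewrite !ascA_kdist.
rewrite kdist_triangle_eq; [|exact: rcA_inj|exact: hA_inj|exact: hA_inj].
have colk (l : IA) : (colA l < k)%N by apply: valP l.
apply/forallP/forallP => em l; last first.
  apply/forallP => l'; apply/negP; rewrite /hgt !xy /rcol => /and3P[cl].
  have := em l; rewrite /interior /halfrectA /pt /= /Zline /line.
  have := colk l; have := colk l'; move: cl.
  have := ltn_ord (colA l); have := ltn_ord (colA l').
  case: eqP => [->|nl]; case: eqP => [->|nl']; rewrite ?xm; try lia.
apply/negP => int; move/forallP: (em l) => /(_ m); apply/negP; rewrite negbK.
move: int; rewrite /interior /halfrectA /pt /= /Zline /line /hgt !xy eqxx /rcol.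
have := ltn_ord (colA l); have := ltn_ord (colA m); rewrite xm.
case: eqP => [->|nl]; lia.
Qed.

Lemma strand_act_rho x (i j : ord) : (i < j)%N ->
  strand_act << x >> (rho k i j) =
    \sum_(y : genA) \sum_(m : IA | is_halfA x y i j m
                          && (Xcount H mA (halfrectA m i j) == 0%N))
      Uweight H mA (halfrectA m i j) *: << y >>.
Proof.
move=> ij; have l_act := strand_act_linr << x >>.
have half_im y m : is_halfA x y i j m -> [/\ htA x m
  = i, bumped x m j y & j \notin imA x].
  case/and5P=> _ /eqP xm /eqP ym /forallP xy _;
    have xy' l : l != m -> htA y l = htA x l.
    by move=> nl; move: (xy l); rewrite nl => /eqP.
  split=> // [l|]; first by case: eqP => [->//|/eqP /xy'].
  apply/negP => /imsetP[l _ jl]; have nl : l != m.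
    by apply: contraTneq ij => lm; rewrite jl lm xm ltnn.
  by case/eqP: (nl); apply: (@htA_inj _ _ y); rewrite xy' // ym.
have dead f : dom_of (val f) != imA x -> strand_act << x >> << f >> = 0.
  by rewrite strand_actU; apply: strand_act_gen0.
have [/andP[/imsetP[m _ im] jx]|nij] := boolP ((i \in imA x) &&
  (j \notin imA x)); last first.
  rewrite [RHS]big1 => [|y _]; last first.
    apply: big1 => m /andP[/half_im[xm _ jx] _]; case/negP: nij.
    by rewrite jx andbT -xm imset_f.
  rewrite /rho (lin_sum l_act) big1 // => S /andP[iS jS].
  rewrite /rhoS (lin_sum l_act) big1 // => f /forallP fS; apply: dead.
  apply: contra nij => /eqP <-; rewrite !inE !(eqP (fS _)) iS.
  by rewrite (negPf jS).
have [y xy] := bumped_exists m jx.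
have [r xry] : exists r : strand, links x (val r) y.
  by apply: strand_exists => // l; rewrite xy; case: eqP => // ->;
    rewrite -im ltnW.
rewrite (sum_rho l_act dead ij (esym im) xy jx xry) strand_actU
  (strand_act_genE xry).
rewrite (bumped_coef ij (esym im) xy) (bigD1 y) //= [X in _ + X]big1 ?addr0;
  last first.
  move=> y' ny; apply: big1 => m' /andP[/half_im[xm' xy' _] _]; case/eqP: ny.
  have mm' : m' = m by apply: (@htA_inj _ _ x); rewrite xm' im.
  by apply: htA_eq => l; rewrite xy' xy mm'.
rewrite big_mkcond (bigD1 m) //= big1 ?addr0; last first.
  move=> m' nm; case: ifP => // /andP[/half_im[xm' _ _] _]; case/eqP: nm.
  by apply: (@htA_inj _ _ x); rewrite xm' im.
have -> : is_halfA x y i j m = empty_of colA (htA x) (halfrectA m i j).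
  rewrite /is_halfA ij -im xy !eqxx /=; case: (empty_of _ _ _);
    rewrite ?andbF // andbT.
  by apply/forallP => l; apply/implyP => nl; rewrite xy (negPf nl).
by case: (empty_of _ _ _); case: eqP => _; rewrite /= ?mul1r ?mul0r ?scale0r.
Qed.

Lemma strand_act_action : is_CPA_action H strand_act.
Proof.
split.
- by move=> a c p p'; apply: strand_act_linl.
- by move=> p c a a'; apply: strand_act_linr.
- exact: strand_act_one.
- exact: strand_act_mul.
- exact: strand_act_idem.
- exact: strand_act_rho.
Qed.

End Action.

(** * The Leibniz rule for the type A module *)

Section Leibniz.
Variables (N k : nat).
Hypothesis hk : (k <= N)%N.
Variable H : grid N.
Local Notation ord := 'I_N.+1.
Local Notation IA := (IA N k).
Local Notation genA := (genA N k).
Local Notation strand := (strand N k).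
Local Notation alg := (alg N k).
Local Notation CPA := (CPA N k).
Local Notation colA := (@colA N k).
Local Notation hA x := (hgt (htA x)).
Local Notation ascA x := (asc colA (htA x)).
Local Notation wtA x y := (wt H (markA N k) colA (htA x) (htA y)).
Local Notation mA := (markA N k).
Implicit Types (x y z : genA) (f g h : strand) (a b m l : IA).

Let rcA_inj : injective (rcol colA) := rcol_inj (@colA_inj N k).
Local Notation coefA := (rect_coef H mA colA (@htA N k)).
Local Notation strand_act := (strand_act H).
Local Notation strand_act_gen := (strand_act_gen H).

Lemma diffA_linear : linear (@diffA N H k).
Proof. exact: fglift_linear. Qed.

Lemma diffAU x : diffA H << x >> =
  \sum_a \sum_(b | (colA a < colA b)%N) coefA x (swapA x a b) *: << swapA x a b
    >>.
Proof.
rewrite /diffA /rect_diff fgliftU; apply: rect_sumE.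
- exact: colA_inj.
- exact: htA_inj.
- exact: htA_eq.
- exact: ht_swapA.
Qed.

Lemma alg_diff_linear : linear (@alg_diff N k).
Proof. exact: fglift_linear. Qed.

Lemma alg_diffU f : alg_diff << f >> = \sum_(f' : strand) \sum_i
    \sum_(j | is_smoothing (val f) (val f') i j) << f' >> :> alg.
Proof. by rewrite /alg_diff fgliftU. Qed.

Lemma imA_swapA x a b : imA (swapA x a b) = imA x.
Proof.
apply/setP => i; apply/imsetP/imsetP => -[m _ ->].
  by exists (tperm a b m); rewrite // ht_swapA.
by exists (tperm a b m); rewrite // ht_swapA /= tpermK.
Qed.

Lemma links_swap x (f : pfun N) y a b :
  links x f y -> links (swapA x a b) f (swapA y a b).
Proof.
case/linksP=> d e; apply/linksP; rewrite imA_swapA d; split=> // m.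
by rewrite !ht_swapA /= e.
Qed.

Lemma hA_swap x a b : hA (swapA x a b) =1 hA x \o tperm a b.
Proof. by move=> m; rewrite /hgt ht_swapA. Qed.

Lemma smoothing_dom (f f' : pfun N) (i j : ord)
  : is_smoothing f f' i j -> dom_of f' = dom_of f.
Proof.
case/and5P=> /andP[_]; case fi : (f i) => [u|//]; case fj : (f j) => [v|//] _.
move=> /eqP f'i /eqP f'j /forallP fl _; apply/setP => l; rewrite !inE.
have [->|nli] := eqVneq l i; first by rewrite f'i fi.
have [->|nlj] := eqVneq l j; first by rewrite f'j fj.
by have := fl l; rewrite nli nlj /= => /eqP ->.
Qed.

Lemma links_out x (f : pfun N) y i : links x f y -> i \notin imA x -> f i = None.
Proof. by case/linksP=> <- _; rewrite inE negbK => /eqP. Qed.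

(** Smoothing keeps x and exchanges the heights of y on two columns; the drop in distance already
    implies that the strands cross. *)
Lemma smoothing_links x (f f' : pfun N) y a b : links x f y ->
  is_smoothing f f' (htA x a) (htA x b) =
  [&& (htA x a < htA x b)%N, links x f' (swapA y a b) &
      (kdist (hA x) (hA (swapA y a b))).+1 == kdist (hA x) (hA y)].
Proof.
move=> xfy; have [df ef] := linksP _ _ _ xfy; apply/idP/idP => [sm|].
  have df' := smoothing_dom sm.
  have [/andP[xab _] /eqP ea /eqP eb /forallP el crf] := and5P sm.
  have xfy' : links x f' (swapA y a b).
    apply/linksP; rewrite df'; split=> // m; rewrite ht_swapA /=.
    case: tpermP => [->|->|/eqP ma /eqP mb]; first by rewrite ea ef.
      by rewrite eb ef.
    have := el (htA x m); rewrite !(inj_eq (@htA_inj _ _ x)) ma mb /=.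
    by rewrite ef => /eqP.
  by rewrite xab xfy' -(links_cr xfy') -(links_cr xfy).
case/and3P=> xab xfy' drop; have [df' ef'] := linksP _ _ _ xfy'.
have nab : a != b by apply: contraTneq xab => ->; rewrite ltnn.
have yba : (htA y b < htA y a)%N.
  have := kdist_swap_cmp (@hA_inj _ _ x) (@hA_inj _ _ y) nab.
  rewrite -(eq_kdist (frefl _) (hA_swap y a b)) -(eqP drop) /hgt xab.
  by case: ifP => [/eqP <-//|_]; lia.
apply/and5P; split.
- by rewrite /crossing xab !ef.
- by rewrite ef' ef ht_swapA /= tpermL.
- by rewrite ef' ef ht_swapA /= tpermR.
- apply/forallP => i; apply/implyP => /andP[ia ib].
  have [/imsetP[m _ im]|ni] := boolP (i \in imA x).
    rewrite im ef' ef ht_swapA /= tpermD //.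
      by apply: contra_neq ia => ->.
    by apply: contra_neq ib => ->.
  have := ni; rewrite -df inE negbK => /eqP ->.
  by move: ni; rewrite -df' inE negbK.
- by rewrite (links_cr xfy) (links_cr xfy').
Qed.

Lemma strand_act_alg_diff x f y : links x (val f) y ->
  strand_act << x >> (alg_diff << f >>) =
  \sum_a \sum_(b | (colA a < colA b)%N)
    (((kdist (hA x) (hA (swapA y a b))).+1 == kdist (hA x) (hA y))%:R *
     (ascA (swapA y a b) == ascA x + kdist (hA x) (hA (swapA y a b)))%N%:R *
     wtA x (swapA y a b)) *: << swapA y a b >>.
Proof.
move=> xfy; have l_act := @strand_act_linr N k H << x >>;
  have [df ef] := linksP _ _ _ xfy.
have hxi := @hA_inj N k x; have hyi := @hA_inj N k y.
have colI : injective (fun a : IA => colA a : nat)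
  by move=> m l /val_inj/colA_inj.
(* Crossings are listed by increasing height in x, rectangles by increasing column. *)
rewrite -(@sum_ltn_sym _ _ (hA x) (fun a : IA => colA a : nat) _ hxi colI);
  last first.
  by move=> a b; rewrite (_ : swapA y b a = swapA y a b) //;
    apply: htA_eq => m; rewrite !ht_swapA /= tpermC.
transitivity (\sum_(i : ord) \sum_(j : ord)
    \sum_(f' : strand | is_smoothing (val f) (val f') i j) strand_act_gen x f').
  rewrite alg_diffU (lin_sum l_act).
  under eq_bigr => f' _.
    rewrite (lin_sum l_act); under eq_bigr do (rewrite (lin_sum l_act) big_mkcond;
      under eq_bigr do rewrite strand_actU).
    over.
  rewrite exchange_big; apply: eq_bigr => i _ /=.
  by rewrite exchange_big; apply: eq_bigr => j _ /=; rewrite [RHS]big_mkcond.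
rewrite (sum_inj_im (@htA_inj _ _ x)) => [|i ni]; last first.
  apply: big1 => j _; apply: big1 => f' /andP[/andP[_ cr_ij] _].
  by rewrite (links_out xfy ni) in cr_ij.
apply: eq_bigr => a _.
rewrite (sum_inj_im (@htA_inj _ _ x)) => [|i ni]; last first.
  apply: big1 => f' /andP[/andP[_ cr_ij] _].
  by rewrite (links_out xfy ni) in cr_ij; case: (val f _) cr_ij.
rewrite [RHS]big_mkcond; apply: eq_bigr => b _.
case: ifP => xab; last first.
  by apply: big_pred0 => f'; rewrite (smoothing_links _ _ _ xfy) xab.
case drop : (_ == kdist (hA x) (hA y)); last first.
  by rewrite !mul0r scale0r; apply: big_pred0 => f';
    rewrite (smoothing_links _ _ _ xfy) drop !andbF.
have nab : a != b by apply: contraTneq xab => ->; rewrite /hgt ltnn.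
have yba : (htA y b < htA y a)%N.
  have := kdist_swap_cmp hxi hyi nab.
  rewrite -(eq_kdist (frefl _) (hA_swap y a b)) -(eqP drop) xab.
  by case: ifP => [/eqP <-//|_]; lia.
have [f' xf'] : exists f' : strand, links x (val f') (swapA y a b).
  apply: strand_exists => // m; rewrite ht_swapA /=.
  case: tpermP => [->|->|_ _]; last exact: links_le xfy.
    by apply: leq_trans (ltnW xab) (links_le b xfy).
  by apply: leq_trans (ltnW yba); apply: links_le xfy.
rewrite (big_pred1 f') => [|f'']; last first.
  rewrite (smoothing_links _ _ _ xfy) drop andbT (xab : (htA x a < htA x b)%N) /=.
  by apply/idP/eqP => [/links_inj/(_ xf') /val_inj|->].
by rewrite (strand_act_genE H xf') mul1r.
Qed.

(** For a fixed pair of columns the three terms end at the same generator with the same weight.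
    Their coefficients are the conditions of [kdist_leibniz] for the reversed columns, x and y, and
    exclusive or is addition modulo 2. *)
Lemma strand_act_leibniz (p : CPA) (u : alg) :
  diffA H (strand_act p u) = strand_act (diffA H p) u + strand_act p (alg_diff u).
Proof.
have lA := diffA_linear.
have ll v := @strand_act_linl N k H v; have lr q := @strand_act_linr N k H q.
move: p; apply: fglift_ext => [c p q|c p q|x]; first by rewrite !(ll _, lA).
  by rewrite lA !(ll _) scalerDr addrACA.
move: u; apply: fglift_ext => [c u v|c u v|f]; first by rewrite !(lr _, lA).
  by rewrite alg_diff_linear !(lr _) scalerDr addrACA.
rewrite strand_actU; have [d|nd] := eqVneq (dom_of (val f)) (imA x); last first.
  rewrite strand_act_gen0 // (lin0 lA) diffAU (lin_sum (ll _)) big1 ?add0r =>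
    [|a _].
    rewrite alg_diffU (lin_sum (lr _)) big1 // => f' _.
    rewrite (lin_sum (lr _)) big1 // => i _; rewrite (lin_sum (lr _)) big1 //
      => j.
    by move/smoothing_dom => d; rewrite strand_actU strand_act_gen0 // d.
  rewrite (lin_sum (ll _)) big1 // => b _; rewrite (linZ (ll _)) strand_actU
    strand_act_gen0 ?scaler0 //.
  by rewrite imA_swapA.
have [y xfy] := links_exists d.
rewrite (strand_act_genE H xfy) (linZ lA) (strand_act_alg_diff xfy) !diffAU
  scaler_sumr.
rewrite (lin_sum (ll _)) -[RHS]big_split; apply: eq_bigr => a _.
rewrite scaler_sumr (lin_sum (ll _)) -[RHS]big_split; apply: eq_bigr => b cab /=.
rewrite (linZ (ll _)) strand_actU (strand_act_genE H (links_swap a b xfy))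
  !scalerA -scalerDl.
congr (_ *: _).
have nab : a != b by apply: contraTneq cab => ->; rewrite ltnn.
have := kdist_leibniz rcA_inj (@hA_inj _ _ x) (@hA_inj _ _ y) nab.
have -> : kdist (hA (swapA x a b)) (hA (swapA y a b)) = kdist (hA x) (hA y).
  by rewrite (eq_kdist (hA_swap _ _ _) (hA_swap _ _ _)) kdist_perm.
rewrite /= -!(eq_kdist (frefl _) (hA_swap _ _ _)) -!ascA_kdist /rect_coef.
set T1 := _ && _; set T2 := _ && _; set T3 := _ && _ => T.
have -> : (ascA y == (ascA x + kdist (hA x) (hA y))%N)%:R * wtA x y *
   (((ascA (swapA y a b)).+1 == ascA y)%:R * wtA y (swapA y a b)) =
   T1%:R * wtA x (swapA y a b).
  rewrite mulrACA -natrM mulnb -/T1; case T1E : T1; rewrite ?mul0r ?mul1r //.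
  apply: wt_mul; first exact: links_pot_le xfy.
  by apply: rect_coef_pot_le => //; [exact: colA_inj|exact: htA_inj|exact:
    ht_swapA|case/andP: T1E].
have -> : ((ascA (swapA x a b)).+1 == ascA x)%:R * wtA x (swapA x a b) *
   ((ascA (swapA y a b) == (ascA (swapA x a b) + kdist (hA x) (hA y))%N)%:R *
    wtA (swapA x a b) (swapA y a b)) = T2%:R * wtA x (swapA y a b).
  rewrite mulrACA -natrM mulnb -/T2; case T2E : T2; rewrite ?mul0r ?mul1r //.
  apply: wt_mul; last exact: links_pot_le (links_swap a b xfy).
  by apply: rect_coef_pot_le => //; [exact: colA_inj|exact: htA_inj|exact:
    ht_swapA|case/andP: T2E].
by rewrite -mulrDl -natrM mulnb -/T3 T natr_addb.
Qed.

Lemma idemE x (S : ksub N k) : val S = imA x ->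
  exists2 e : strand, links x (val e) x & idem S = << e >>.
Proof.
move=> xS; pose F : pfun N := [ffun i => if i \in val S then Some i else None].
have xF : links x F x.
  apply/linksP; split; last by move=> m; rewrite ffunE xS imset_f.
  by apply/setP => i; rewrite -xS inE ffunE; case: ifP.
rewrite /idem (eq_bigl (fun f : strand => [forall i, val f i == F i]));
  last first.
  by move=> g; apply: eq_forallb => i; rewrite ffunE.
have [e xex ->] := sum_strand_eq hk (fun e => << e >>
  : alg) (fun m => leqnn _) xF.
by exists e.
Qed.

Lemma alg_mul_links x y z f g h :
    links x (val f) y -> links y (val g) z -> links x (val h) z ->
    kdist (hA x) (hA z) = (kdist (hA x) (hA y) + kdist (hA y) (hA z))%N ->
  alg_mul << f >> << g >> = << h >>.
Proof.
move=> xfy ygz xhz D; rewrite alg_mulU (big_pred1 h) // => h'.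
apply/idP/eqP => [p|->]; last by rewrite (links_product xfy ygz xhz) D.
exact/val_inj/(links_inj (product_links xfy ygz p) xhz).
Qed.

Lemma alg_mul_idem (S : ksub N k) f : dom_of (val f) = val S ->
  alg_mul (idem S) << f >> = << f >>.
Proof.
move=> dS; have [x xS] := genA_of_set hk (eqP (valP S)).
have [y xfy] := links_exists (etrans dS (esym xS)).
have [e xex ->] := idemE (esym xS); apply: (alg_mul_links xex xfy xfy).
by rewrite kdistxx.
Qed.

Lemma dom_ksub f : exists S : ksub N k, val S = dom_of (val f).
Proof. by have [/eqP cf _ _] := strandP f; exists (exist (fun S
  : {set ord} => #|S| == k) _ cf). Qed.

(** * Uniqueness of the action *)

Section Uniqueness.
Variable act : CPA -> alg -> CPA.
Hypothesis actP : is_CPA_action H act.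

Lemma action_unique p u : act p u = strand_act p u.
Proof.
have ll v : linear (act^~ v) by move=> ? ? ?; apply: (act_linear_l actP).
have lr q : linear (act q) by move=> ? ? ?; apply: (act_linear_r actP).
have strand_actP := strand_act_action hk H.
move: p; apply: fglift_ext => [||x]; [exact: ll|exact: strand_act_linl|].
move: u; apply: fglift_ext => [||f]; [exact: lr|exact: strand_act_linr|].
(* g is the product of the idempotent of its domain and g, and this idempotent kills z. *)
have dead g z : dom_of (val g) != imA z -> act << z >> << g >> = 0.
  move=> nd; have [S Sg] := dom_ksub g.
  rewrite -(alg_mul_idem (esym Sg)) (act_mul actP) (act_idem actP) Sg.
  by rewrite ifN_eq ?(lin0 (ll _)) // eq_sym.
have dead0 g z : dom_of (val g) != imA z -> strand_act << z >> << g >> = 0.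
  by rewrite strand_actU; apply: strand_act_gen0.
have [d|nd] := eqVneq (dom_of (val f)) (imA x); last by rewrite dead // dead0.
have [y xfy] := links_exists d.
(* The induction is on the number of moving strands, with y fixed and x varying. *)
pose moved z := #|[set m | (htA z m < htA y m)%N]|.
have [n] := ubnP (moved x); elim: n x f d xfy => // n IHn x f d xfy mx.
have [/existsP[m0 lt0]|none] := boolP [exists m, (htA x m < htA y m)%N];
  last first.
  have xy : y = x.
    apply: htA_eq => m; apply/val_inj/eqP; rewrite eqn_leq (links_le m xfy)
      leqNgt andbT.
    by apply: contra none => ?; apply/existsP; exists m.
  have [S Sf] := dom_ksub f; have [e xex SE] := idemE (etrans Sf d).
  have -> : << f >> = idem S.
    by rewrite SE; congr << _ >>; apply/val_inj; apply: links_inj xex;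
      rewrite -{2}xy.
  by rewrite (act_idem actP) (act_idem strand_actP).
(* All strands above the highest moving one are fixed, so its endpoint is not a height of x and a
   [rho] can carry it there. *)
case: (@arg_maxnP _ m0 (fun m => (htA x m < htA y m)%N) (fun m => htA x m
  : nat) lt0).
move=> m lt maxm; have fixed l : (htA x m < htA x l)%N -> htA y l = htA x l.
  move=> ml; apply/val_inj/eqP; rewrite eqn_leq (links_le l xfy) andbT leqNgt.
  by apply: contraL ml => /maxm; rewrite -leqNgt.
have jx : htA y m \notin imA x.
  apply/negP => /imsetP[l _ e]; have ml : (htA x m < htA x l)%N by rewrite -e.
  by have := fixed l ml; rewrite -e => /htA_inj le; rewrite le ltnn in ml.
have [z xz] := bumped_exists m jx.
have xz_le l : (htA x l <= htA z l)%N by rewrite xz; case: eqP => // ->;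
  apply: ltnW.
have zy_le l : (htA z l <= htA y l)%N by rewrite xz; case: eqP => // [->|_]//;
  apply: links_le xfy.
have [r xrz] := strand_exists hk xz_le; have [g zgy] := strand_exists hk zy_le.
(* r makes the strand m cross only strands above it. These do not move in g, so no pair crosses
   twice and the product is nonzero. *)
have fE : << f >> = alg_mul << r >> << g >>.
  symmetry; apply: (alg_mul_links xrz zgy xfy); apply/eqP.
  rewrite kdist_triangle_eq; [|exact: hA_inj|exact: hA_inj|exact: hA_inj].
  apply/forallP => a; apply/forallP => b; rewrite /hgt !xz; apply/and3P => -[xab].
  case: (eqVneq b m) xab => [->|_] xab; case: (eqVneq a m) xab => [->|_] xab.
  - by rewrite ltnn.
  - by rewrite ltnNge (ltnW (ltn_trans xab lt)).
  - by rewrite (fixed b xab) => lt1; rewrite ltnNge (ltnW lt1).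
  - by rewrite ltnNge (ltnW xab).
(* r is the only summand of [rho] whose domain is the image of x, so the axiom on [rho] determines
   its action there. *)
have act_r : act << x >> << r >> = strand_act << x >> << r >>.
  rewrite -(sum_rho hk (lr _) (fun g => @dead g x) lt erefl xz jx xrz).
  rewrite -(sum_rho hk (@strand_act_linr _ _ H _) (fun g =>
    @dead0 g x) lt erefl xz jx xrz).
  by rewrite (act_rho actP) // (act_rho strand_actP).
rewrite fE (act_mul actP) (act_mul strand_actP) act_r strand_actU
  (strand_act_genE H xrz).
rewrite (linZ (ll _)) (linZ (@strand_act_linl _ _ H _)); congr (_ *: _).
apply: IHn => //; first by case/linksP: zgy.
rewrite ltnS in mx; apply: leq_trans mx; apply: proper_card.
apply/properP; split; last by exists m; rewrite !inE ?lt // xz eqxx ltnn.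
by apply/subsetP => l; rewrite !inE xz; case: eqP => // ->; rewrite ltnn.
Qed.

End Uniqueness.
End Leibniz.

(** * The type D module *)

Section TypeD.
Variables (N k : nat).
Hypothesis hk : (k <= N)%N.
Variable H : grid N.
Local Notation ord := 'I_N.+1.
Local Notation strand := (strand N k).
Local Notation alg := (alg N k).
Local Notation modD := (modD N k).
Local Notation CPD := (CPD N k).
Local Notation genD := (genD N k).
Local Notation ID := (ID N k).
Local Notation colD := (@colD N k).
Implicit Types (f g h : strand) (S : ksub N k) (x y : genD).

Lemma strand_links f : exists x y : genA N k, links x (val f) y.
Proof.
have [cf _ _] := strandP f; have [x xf] := genA_of_set hk cf.
by have [y xfy] := links_exists (esym xf); exists x, y.
Qed.

Lemma card_cod f : #|cod_of (val f)| = k.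
Proof. by have [x [y xfy]] := strand_links f; rewrite (links_cod xfy) card_imA.
  Qed.

Lemma product_cod f g (h : pfun N) :
  is_product (val f) (val g) h -> cod_of h = cod_of (val g).
Proof.
move=> p; have [x [y xfy]] := strand_links f; have [/eqP cfg _ _] := and3P p.
have [z ygz] : exists z, links y (val g) z.
  by apply: links_exists; rewrite -cfg (links_cod xfy).
by rewrite (links_cod (product_links xfy ygz p)) (links_cod ygz).
Qed.

Lemma smoothing_cod f (f' : strand) (i j : ord) :
  is_smoothing (val f) (val f') i j -> cod_of (val f') = cod_of (val f).
Proof.
case/and5P=> _ /eqP fi /eqP fj /forallP fl _; apply/setP => l; rewrite !inE.
have {}fl m : m != i -> m != j -> val f' m = val f m.
  by move=> mi mj; have := fl m; rewrite mi mj => /eqP.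
apply/existsP/existsP => -[m /eqP e].
  have [mi|mi] := eqVneq m i; first by exists j; rewrite -fi -mi e.
  have [mj|mj] := eqVneq m j; first by exists i; rewrite -fj -mj e.
  by exists m; rewrite -fl // e.
have [mi|mi] := eqVneq m i; first by exists j; rewrite fj -mi e.
have [mj|mj] := eqVneq m j; first by exists i; rewrite fi -mj e.
by exists m; rewrite fl // e.
Qed.

Lemma alg_mul_idemr f S :
  alg_mul << f >> (idem S) = if cod_of (val f) == val S then << f >> else 0.
Proof.
have [z zS] := genA_of_set hk (eqP (valP S)); have [e zez ->] := idemE hk (esym
  zS).
have [x [y xfy]] := strand_links f; case: eqP => [cS|nS].
  have yez : links y (val e) y.
    have [de ee] := linksP _ _ _ zez; apply/linksP.
    rewrite de zS -(links_cod xfy) cS; split=> // m.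
    have /imsetP[l _ ->] : htA y m \in imA z by rewrite zS -cS (links_cod xfy)
      imset_f.
    exact: ee.
  by apply: (alg_mul_links xfy yez xfy); rewrite kdistxx addn0.
rewrite alg_mulU big_pred0 // => h; apply/negP => /and3P[/eqP ce _ _].
by case: nS; rewrite ce -zS; case/linksP: zez.
Qed.

Lemma alg_mulr1 (a : alg) : alg_mul a (alg_one N k) = a.
Proof.
move: a; apply: fglift_ext => [||f] //; first exact: alg_mul_linl.
have cf : #|cod_of (val f)| == k by rewrite card_cod.
rewrite /alg_one (lin_sum (@alg_mul_linr _ _ _)).
rewrite (bigD1 (exist (fun S : {set ord} => #|S| == k) _ cf)) //= alg_mul_idemr
  eqxx.
rewrite big1 ?addr0 // => S nS; rewrite alg_mul_idemr ifN_eq //.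
by apply: contra_neq nS => e; apply/val_inj; rewrite /= e.
Qed.

Lemma alg_mul1r (a : alg) : alg_mul (alg_one N k) a = a.
Proof.
move: a; apply: fglift_ext => [||f] //; first exact: alg_mul_linr.
have [S0 Sf] := dom_ksub f.
rewrite /alg_one (lin_sum (@alg_mul_linl _ _ _)) (bigD1 S0) //= alg_mul_idem //.
rewrite big1 ?addr0 // => S nS; have [z zS] := genA_of_set hk (eqP (valP S)).
have [e zez ->] := idemE hk (esym zS); rewrite alg_mulU big_pred0 // => h.
apply/negP => /and3P[/eqP ce _ _]; case/eqP: nS; apply/val_inj.
by rewrite Sf -ce (links_cod zez) zS.
Qed.

(** The instance of associativity that lets left multiplication descend to the tensor product over
    the idempotents. *)
Lemma alg_mulA_idem (b a : alg) S :
  alg_mul b (alg_mul a (idem S)) = alg_mul (alg_mul b a) (idem S).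
Proof.
have ll (u : alg) := @alg_mul_linl N k u; have lr (u
  : alg) := @alg_mul_linr N k u.
move: b; apply: fglift_ext => [||g]; first exact: ll.
  by move=> c u v; rewrite !ll.
move: a; apply: fglift_ext => [c u v|c u v|f].
- by rewrite ll lr.
- by rewrite lr ll.
rewrite alg_mul_idemr alg_mulU (lin_sum (ll _)).
case: ifP => cS.
  by rewrite alg_mulU; apply: eq_bigr => h /product_cod ch;
    rewrite alg_mul_idemr ch cS.
by rewrite (lin0 (lr _)) big1 // => h /product_cod ch;
  rewrite alg_mul_idemr ch cS.
Qed.

Lemma alg_diff_idem (S : ksub N k) : alg_diff (idem S) = 0.
Proof.
have [z zS] := genA_of_set hk (eqP (valP S)); have [e zez ->] := idemE hk (esym
  zS).
rewrite alg_diffU big1 // => f _; apply: big1 => i _; apply: big_pred0 => j.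
apply/negP => /and5P[_ _ _ _]; rewrite (links_cr zez) kdistxx //.
Qed.

Lemma tensD_linr (a : alg) : linear (tensD a : modD -> CPD).
Proof. exact: tens_linr. Qed.

Lemma tensD_linl (v : modD) : linear ((@tensD N k)^~ v).
Proof. exact: tens_linl. Qed.

Lemma idem_inclU S : idem_incl << S >> = idem S.
Proof. by rewrite /idem_incl fgliftU. Qed.

Lemma idem_lactU S x : idem_lact << S >> << x >> =
  if [disjoint val S & imD x] then << x >> else 0 :> modD.
Proof. by rewrite /idem_lact !fgliftU. Qed.

(** f absorbs the idempotent of its range on the right; moved across the tensor sign, this
    idempotent kills x. *)
Lemma tensD_dead f x : ~~ [disjoint cod_of (val f) & imD x] ->
  tensD << f >> << x >> = 0.
Proof.
move=> nd; have cf : #|cod_of (val f)| == k by rewrite card_cod.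
pose S : ksub N k := exist (fun S : {set ord} => #|S| == k) _ cf.
have {1}-> : << f >> = idem_ract << f >> << S >> :> alg.
  by rewrite /idem_ract idem_inclU alg_mul_idemr eqxx.
rewrite /tensD tensB idem_lactU (negPf nd).
exact: (lin0 (@tensD_linr _)).
Qed.

Lemma lactD_map_balanced (b : alg) :
  balanced (@idem_ract N k) (@idem_lact N k) (lactD_map b).
Proof.
split.
- by move=> v c p p'; rewrite /lactD_map alg_mul_linr tensD_linl.
- by move=> p c v v'; rewrite /lactD_map tensD_linr.
move=> a e v; rewrite /lactD_map /tensD -[RHS]tensB; congr (tens _ _ _ v).
rewrite /idem_ract; move: e; apply: fglift_ext => [c e e'|c e e'|S].
- by rewrite /idem_incl fglift_linear !alg_mul_linr.
- by rewrite /idem_incl fglift_linear !alg_mul_linr.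
by rewrite idem_inclU alg_mulA_idem.
Qed.

Lemma lactDE (b a : alg) (v : modD) : lactD b (tensD a v) = tensD (alg_mul b a) v.
Proof. exact: (tens_liftE (lactD_map_balanced b)). Qed.

Lemma lactD_linr (b : alg) : linear (@lactD N k b).
Proof. exact/tens_lift_lin/lactD_map_balanced. Qed.

Lemma lactD_linl (w : CPD) : linear ((@lactD N k)^~ w).
Proof.
apply: tens_lift_linl => a v c b b'.
by rewrite /lactD_map alg_mul_linl tensD_linl.
Qed.

Lemma lactD1 (w : CPD) : lactD (alg_one N k) w = w.
Proof.
move: w; apply: tensor_ext => [||a v] //; first exact: lactD_linr.
by rewrite -/(tensD a v) lactDE alg_mul1r.
Qed.

Lemma htD_inj x : injective (htD x).
Proof. by case: x => x xi; apply/injectiveP. Qed.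

Lemma htD_eq x y : htD x =1 htD y -> x = y.
Proof. by move=> e; apply/val_inj/ffunP. Qed.

Lemma colD_inj : injective colD.
Proof. exact: val_inj. Qed.

Lemma deltaD_linear : linear (@deltaD N H k).
Proof. exact: fglift_linear. Qed.

Lemma is_rect_imD x y (a b : ID) : is_rect colD (htD x) (htD y) a b -> imD y
  = imD x.
Proof.
rewrite is_rectE; [|exact: colD_inj|exact: htD_inj].
case/and3P=> _ /forallP yx _; apply/setP => i; apply/imsetP/imsetP => -[m _ ->].
  by exists (tperm a b m); rewrite // (eqP (yx m)).
by exists (tperm a b m); rewrite // (eqP (yx _)) tpermK.
Qed.

(** From x to y the half-strip replaces height j by i, while [rho] replaces i by j in S, so
    disjointness after the move implies disjointness before it. *)
Lemma halfD_disjoint x y (i j : ord) (m : ID) (S : {set ord}) :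
    is_halfD x y i j m -> i \in S -> j \notin S ->
    [disjoint j |: (S :\ i) & imD y] -> [disjoint S & imD x].
Proof.
case/and5P=> ij /eqP xm /eqP ym /forallP xy _ iS jS /pred0P d; apply/pred0P => l.
have {}xy l' : l' != m -> htD y l' = htD x l'.
  by move=> nl; move: (xy l'); rewrite nl => /eqP.
apply/negP => /andP[lS /imsetP[m' _ lm']].
have {}lS : l \in S := lS.
have nm : m' != m by apply: contraNneq jS => e; rewrite -xm -e -lm'.
have li : l != i.
  apply: contra_neq nm => li; apply: (@htD_inj y).
  by rewrite ym xy ?lm' -?lm' // ; apply: contraNneq jS => e; rewrite -xm -e -lm'.
have := d l; rewrite /= !inE li lS orbT /= => /negP; apply.
by apply/imsetP; exists m' => //; rewrite xy.
Qed.

Lemma rhoS_dom (S : ksub N k) (i j : ord) f : i \in val S ->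
    [forall l, val f l == if l \in val S then Some (if l == i then j else l)
      else None] ->
  dom_of (val f) = val S /\ cod_of (val f) = j |: (val S :\ i).
Proof.
move=> iS /forallP fS; split; apply/setP => l; rewrite !inE.
  by rewrite (eqP (fS l)); case: ifP.
apply/existsP/idP => [[u]|].
  rewrite (eqP (fS u)); case: ifP => // uS /eqP[].
  by case: eqP => [_ -> |/eqP ui <-]; rewrite ?eqxx // ui uS orbT.
case/orP=> [/eqP ->|/andP[li lS]]; first by exists i;
  rewrite (eqP (fS _)) iS eqxx.
by exists l; rewrite (eqP (fS _)) lS (negPf li).
Qed.

(** The differential respects idempotents: rectangles preserve the image of x, and half-strips are
    covered by [halfD_disjoint]. *)
Lemma lactD_delta_dead f x : ~~ [disjoint cod_of (val f) & imD x] ->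
  lactD << f >> (deltaD H << x >>) = 0.
Proof.
move=> nd; have lL (b : alg) := lactD_linr b.
rewrite /deltaD fgliftU (linD (lL _)) [X in X + _](_ : _ = 0).
  rewrite add0r (lin_sum (lL _)) big1 // => y _.
  rewrite (lin_sum (lL _)) big1 // => i _; rewrite (lin_sum (lL _)) big1 // =>
    j _.
  rewrite (lin_sum (lL _)) big1 // => m /andP[half _]; rewrite (linZ (lL _)).
  rewrite /rho (lin_sum (@tensD_linl _)) (lin_sum (lL _)) big1 ?scaler0 //.
  move=> S /andP[iS jS]; rewrite /rhoS (lin_sum (@tensD_linl _)) (lin_sum (lL _)).
  apply: big1 => g /(rhoS_dom iS)[dg cg].
  have [d|/tensD_dead->] := boolP [disjoint cod_of (val g) & imD y];
    last exact: (lin0 (lL _)).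
  rewrite cg in d; have Sx := halfD_disjoint half iS jS d.
  rewrite lactDE alg_mulU big_pred0 ?(lin0 (@tensD_linl _)) // => h.
  by apply/negP => /and3P[/eqP cf _ _]; rewrite cf dg Sx in nd.
rewrite /rect_sum (lin_sum (lL _)) big1 // => y _.
rewrite (lin_sum (lL _)) big1 // => a _; rewrite (lin_sum (lL _)) big1 // => b.
case/andP=> /is_rect_imD yx _; rewrite (linZ (lL _)) lactDE alg_mulr1.
by rewrite tensD_dead ?scaler0 // yx.
Qed.

Lemma card_imD x : #|imD x| = (N.+1 - k)%N.
Proof.
rewrite card_imset; last exact: htD_inj.
rewrite card_sig -[N.+1 in RHS]card_ord -(cardC (fun i : ord => (i < k)%N)).
have -> : #|[pred i : ord | (i < k)%N]| = k.
  rewrite -sum1_card (big_ord_narrow (leq_trans hk (leqnSn N))).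
  by rewrite sum1_card card_ord.
by rewrite addKn; apply: eq_card => i; rewrite !inE -leqNgt.
Qed.

(** The cardinalities k and N + 1 - k add up to N + 1, so disjoint means complementary. *)
Lemma disjoint_setC (S : {set ord}) x : #|S| = k ->
  [disjoint S & imD x] = (S == ~: imD x).
Proof.
move=> cS; rewrite disjoints_subset eqEcard cS cardsCs setCK card_imD card_ord.
by rewrite subKn ?leqnn ?andbT // ltnW.
Qed.

Lemma diffD_map_balanced : balanced (@idem_ract N k) (@idem_lact N k)
  (diffD_map H (k := k)).
Proof.
split=> [v c a a'|a c v v'|a e v].
- by rewrite /diffD_map alg_diff_linear tensD_linl lactD_linl scalerDr addrACA.
- by rewrite /diffD_map tensD_linr deltaD_linear lactD_linr scalerDr addrACA.
have lin1 v' : linear ((diffD_map H (k := k))^~ v').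
  move=> c b b'.
  by rewrite /diffD_map alg_diff_linear tensD_linl lactD_linl scalerDr addrACA.
have lin2 b : linear (diffD_map H (k := k) b).
  move=> c w w'.
  by rewrite /diffD_map tensD_linr deltaD_linear lactD_linr scalerDr addrACA.
have linI : linear (@idem_incl N k) by apply: fglift_linear.
move: e; apply: fglift_ext => [c e e'|c e e'|S].
- by rewrite /idem_ract linI alg_mul_linr lin1.
- by rewrite /idem_lact fglift_linear lin2.
move: a; apply: fglift_ext => [c a a'|c a a'|f].
- by rewrite /idem_ract alg_mul_linl lin1.
- by rewrite lin1.
move: v; apply: fglift_ext => [|c v v'|x].
- exact: lin2.
- rewrite -lin2; congr (diffD_map _ _); rewrite /idem_lact !fgliftU;
    exact: fglift_linear.
rewrite /idem_ract idem_inclU alg_mul_idemr idem_lactU.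
have dead : ~~ [disjoint cod_of (val f) & imD x] ->
  diffD_map H << f >> << x >> = 0.
  move=> nd; rewrite /diffD_map lactD_delta_dead // addr0 alg_diffU.
  rewrite (lin_sum (@tensD_linl _)) big1 // => g _.
  rewrite (lin_sum (@tensD_linl _)) big1 // => i _.
  rewrite (lin_sum (@tensD_linl _)) big1 // => j /smoothing_cod cg.
  by rewrite tensD_dead // cg.
rewrite !disjoint_setC ?card_cod ?(eqP (valP S)) // in dead *.
(* Either both idempotent conditions hold and the sides coincide, or the surviving side, if any, is
   killed by [dead]. *)
case: eqP => cS; case: eqP => Sx.
- by [].
- by rewrite (lin0 (lin2 _)) dead // cS; apply/eqP.
- by rewrite (lin0 (lin1 _)) dead //; apply/eqP => e; apply: cS; rewrite e Sx.
- by rewrite (lin0 (lin1 _)) (lin0 (lin2 _)).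
Qed.

Lemma diffDE (a : alg) (v : modD) :
  diffD H (tensD a v) = tensD (alg_diff a) v + lactD a (deltaD H v).
Proof. exact: (tens_liftE diffD_map_balanced). Qed.

Lemma diffD_linear : linear (@diffD N H k).
Proof. exact/tens_lift_lin/diffD_map_balanced. Qed.

Lemma alg_diff1 : alg_diff (alg_one N k) = 0.
Proof.
rewrite /alg_one (lin_sum (@alg_diff_linear N k)).
by apply: big1 => S _; apply: alg_diff_idem.
Qed.

Lemma diffD_gen (v : modD) : diffD H (tensD (alg_one N k) v) = deltaD H v.
Proof. by rewrite diffDE alg_diff1 (lin0 (@tensD_linl _)) add0r lactD1. Qed.

End TypeD.

(** * The pairing *)

Section Pairing.
Variables (N k : nat).
Hypothesis hk : (k <= N)%N.
Variable H : grid N.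
Local Notation A := {mpoly 'F_2[N]}.
Local Notation ord := 'I_N.+1.
Local Notation alg := (alg N k).
Local Notation CPA := (CPA N k).
Local Notation modD := (modD N k).
Local Notation CPD := (CPD N k).
Local Notation genA := (genA N k).
Local Notation genD := (genD N k).
Local Notation ID := (ID N k).
Local Notation IA := (IA N k).
Local Notation colA := (@colA N k).
Local Notation colD := (@colD N k).
Local Notation one := (alg_one N k).
Local Notation perms := 'S_N.+1.
Local Notation cpCar := {freeg perms / A}.
Implicit Types (x : genA) (y : genD) (z : 'S_N.+1).

Variable act : CPA -> alg -> CPA.
Hypothesis actP : is_CPA_action H act.

Local Notation tensAD := (tensAD act).
Local Notation tns p q := (tens act (@lactD N k) p q).

Lemma action_linl a : linear (act^~ a).
Proof. by move=> c p p'; apply: (act_linear_l actP). Qed.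

Lemma action_linr p : linear (act p).
Proof. by move=> c a a'; apply: (act_linear_r actP). Qed.

Lemma action_leibniz p u : diffA H (act p u) = act (diffA H p) u + act p
  (alg_diff u).
Proof. by rewrite !(action_unique hk actP) strand_act_leibniz. Qed.

Lemma tns_linl q : linear (fun p => tns p q).
Proof. exact: tens_linl. Qed.

Lemma tns_linr p : linear (fun q => tns p q).
Proof. exact: tens_linr. Qed.

Lemma tnsB p a q : tns (act p a) q = tns p (lactD a q).
Proof. exact: tensB. Qed.

(** The normal form of tensors: all of the algebra is absorbed by the type A factor. *)
Lemma tns_gen p a (v : modD) : tns p (tensD a v) = tns (act p a) (tensD one v).
Proof. by rewrite tnsB lactDE // alg_mulr1. Qed.

Lemma diffAD_map_balanced : balanced act (@lactD N k) (diffAD_map H act).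
Proof.
have lD := diffD_linear hk H; have lA := @diffA_linear N k H.
have lin1 q : linear (fun p => diffAD_map H act p q).
  by move=> c p p'; rewrite /diffAD_map lA !(tns_linl _ c) scalerDr addrACA.
have lin2 p : linear (diffAD_map H act p).
  by move=> c q q'; rewrite /diffAD_map lD !(tns_linr _ c) scalerDr addrACA.
split=> [q c p p'|p c q q'|p b q]; [exact: lin1|exact: lin2|].
move: q; apply: tensor_ext => [|c q q'|a v]; first exact: lin2.
  by rewrite (lactD_linr hk) lin2.
(* Both sides equal d(pba) (x) t + pba (x) w: the Leibniz rule is used for pb and a on the left, for
   p and ba on the right. *)
set w := deltaD H v; set t := tensD one v.
rewrite -/(tensD a v) (lactDE hk) /diffAD_map (diffDE hk) (diffDE hk) -/w.
rewrite (linD (tns_linr _)) (linD (tns_linr p)) -(tnsB (act p b) a) -(tnsB p _ w).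
rewrite (tns_gen _ a) (tns_gen _ (alg_diff a)).
rewrite (tns_gen _ (alg_mul b a)) (tns_gen _ (alg_diff (alg_mul b a))) -/t.
rewrite !addrA -(linD (tns_linl t)) -(linD (tns_linl t)) -action_leibniz
  -action_leibniz.
by rewrite (act_mul actP).
Qed.

Lemma diffADE p q : diffAD H (tns p q) = tns (diffA H p) q + tns p (diffD H q).
Proof. exact: (tens_liftE diffAD_map_balanced). Qed.

Lemma diffAD_linear : linear (diffAD H (act := act)).
Proof. exact/tens_lift_lin/diffAD_map_balanced. Qed.

Lemma tns_dead x y : ~~ [disjoint imA x & imD y] ->
  tns << x >> (tensD one << y >>) = 0.
Proof.
move=> nd; have cx : #|imA x| == k by rewrite card_imA.
pose S : ksub N k := exist (fun S : {set ord} => #|S| == k) _ cx.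
have {1}-> : << x >> = act << x >> (idem S) by rewrite (act_idem actP) eqxx.
have [e xex ->] := @idemE N k hk x S erefl.
rewrite tnsB lactDE // alg_mulr1 // tensD_dead // ?(lin0 (tns_linr _)) //.
by rewrite (links_cod xex).
Qed.

Lemma resA_subproof z : injectiveb [ffun m : IA => z (colA m)].
Proof. by apply/injectiveP => m l; rewrite !ffunE => /perm_inj/val_inj. Qed.

Definition resA z : genA :=
  exist (fun u : {ffun IA -> ord} => injectiveb u) _ (resA_subproof z).

Lemma ht_resA z m : htA (resA z) m = z (colA m).
Proof. by rewrite /htA /= ffunE. Qed.

Lemma resD_subproof z : injectiveb [ffun m : ID => z (colD m)].
Proof. by apply/injectiveP => m l; rewrite !ffunE => /perm_inj/val_inj. Qed.

Definition resD z : genD :=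
  exist (fun u : {ffun ID -> ord} => injectiveb u) _ (resD_subproof z).

Lemma ht_resD z m : htD (resD z) m = z (colD m).
Proof. by rewrite /htD /= ffunE. Qed.

Lemma col_cases (m : ord) : (exists a : IA, m = colA a) \/ (exists b
  : ID, m = colD b).
Proof.
have [mk|km] := ltnP m k; [left|right].
  by exists (exist (fun m : ord => (m < k)%N) m mk).
by exists (exist (fun m : ord => (k <= m)%N) m km).
Qed.

Lemma res_inj z z' : resA z = resA z' -> resD z = resD z' -> z = z'.
Proof.
move=> eA eD; apply/permP => m; have [[a ->]|[b ->]] := col_cases m.
  by rewrite -!ht_resA eA.
by rewrite -!ht_resD eD.
Qed.

Lemma res_disjoint z : [disjoint imA (resA z) & imD (resD z)].
Proof.
apply/pred0P => i; apply/negP => /andP[/imsetP[a _ ->] /imsetP[b _]].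
rewrite ht_resA ht_resD => /perm_inj ab; have := valP a; have := valP b => /=.
by rewrite leqNgt -[val a]/(colA a) ab => /negP.
Qed.

Lemma res_exists x y : [disjoint imA x & imD y] -> exists z, resA z
  = x /\ resD z = y.
Proof.
(* Every column lies on one side of Z, so the final default m is never reached. *)
move=> d; pose u (m : ord) : ord :=
  if insub m is Some a then htA x a else if insub m is Some b then htD y b else m.
have uA a : u (colA a) = htA x a by rewrite /u valK.
have uD b : u (colD b) = htD y b.
  rewrite /u insubN ?valK // -leqNgt; exact: valP b.
have ui : injective u.
  have dis a b : htA x a <> htD y b.
    move=> e; have /pred0P/(_ (htA x a)) := d.
    by rewrite /= imset_f // e imset_f.
  move=> m l; have [[a ->]|[b ->]] := col_cases m;
    have [[a' ->]|[b' ->]] := col_cases l; rewrite ?uA ?uD.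
  - by move/htA_inj->.
  - by move/dis.
  - by move/esym/dis.
  - by move/htD_inj->.
exists (perm ui); split.
  by apply: htA_eq => a; rewrite ht_resA permE uA.
by apply: htD_eq => b; rewrite ht_resD permE uD.
Qed.

(** There is one term if the images of x and y are disjoint and none otherwise; the sum supplies the
    value 0 in the second case. *)
Definition glue_gen x y : cpCar := \sum_(z | (resA z == x) &&
  (resD z == y)) << z >>.

Definition glue (p : CPA) (v : modD) : cpCar :=
  fglift (fun x => fglift (glue_gen x) v : cpCar) p.

Lemma glue_linl v : linear (glue^~ v).
Proof. exact: fglift_linear. Qed.

Lemma glue_linr p : linear (glue p).
Proof.
move=> c v w; rewrite /glue !fglift_sum scaler_sumr -big_split.
by apply: eq_bigr => x _; rewrite /= fglift_linear scalerDr !scalerA mulrC.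
Qed.

Lemma glueU x y : glue << x >> << y >> = glue_gen x y.
Proof. by rewrite /glue !fgliftU. Qed.

Lemma glue_gen_res z : glue_gen (resA z) (resD z) = << z >>.
Proof.
rewrite /glue_gen (big_pred1 z) // => z'.
by apply/andP/eqP => [[/eqP eA /eqP eD]|->//]; apply: res_inj.
Qed.

Lemma glue_gen0 x y : ~~ [disjoint imA x & imD y] -> glue_gen x y = 0.
Proof.
move=> nd; apply: big_pred0 => z; apply/andP => -[/eqP eA /eqP eD].
by case/negP: nd; rewrite -eA -eD res_disjoint.
Qed.

Lemma glue_balanced p :
  balanced (@idem_ract N k) (@idem_lact N k) (fun a v => glue (act p a) v).
Proof.
split=> [v c a a'|a c v v'|a e v].
- by rewrite action_linr glue_linl.
- by rewrite glue_linr.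
have linI : linear (@idem_incl N k) by apply: fglift_linear.
rewrite /idem_ract (act_mul actP); move: (act p a) => {p a} p.
have lI w : linear (fun e => idem_lact e w : modD) by apply: fglift_linear.
have lI2 u : linear (idem_lact u : modD -> modD).
  apply: (@fglift_lin_fun _ _ _ _ (fun w (S : ksub N k) => fglift (fun x : genD =>
    if [disjoint val S & imD x] then << x >> else 0 : modD) w)) => S.
  exact: fglift_linear.
move: e; apply: fglift_ext => [c e e'|c e e'|S].
- by rewrite linI action_linr glue_linl.
- by rewrite (lI v) glue_linr.
rewrite idem_inclU; move: p; apply: fglift_ext => [c p p'|c p p'|x].
- by rewrite action_linl glue_linl.
- by rewrite glue_linl.
rewrite (act_idem actP); move: v; apply: fglift_ext => [c v v'|c v v'|y].
- by rewrite glue_linr.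
- by rewrite (lI2 << S >>) glue_linr.
rewrite idem_lactU; have cS := eqP (valP S).
have [d|nd] := boolP [disjoint imA x & imD y].
  have dx : imA x = ~: imD y by apply/eqP; rewrite -(disjoint_setC hk) ?card_imA.
  rewrite (disjoint_setC hk) // dx [in RHS]eq_sym; case: eqP => // _.
  by rewrite (lin0 (glue_linl _)) (lin0 (glue_linr _)).
transitivity (0 : cpCar).
  by case: ifP => _; rewrite ?glueU ?glue_gen0 // (lin0 (glue_linl _)).
by case: ifP => _; rewrite ?glueU ?glue_gen0 // (lin0 (glue_linr _)).
Qed.

Definition of_tensor_map (p : CPA) (q : CPD) : cpCar :=
  tens_lift (fun a v => glue (act p a) v) q.

Lemma of_tensor_mapE p a v : of_tensor_map p (tensD a v) = glue (act p a) v.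
Proof. exact: (tens_liftE (glue_balanced p)). Qed.

Lemma of_tensor_map_linr p : linear (of_tensor_map p).
Proof. exact/tens_lift_lin/glue_balanced. Qed.

Lemma of_tensor_map_linl q : linear (of_tensor_map^~ q).
Proof.
apply: (tens_lift_linl (f := fun p a v => glue (act p a) v)) => a v c p p'.
by rewrite action_linl glue_linl.
Qed.

Lemma of_tensor_balanced : balanced act (@lactD N k) of_tensor_map.
Proof.
split=> [q c p p'|p c q q'|p b q].
- exact: of_tensor_map_linl.
- exact: of_tensor_map_linr.
move: q; apply: tensor_ext => [|c q q'|a v]; first exact: of_tensor_map_linr.
  by rewrite (lactD_linr hk) of_tensor_map_linr.
by rewrite -/(tensD a v) (lactDE hk) !of_tensor_mapE (act_mul actP).
Qed.

Definition of_tensor (t : tensAD) : cpCar := tens_lift of_tensor_map t.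

Lemma of_tensorE p q : of_tensor (tns p q) = of_tensor_map p q.
Proof. exact: (tens_liftE of_tensor_balanced). Qed.

Lemma of_tensor_linear : linear of_tensor.
Proof. exact/tens_lift_lin/of_tensor_balanced. Qed.

Definition to_tensor_gen z : tensAD := tns << resA z >> (tensD one << resD z >>).

Definition to_tensor : cpCar -> tensAD := fglift to_tensor_gen.

Lemma to_tensor_linear : linear to_tensor.
Proof. exact: fglift_linear. Qed.

Lemma to_tensorK u : of_tensor (to_tensor u) = u.
Proof.
move: u; apply: fglift_ext => [c u v|//|z].
  by rewrite to_tensor_linear of_tensor_linear.
rewrite /to_tensor fgliftU /to_tensor_gen of_tensorE of_tensor_mapE (act_one
  actP) glueU.
exact: glue_gen_res.
Qed.

(** Incompatible generators give zero on both sides, by [glue_gen0] and [tns_dead]. *)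
Lemma to_tensor_glue p v : to_tensor (glue p v) = tns p (tensD one v).
Proof.
move: p; apply: fglift_ext => [c p p'|c p p'|x].
- by rewrite glue_linl to_tensor_linear.
- by rewrite tns_linl.
move: v; apply: fglift_ext => [c v v'|c v v'|y].
- by rewrite glue_linr to_tensor_linear.
- by rewrite tensD_linr tns_linr.
rewrite glueU; have [d|nd] := boolP [disjoint imA x & imD y]; last first.
  by rewrite glue_gen0 // tns_dead // (lin0 to_tensor_linear).
have [z [<- <-]] := res_exists d.
by rewrite glue_gen_res /to_tensor fgliftU.
Qed.

Lemma of_tensorK t : to_tensor (of_tensor t) = t.
Proof.
move: t; apply: tensor_ext => [c t t'|//|p q].
  by rewrite of_tensor_linear to_tensor_linear.
rewrite of_tensorE; move: q; apply: tensor_ext => [c q q'|c q q'|a v].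
- by rewrite of_tensor_map_linr to_tensor_linear.
- by rewrite tns_linr.
by rewrite -/(tensD a v) of_tensor_mapE to_tensor_glue -tns_gen.
Qed.

End Pairing.

(** * Cutting rectangles along Z *)

Section RectCoef.
Variables (N : nat) (H : grid N) (D : {set 'I_N}).
Variables (I : finType) (col : I -> 'I_N.+1).
Hypothesis col_inj : injective col.
Variables (G : finType) (ht : G -> I -> 'I_N.+1) (swap : G -> I -> I -> G).
Hypothesis ht_inj : forall x : G, injective (ht x).
Hypothesis ht_swap : forall (x : G) a b, ht (swap x a b) =1 ht x \o tperm a b.

(** The coefficient in geometric terms again: emptiness, unlike the number of ascents, can be read
    separately on the two sides of Z. *)
Lemma rect_coefE (x : G) a b : (col a < col b)%N ->
  rect_coef H D col ht x (swap x a b) =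
  ((ht x a < ht x b)%N && empty_of col (ht x) (rect col (ht x) a b))%:R *
  ((Xcount H D (rect col (ht x) a b) == 0%N)%:R * Uweight H D (rect col (ht x)
    a b)).
Proof.
move=> cab; have ix := @ht_inj x; have hs := @ht_swap x a b.
have := is_rectE col_inj (ht (swap x a b)) a b ix.
rewrite /is_rect cab !hs /= tpermL tpermR !eqxx /=.
have -> : [forall m, (m != a) && (m != b) ==> (ht (swap x a b) m == ht x m)].
  apply/forallP => m; apply/implyP => /andP[ma mb].
  by rewrite hs /= tpermD // eq_sym.
have -> : [forall m, ht (swap x a b) m == ht x (tperm a b m)].
  by apply/forallP => m; rewrite hs.
rewrite /= -(eq_asc col hs) /rect_coef => <-.
case: (ltnP (ht x a) (ht x b)) => [xab|] /=; last by rewrite !mul0r.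
by rewrite (eq_wt _ _ _ (frefl _) hs) -(wt_rect H D cab xab).2.
Qed.

End RectCoef.

Section ChainMap.
Variables (N k : nat).
Variable H : grid N.
Local Notation ord := 'I_N.+1.
Local Notation full := [set: 'I_N].
Local Notation alg := (alg N k).
Local Notation CPA := (CPA N k).
Local Notation genA := (genA N k).
Local Notation genD := (genD N k).
Local Notation ID := (ID N k).
Local Notation IA := (IA N k).
Local Notation colA := (@colA N k).
Local Notation colD := (@colD N k).
Local Notation mA := (markA N k).
Local Notation mD := (markD N k).
Local Notation one := (alg_one N k).
Local Notation resA := (@resA N k).
Local Notation resD := (@resD N k).
Implicit Types (x : genA) (y : genD) (z : 'S_N.+1).

Lemma colA_lt (a : IA) : (colA a < k)%N.
Proof. exact: valP a. Qed.

Lemma colD_ge (b : ID) : (k <= colD b)%N.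
Proof. exact: valP b. Qed.

Lemma sum_cols (V : nmodType) (F : ord -> V) :
  \sum_m F m = \sum_(a : IA) F (colA a) + \sum_(b : ID) F (colD b).
Proof.
rewrite (bigID (fun m : ord => (m < k)%N)) /=; congr (_ + _).
  rewrite big_mkcond (sum_inj_im (@colA_inj N k)) /= => [|m].
    by apply: eq_bigr => a _; rewrite colA_lt.
  case: ifP => // mk /imsetP[]; by exists (exist (fun m : ord => (m < k)%N) m mk).
rewrite big_mkcond (sum_inj_im (@colD_inj N k)) /= => [|m].
  by apply: eq_bigr => b _; rewrite -leqNgt colD_ge.
rewrite -leqNgt; case: ifP => // km /imsetP[].
by exists (exist (fun m : ord => (k <= m)%N) m km).
Qed.

Lemma sum_ltn_cols (V : nmodType) (F : ord -> ord -> V) :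
  \sum_(a : ord) \sum_(b : ord | (a < b)%N) F a b =
  \sum_(a : IA) \sum_(b : IA | (colA a < colA b)%N) F (colA a) (colA b) +
  (\sum_(a : ID) \sum_(b : ID | (colD a < colD b)%N) F (colD a) (colD b) +
   \sum_(a : IA) \sum_(b : ID) F (colA a) (colD b)).
Proof.
have inner (m : ord) : \sum_(b : ord | (m < b)%N) F m b =
    \sum_(b : IA | (m < colA b)%N) F m (colA b) +
    \sum_(b : ID | (m < colD b)%N) F m (colD b).
  by rewrite big_mkcond sum_cols -!big_mkcond.
rewrite sum_cols (eq_bigr _ (fun a _ => inner (colA a))).
rewrite [X in _ + X](eq_bigr _ (fun a _ => inner (colD a))) !big_split /= -!addrA.
congr (_ + _); rewrite [X in _ + (X + _)]big1 ?add0r => [|b _]; last first.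
  by apply: big_pred0 => a; rewrite ltnNge (leq_trans (ltnW (colA_lt a))
    (colD_ge b)).
rewrite addrC; congr (_ + _); apply: eq_bigr => a _; apply: eq_bigl => b.
exact: leq_trans (colA_lt a) (colD_ge b).
Qed.

Lemma swapD_subproof y (a b : ID) : injectiveb [ffun m => htD y (tperm a b m)].
Proof. by apply/injectiveP => m l; rewrite !ffunE => /htD_inj/perm_inj. Qed.

Definition swapD y (a b : ID) : genD :=
  exist (fun u : {ffun ID -> ord} => injectiveb u) _ (swapD_subproof y a b).

Lemma ht_swapD y a b : htD (swapD y a b) =1 htD y \o tperm a b.
Proof. by move=> m; rewrite /htD /= ffunE. Qed.

Lemma tperm_val (J : finType) (col : J -> ord) (a b m : J) : injective col ->
  tperm (col a) (col b) (col m) = col (tperm a b m).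
Proof. by move=> ci; rewrite (inj_tperm _ _ _ ci). Qed.

Lemma resA_swapAA z (a b : IA) :
  resA (swapS z (colA a) (colA b)) = swapA (resA z) a b /\
  resD (swapS z (colA a) (colA b)) = resD z.
Proof.
split; [apply: htA_eq => m|apply: htD_eq => m].
  by rewrite ht_swapA /= !ht_resA /swapS permM tperm_val //; apply: colA_inj.
rewrite !ht_resD /swapS permM tpermD //; apply/eqP => e; have := colD_ge m.
  by rewrite -e leqNgt colA_lt.
by rewrite -e leqNgt colA_lt.
Qed.

Lemma res_swapDD z (a b : ID) :
  resA (swapS z (colD a) (colD b)) = resA z /\
  resD (swapS z (colD a) (colD b)) = swapD (resD z) a b.
Proof.
split; [apply: htA_eq => m|apply: htD_eq => m]; last first.
  by rewrite ht_swapD /= !ht_resD /swapS permM tperm_val //; apply: colD_inj.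
rewrite !ht_resA /swapS permM tpermD //; apply/eqP => e; have := colA_lt m.
  by rewrite -e ltnNge colD_ge.
by rewrite -e ltnNge colD_ge.
Qed.

Lemma marks_restrict (D : {set 'I_N}) (R : rectangle) :
    (forall c p, c \notin D -> interior R (mark c, p) = false) ->
  Xcount H full R = Xcount H D R /\ Uweight H full R = Uweight H D R.
Proof.
move=> out; rewrite /Xcount /Uweight; split.
  rewrite [LHS](bigID (mem D)) /= [X in (_ + X)%N]big1 ?addn0.
    by apply: eq_bigl => c; rewrite inE.
  by move=> c /andP[_ cD]; rewrite out.
rewrite [LHS](bigID (mem D)) /= [X in _ * X]big1 ?mulr1.
  by apply: eq_bigl => c; rewrite inE.
by move=> c /andP[_ cD]; rewrite out.
Qed.

Lemma rect_coefAA z (a b : IA) : (colA a < colA b)%N ->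
  rect_coef H full id (@full_ht N) z (swapS z (colA a) (colA b)) =
  rect_coef H mA colA (@htA N k) (resA z) (swapA (resA z) a b).
Proof.
move=> ab; have id_inj : injective (@id ord) by [].
rewrite (rect_coefE H full id_inj (@full_ht_inj N) (@ht_swapS N)) //.
rewrite (rect_coefE H mA (@colA_inj N k) (@htA_inj N k) (@ht_swapA N k)) //.
have -> : rect id (full_ht z) (colA a) (colA b) = rect colA (htA (resA z)) a b.
  by rewrite /rect !ht_resA.
set R := rect _ _ _ _; have [|-> ->] := @marks_restrict mA R.
  move=> c p; rewrite inE -leqNgt => kc; rewrite /interior /R /rect /mark /line
    /=.
  by have := colA_lt b; lia.
rewrite !ht_resA; congr ((_ && _)%:R * _); apply/forallP/forallP => em m.
  by have := em (colA m); rewrite /pt ht_resA.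
have [[l ->]|[l ->]] := @col_cases N k m; first by have := em l;
  rewrite /pt ht_resA.
rewrite /interior /R /rect /pt /line /=.
by have := colA_lt b; have := colD_ge l; rewrite /id; lia.
Qed.

Lemma rect_coefDD z (a b : ID) : (colD a < colD b)%N ->
  rect_coef H full id (@full_ht N) z (swapS z (colD a) (colD b)) =
  rect_coef H mD colD (@htD N k) (resD z) (swapD (resD z) a b).
Proof.
move=> ab; have id_inj : injective (@id ord) by [].
rewrite (rect_coefE H full id_inj (@full_ht_inj N) (@ht_swapS N)) //.
rewrite (rect_coefE H mD (@colD_inj N k) (@htD_inj N k) ht_swapD) //.
have -> : rect id (full_ht z) (colD a) (colD b) = rect colD (htD (resD z)) a b.
  by rewrite /rect !ht_resD.
set R := rect _ _ _ _; have [|-> ->] := @marks_restrict mD R.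
  move=> c p; rewrite inE -ltnNge => kc; rewrite /interior /R /rect /mark /line
    /=.
  by have := colD_ge a; lia.
rewrite !ht_resD; congr ((_ && _)%:R * _); apply/forallP/forallP => em m.
  by have := em (colD m); rewrite /pt ht_resD.
have [[l ->]|[l ->]] := @col_cases N k m; last by have := em l;
  rewrite /pt ht_resD.
rewrite /interior /R /rect /pt /line /=.
by have := colD_ge a; have := colA_lt l; rewrite /id; lia.
Qed.

(** Around Z, at abscissa 4k - 1, the last marking on the left is at 4k - 2 and the first column on
    the right at 4k. Hence each point or marking inside the rectangle is inside exactly one of the
    two halves. *)
Lemma rect_coefAD z (a : IA) (b : ID)
    (RA := halfrectA a (z (colA a)) (z (colD b)))
    (RD := halfrectD b (z (colA a)) (z (colD b))) :
  rect_coef H full id (@full_ht N) z (swapS z (colA a) (colD b)) =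
  ((z (colA a) < z (colD b))%N && (empty_of colA (htA (resA z)) RA
     && empty_of colD (htD (resD z)) RD))%:R *
  (((Xcount H mD RD == 0%N) && (Xcount H mA RA == 0%N))%:R *
    (Uweight H mD RD * Uweight H mA RA)).
Proof.
have id_inj : injective (@id ord) by [].
have ab : (colA a < colD b)%N by apply: leq_trans (colA_lt a) (colD_ge b).
rewrite (rect_coefE H full id_inj (@full_ht_inj N) (@ht_swapS N)) //.
set R := rect _ _ _ _; have cAa := colA_lt a; have cDb := colD_ge b.
have inA c p : c \in mA -> interior R (mark c, p) = interior RA (mark c, p).
  rewrite inE => ck; rewrite /interior /R /RA /rect /halfrectA /mark /line
    /Zline /=.
  by rewrite /full_ht /id; lia.
have inD c p : c \notin mA -> interior R (mark c, p) = interior RD (mark c, p).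
  rewrite inE -leqNgt => ck; rewrite /interior /R /RD /rect /halfrectD /mark
    /line /Zline /=.
  by rewrite /full_ht /id; lia.
have mAD c : (c \in full) && (c \notin mA) = (c \in mD) by rewrite !inE -leqNgt.
have XE : Xcount H full R = (Xcount H mA RA + Xcount H mD RD)%N.
  rewrite /Xcount [LHS](bigID (mem mA)) /=; congr (_ + _)%N.
    by apply: eq_big => [c|c /andP[_ cA]]; [rewrite inE | rewrite inA].
  by apply: eq_big => [c|c /andP[_ cA]]; [rewrite mAD | rewrite inD].
have UE : Uweight H full R = Uweight H mA RA * Uweight H mD RD.
  rewrite /Uweight [LHS](bigID (mem mA)) /=; congr (_ * _).
    by apply: eq_big => [c|c /andP[_ cA]]; [rewrite inE | rewrite inA].
  by apply: eq_big => [c|c /andP[_ cA]]; [rewrite mAD | rewrite inD].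
rewrite XE UE addn_eq0 (andbC (Xcount H mA RA == 0%N)) (mulrC (Uweight H mA
  RA)); congr ((_ && _)%:R * _).
apply/forallP/andP => [em|[/forallP emA /forallP emD] m].
  split; apply/forallP => m.
    have := em (colA m); rewrite /pt ht_resA; apply: contra.
    rewrite /interior /R /RA /rect /halfrectA /pt /line /Zline /=.
    by have := colA_lt m; rewrite /full_ht /id; lia.
  have := em (colD m); rewrite /pt ht_resD; apply: contra.
  rewrite /interior /R /RD /rect /halfrectD /pt /line /Zline /=.
  by have := colD_ge m; rewrite /full_ht /id; lia.
have [[l ->]|[l ->]] := @col_cases N k m.
  have := emA l; rewrite /pt ht_resA; apply: contra.
  rewrite /interior /R /RA /rect /halfrectA /pt /line /Zline /=.
  by have := colA_lt l; rewrite /full_ht /id; lia.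
have := emD l; rewrite /pt ht_resD; apply: contra.
rewrite /interior /R /RD /rect /halfrectD /pt /line /Zline /=.
by have := colD_ge l; rewrite /full_ht /id; lia.
Qed.

Lemma ht_resA_swapAD z (a : IA) (b : ID) m :
  htA (resA (swapS z (colA a) (colD b))) m = if m == a then z (colD b) else z
    (colA m).
Proof.
rewrite ht_resA /swapS permM; have [->|na] := eqVneq m a; first by rewrite tpermL.
rewrite tpermD //; first by rewrite eq_sym (inj_eq (@colA_inj N k)).
by apply/eqP => e; have := colA_lt m; rewrite -e ltnNge colD_ge.
Qed.

Lemma ht_resD_swapAD z (a : IA) (b : ID) m :
  htD (resD (swapS z (colA a) (colD b))) m = if m == b then z (colA a) else z
    (colD m).
Proof.
rewrite ht_resD /swapS permM; have [->|nb] := eqVneq m b; first by rewrite tpermR.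
rewrite tpermD //; last by rewrite eq_sym (inj_eq (@colD_inj N k)).
by apply/eqP => e; have := colD_ge m; rewrite -e leqNgt colA_lt.
Qed.

(** Two half-strips with a common edge on Z glue to the rectangle exchanging columns a and b, which
    determines all the other data. *)
Lemma halves_unique z x y (i j : ord) (a : IA) (b : ID) :
    is_halfA (resA z) x i j a -> is_halfD (resD z) y i j b ->
  [/\ i = z (colA a), j = z (colD b), x = resA (swapS z (colA a) (colD b))
    & y = resD (swapS z (colA a) (colD b))].
Proof.
case/and5P=> _ /eqP xa /eqP ya /forallP xy _ /and5P[_ /eqP xb /eqP yb /forallP
  xy' _].
rewrite ht_resA in xa; rewrite ht_resD in xb; split=> //.
  apply: htA_eq => m; rewrite ht_resA_swapAD.
  have := xy m; case: eqVneq => [->|_ /eqP->]; first by rewrite ya xb.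
  by rewrite ht_resA.
apply: htD_eq => m; rewrite ht_resD_swapAD.
have := xy' m; case: eqVneq => [->|_ /eqP->]; first by rewrite yb xa.
by rewrite ht_resD.
Qed.

Lemma halfA_swapAD z (a : IA) (b : ID) (i := z (colA a)) (j := z (colD b)) :
  is_halfA (resA z) (resA (swapS z (colA a) (colD b))) i j a =
  (i < j)%N && empty_of colA (htA (resA z)) (halfrectA a i j).
Proof.
rewrite /is_halfA ht_resA_swapAD ht_resA !eqxx /=; congr (_ && _).
have -> // : [forall l, (l != a) ==>
   (htA (resA (swapS z (colA a) (colD b))) l == htA (resA z) l)].
by apply/forallP => l; apply/implyP => nl; rewrite ht_resA_swapAD (negPf nl)
  ht_resA.
Qed.

Lemma halfD_swapAD z (a : IA) (b : ID) (i := z (colA a)) (j := z (colD b)) :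
  is_halfD (resD z) (resD (swapS z (colA a) (colD b))) i j b =
  (i < j)%N && empty_of colD (htD (resD z)) (halfrectD b i j).
Proof.
rewrite /is_halfD ht_resD_swapAD ht_resD !eqxx /=; congr (_ && _).
have -> // : [forall l, (l != b) ==>
   (htD (resD (swapS z (colA a) (colD b))) l == htD (resD z) l)].
by apply/forallP => l; apply/implyP => nl; rewrite ht_resD_swapAD (negPf nl)
  ht_resD.
Qed.

Hypothesis hk : (k <= N)%N.
Variable act : CPA -> alg -> CPA.
Hypothesis actP : is_CPA_action H act.
Local Notation tensAD := (tensAD act).
Local Notation tns p q := (tens act (@lactD N k) p q).
Local Notation coef := (rect_coef H full id (@full_ht N)).

(** Balancing turns each [rho] produced on the right into half-strips on the left with the same edge
    on Z. *)
Lemma tns_half z :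
  tns << resA z >> (\sum_(y : genD) \sum_(i : ord) \sum_(j : ord)
      \sum_(m : ID | is_halfD (resD z) y i j m
                     && (Xcount H mD (halfrectD m i j) == 0%N))
      Uweight H mD (halfrectD m i j) *: tensD (rho k i j) << y >>) =
  \sum_(a : IA) \sum_(b : ID) coef z (swapS z (colA a) (colD b)) *:
    to_tensor_gen act (swapS z (colA a) (colD b)).
Proof.
have lr := tns_linr act << resA z >>; have ll q := tns_linl act q.
pose F y i j b x a : tensAD :=
  if (is_halfD (resD z) y i j b && (Xcount H mD (halfrectD b i j) == 0%N))
     && (is_halfA (resA z) x i j a && (Xcount H mA (halfrectA a i j) == 0%N))
  then (Uweight H mD (halfrectD b i j) * Uweight H mA (halfrectA a i j)) *:
    tns << x >> (tensD one << y >>) else 0.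
transitivity (\sum_y \sum_i \sum_j \sum_b \sum_x \sum_a F y i j b x a).
  rewrite (lin_sum lr); apply: eq_bigr => y _.
  rewrite (lin_sum lr); apply: eq_bigr => i _.
  rewrite (lin_sum lr); apply: eq_bigr => j _.
  rewrite (lin_sum lr) big_mkcond; apply: eq_bigr => b _; rewrite /F.
  case: ifP => [/andP[halfD XD]|_]; last by rewrite big1 // => x _; apply: big1.
  have [ij _ _ _ _] := and5P halfD.
  rewrite (linZ lr) (tns_gen hk) (act_rho actP) // (lin_sum (ll _)) scaler_sumr.
  apply: eq_bigr => x _; rewrite (lin_sum (ll _)) scaler_sumr big_mkcond.
  by apply: eq_bigr => a _; rewrite (linZ (ll _)) scalerA.
rewrite !pair_bigA /=.
(* By [halves_unique] the sixfold sum is supported on the image of this injection. *)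
pose h (p : IA * ID) := let z' := swapS z (colA p.1) (colD p.2) in
  (resD z', z (colA p.1), z (colD p.2), p.2, resA z', p.1).
rewrite (@sum_inj_im _ _ _ h) => [|[a b] [a' b'] [_ _ _ -> _ ->]|p] //;
  last first.
  case: p => [[[[[y i] j] b] x] a] /= np; rewrite /F; case: ifP => //.
  case/andP=> /andP[halfD _] /andP[halfA _]; case/imsetP: np; exists (a, b) => //.
  by have [-> -> -> ->] := halves_unique halfA halfD.
apply: eq_bigr => -[a b] _ /=; rewrite /F halfA_swapAD halfD_swapAD rect_coefAD.
case: (ltnP (z _) _) => _ /=; last by rewrite mul0r scale0r.
case: (empty_of colD _ _); rewrite ?andbF ?mul0r ?scale0r //=.
case: (empty_of colA _ _); rewrite ?andbF ?mul0r ?scale0r //=.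
rewrite mul1r; case: (_ == _); rewrite ?mul0r ?scale0r //=.
by case: (_ == _); rewrite ?mul0r ?scale0r ?mul1r.
Qed.

End ChainMap.

Section PairIso.
Variables (N k : nat).
Hypothesis hk : (k <= N)%N.
Variable H : grid N.
Local Notation full := [set: 'I_N].
Local Notation alg := (alg N k).
Local Notation CPA := (CPA N k).
Local Notation genA := (genA N k).
Local Notation genD := (genD N k).
Local Notation mD := (markD N k).
Local Notation resA := (@resA N k).
Local Notation dCP := (rect_diff H full id (@full_ht N)).
Implicit Types (x : genA) (y : genD) (z : 'S_N.+1).

Variable act : CPA -> alg -> CPA.
Hypothesis actP : is_CPA_action H act.
Local Notation to_tensor := (to_tensor act).
Local Notation to_tensor_gen := (to_tensor_gen act).

Lemma to_tensor_diff u : to_tensor (dCP u) = diffAD H (to_tensor u).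
Proof.
have lp := to_tensor_linear act; have ld := diffAD_linear hk actP.
have lr z := tns_linr act << resA z >>; have ll q := tns_linl act q.
move: u; apply: fglift_ext => [c u v|c u v|z].
- by rewrite rect_diff_linear lp.
- by rewrite lp ld.
rewrite [in RHS]/to_tensor fgliftU /to_tensor_gen diffADE // diffD_gen //.
rewrite rect_diffU (sum_ltn_cols k) !(linD lp) /deltaD fgliftU (linD (lr z)).
congr (_ + (_ + _)).
- rewrite diffAU (lin_sum lp) (lin_sum (ll _)); apply: eq_bigr => a _.
  rewrite (lin_sum lp) (lin_sum (ll _)); apply: eq_bigr => b ab.
  rewrite (linZ lp) (linZ (ll _)) (rect_coefAA H z ab) /to_tensor fgliftU
    /to_tensor_gen.
  by have [-> ->] := resA_swapAA z a b.
- rewrite (rect_sumE H mD (@colD_inj N k) (@htD_inj N k) (@htD_eq N k)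
    (@ht_swapD N k)).
  rewrite (lin_sum lp) (lin_sum (lr _)); apply: eq_bigr => a _.
  rewrite (lin_sum lp) (lin_sum (lr _)); apply: eq_bigr => b ab.
  rewrite (linZ lp) (linZ (lr _)) (rect_coefDD H z ab) /to_tensor fgliftU
    /to_tensor_gen.
  by have [-> ->] := res_swapDD z a b.
- rewrite tns_half // (lin_sum lp); apply: eq_bigr => a _.
  rewrite (lin_sum lp); apply: eq_bigr => b _.
  by rewrite (linZ lp) /to_tensor fgliftU.
Qed.

End PairIso.

(** * Bidegrees on the two sides of Z *)

Section PairDegrees.
Variables (N k : nat).
Variable H : grid N.
Local Notation ord := 'I_N.+1.
Local Notation full := [set: 'I_N].
Local Notation strand := (strand N k).
Local Notation genA := (genA N k).
Local Notation genD := (genD N k).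
Local Notation ID := (ID N k).
Local Notation colA := (@colA N k).
Local Notation colD := (@colD N k).
Local Notation mA := (markA N k).
Local Notation resA := (@resA N k).
Local Notation resD := (@resD N k).
Implicit Types (x : genA) (y : genD) (z : 'S_N.+1).

Lemma tot_links (P : 'S_N) x (y : genA) (f : strand) : links x (val f) y ->
  tot mA P (htA y) = (tot mA P (htA x) + strand_count k P (val f))%N.
Proof.
move=> xfy; have [df ef] := linksP _ _ _ xfy.
rewrite /strand_count (sum_inj_im (@htA_inj _ _ x)) => [|i ni]; last first.
  by rewrite (links_out xfy ni) big1.
rewrite exchange_big -big_split; apply: eq_bigr => c _ /=.
rewrite -big_split; apply: eq_bigr => m _ /=; rewrite ef /line /mark.
by have := links_le m xfy; lia.
Qed.

Lemma strand_act_gen_hom x (f : strand) :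
  free_hom (degA H (k := k)) (deg_strand H f + degA H x) (strand_act_gen H x f).
Proof.
have [d|nd] := eqVneq (dom_of (val f)) (imA x); last first.
  by rewrite strand_act_gen0 //; apply: free_hom0.
have [y xfy] := links_exists d; rewrite (strand_act_genE H xfy) -(links_cr xfy).
case: eqP => [ascE|_]; last by rewrite mul0r scale0r; apply: free_hom0.
have le_xy := links_pot_le (D := mA) xfy.
rewrite mul1r; apply: free_hom_wt => // /(gdeg_step le_xy).
rewrite -[gdeg _ _ _ _]/(degA H y) -[gdeg _ _ _ _]/(degA H x) => ->.
rewrite addrC; congr (_ + _); rewrite ascE !(tot_links _ xfy) /deg_strand.
by congr (_, _); lia.
Qed.

Lemma Icount_mapr (E : seq point) (J : finType) (g : J -> point) :
  Icount E [seq g j | j <- enum J] = \sum_(e <- E) \sum_(j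
    : J) (below e (g j))%:Z.
Proof.
rewrite /Icount; apply: eq_bigr => e _.
rewrite -sum1_count big_mkcond big_map big_enum /= (big_morph Posz PoszD (erefl
  _)).
by apply: eq_bigr => j _; case: below.
Qed.

Lemma sum_pts (J : finType) (col u : J -> ord) (F : point -> int) :
  \sum_(e <- pts col u) F e = \sum_m F (pt col u m).
Proof. by rewrite /pts big_map big_enum. Qed.

Lemma Icount_full_pts (E : seq point) z :
  Icount E (full_pts z) = Icount E (ptsA (resA z)) + Icount E (ptsD (resD z)).
Proof.
rewrite !Icount_mapr -big_split; apply: eq_bigr => e _ /=.
rewrite (sum_cols k); congr (_ + _); apply: eq_bigr => m _.
  by rewrite /pt ht_resA.
by rewrite /pt ht_resD.
Qed.

Lemma Icount_marks_A (P : 'S_N) x :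
  Icount [seq (mark (c : 'I_N), mark (P c)) | c <- enum full] (ptsA x) =
  Icount [seq (mark (c : 'I_N), mark (P c)) | c <- enum mA] (ptsA x).
Proof.
rewrite !Icount_mapr !big_map !big_enum /= [LHS](bigID (mem mA)) /=.
rewrite [X in _ + X]big1 ?addr0 => [|c /andP[_]].
  by apply: eq_bigl => c; rewrite inE.
rewrite inE -leqNgt => kc; apply: big1 => m _.
have -> // : below (mark c, mark (P c)) (pt colA (htA x) m) = false.
by rewrite /below /pt /mark /line /=; have := colA_lt m; lia.
Qed.

Lemma Icount_resA z x : x = resA z ->
  Icount (full_pts z) (ptsA x) = Icount (ptsA x) (ptsA x).
Proof.
move=> ->; rewrite !Icount_mapr !sum_pts (sum_cols k).
rewrite [X in _ + X]big1 ?addr0 => [|b _].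
  by apply: eq_bigr => m _; rewrite /pt ht_resA.
apply: big1 => m _; have -> // : below (pt id (full_ht z) (colD b)) (pt colA
  (htA (resA z)) m) = false.
by rewrite /below /pt /line /=; have := colA_lt m; have := colD_ge b;
  rewrite /id; lia.
Qed.

Lemma Icount_extension z z' : resD z = resD z' ->
  Icount (full_pts z) (ptsD (resD z)) = Icount (full_pts z') (ptsD (resD z)).
Proof.
(* Points left of Z are left of every point of y. Adding the lower points of y that are not to the
   left completes the count of all heights below, which the extension does not affect. *)
move=> zz'; pose later z := \sum_(b : ID) \sum_(m : ID)
  ((colD b <= colD m) && (htD (resD z) m < htD (resD z) b))%N%:Z.
suff key w : Icount (full_pts w) (ptsD (resD w)) + later w =
    \sum_(b : ID) \sum_(r : ord) (r < htD (resD w) b)%N%:Z.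
  have lat : later z = later z' by rewrite /later zz'.
  by apply: (addIr (later z)); rewrite key lat zz' key.
rewrite Icount_mapr sum_pts exchange_big -big_split.
apply: eq_bigr => b _ /=.
rewrite [RHS](reindex_inj (@perm_inj _ w)) !(sum_cols k) -addrA; congr (_ + _).
  apply: eq_bigr => m _; rewrite /below /pt /line /= /full_ht;
    congr (Posz (nat_of_bool _)).
  by have := colA_lt m; have := colD_ge b; rewrite /id; lia.
rewrite -big_split; apply: eq_bigr => m _; rewrite /below /pt /line /= /full_ht
  !ht_resD.
by rewrite /id; case: (leqP (colD b) (colD m)) => ?; lia.
Qed.

(** The counts split according to the second point. If it is left of Z, so is the first point or
    marking, which gives [degA]; all other pairs belong to [degD]. *)
Lemma degCP_res z : degCP H z = degA H (resA z) + Defs.degD H (resD z).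
Proof.
rewrite /degCP /degA /Defs.degD.
case: pickP => [z' /forallP z'z|/(_ z)]; last first.
  by move=> /negP[]; apply/forallP => m; rewrite ht_resD.
have zz' : resD z' = resD z by apply: htD_eq => m; rewrite ht_resD (eqP (z'z m)).
have eX : Icount (Xpts H full) (ptsA (resA z))
  = Icount (Xpts H mA) (ptsA (resA z)).
  exact: Icount_marks_A.
have eO : Icount (Opts H full) (ptsA (resA z))
  = Icount (Opts H mA) (ptsA (resA z)).
  exact: Icount_marks_A.
rewrite !Icount_full_pts eX eO Icount_resA // -zz' -(Icount_extension zz') zz'.
congr (_, _) => /=; lia.
Qed.

End PairDegrees.

(** * Homogeneous tensors and transport of complexes *)

Section TensHomScale.
Variables (N : nat) (M P : lmodType {mpoly 'F_2[N]}) (B : Type).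
Variables (ract : M -> B -> M) (lact : B -> P -> P).
Variables (homM : int * int -> M -> Prop) (homP : int * int -> P -> Prop).

Lemma tens_homX e m (t : tensor ract lact) :
    (forall e m p, homM e p -> homM (e - mbideg m) ('X_[m] *: p)) ->
  tens_hom homM homP e t -> tens_hom homM homP (e - mbideg m) ('X_[m] *: t).
Proof.
move=> hX; elim=> [e1|e1 t1 t2 _ h1 _ h2|e1 e2 p q hp hq].
- by rewrite scaler0; apply: TensHom0.
- by rewrite scalerDr; apply: TensHomD.
- by rewrite -tensZl addrAC; apply: TensHomU => //; apply: hX.
Qed.

Lemma tens_hom_lin (Q : lmodType {mpoly 'F_2[N]}) (homQ : int * int -> Q -> Prop)
    (F : tensor ract lact -> Q) e0 e t :
    linear F -> (forall e, homQ e 0) ->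
    (forall e u v, homQ e u -> homQ e v -> homQ e (u + v)) ->
    (forall e e' p q, homM e p -> homP e' q -> homQ (e0 + (e + e')) (F (tens
      ract lact p q))) ->
  tens_hom homM homP e t -> homQ (e0 + e) (F t).
Proof.
move=> lF h0 hD hF; elim=> [e1|e1 t1 t2 _ h1 _ h2|e1 e2 p q hp hq].
- by rewrite (lin0 lF).
- by rewrite (linD lF); apply: hD.
- exact: hF.
Qed.

End TensHomScale.

(** This gives the tensor product its vanishing square and the directness of its grading, both
    inherited from CP. *)
Lemma is_complex_transport (N : nat) (C D : bigraded N) (f : C -> D) (g
  : D -> C) :
    linear f -> cancel f g -> cancel g f ->
    (forall u, f (bg_d u) = bg_d (f u)) ->
    (forall e u, bg_hom e u <-> bg_hom e (f u)) ->
  is_complex C -> is_complex D.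
Proof.
move=> lf fK gK fd fh [Cl Cdd C0 CD CX Cd Cs Ci].
have lg : linear g by move=> c u v; apply: (can_inj fK); rewrite lf !gK.
have gd u : g (bg_d u) = bg_d (g u) by apply: (can_inj fK); rewrite fd !gK.
have gh e u : bg_hom e u <-> bg_hom e (g u) by rewrite -[u in X in X <-> _]gK -fh.
split.
- by move=> c u v; apply: (can_inj gK); rewrite lg !gd lg Cl.
- by move=> u; apply: (can_inj gK); rewrite !gd Cdd (lin0 lg).
- by move=> e; apply/gh; rewrite (lin0 lg).
- by move=> e u v /gh hu /gh hv; apply/gh; rewrite (linD lg); apply: CD.
- by move=> i e u /gh hu; apply/gh; rewrite (linZ lg); apply: CX.
- by move=> e u /gh hu; apply/gh; rewrite gd; apply: Cd.
- move=> u; have [s [c [us hc uE]]] := Cs (g u); exists s, (fun e => f (c e));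
    split=> //.
    by move=> e; apply/fh.
  by rewrite -(lin_sum lf) -uE gK.
- move=> s c us hc c0 e es; apply: (can_inj gK); rewrite (lin0 lg).
  apply: (Ci s (fun e => g (c e)) us) => // [e'|]; first exact/gh.
  by rewrite -(lin_sum lg) c0 (lin0 lg).
Qed.

(** * The graded isomorphism *)

Section Isomorphism.
Variables (N k : nat).
Hypothesis hk : (k <= N)%N.
Variable H : grid N.
Local Notation A := {mpoly 'F_2[N]}.
Local Notation ord := 'I_N.+1.
Local Notation strand := (strand N k).
Local Notation alg := (alg N k).
Local Notation CPA := (CPA N k).
Local Notation modD := (modD N k).
Local Notation genA := (genA N k).
Local Notation genD := (genD N k).
Local Notation one := (alg_one N k).
Local Notation resA := (@resA N k).
Local Notation resD := (@resD N k).
Implicit Types (x : genA) (y : genD) (z : 'S_N.+1).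

Variable act : CPA -> alg -> CPA.
Hypothesis actP : is_CPA_action H act.
Local Notation tensAD := (tensAD act).
Local Notation to_tensor := (to_tensor act).



Local Notation hA := (free_hom (degA H (k := k))).
Local Notation hD := (free_hom (Defs.degD H (k := k))).
Local Notation hCPD := (@CPD_hom N H k).
Local Notation hT := (tens_hom hA hCPD).

Lemma deg_idem x (e : strand) : links x (val e) x -> deg_strand H e = 0.
Proof.
move=> xex; have sc (P : 'S_N) : strand_count k P (val e) = 0%N.
  by have := tot_links P xex; lia.
by rewrite /deg_strand !sc (links_cr xex) kdistxx.
Qed.

Lemma action_hom e1 e2 p u : free_hom (degA H (k := k)) e1 p ->
  free_hom (@deg_strand N H k) e2 u ->
  free_hom (degA H (k := k)) (e1 + e2) (act p u).
Proof.
move=> hp hu; rewrite (action_unique hk actP) /strand_act.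
apply: fglift_hom hp; [exact: free_hom0|exact: free_homD|exact: free_homX|] => x.
rewrite addrC.
apply: fglift_hom hu; [exact: free_hom0|exact: free_homD|exact: free_homX|] => f.
exact: strand_act_gen_hom.
Qed.

Lemma gen_hom z : hCPD (Defs.degD H (resD z)) (tensD one << resD z >>).
Proof.
have cx : #|imA (resA z)| == k by rewrite card_imA.
pose S : ksub N k := exist (fun S : {set ord} => #|S| == k) _ cx.
(* The idempotent S fixes [resD z] and can be moved across the tensor sign; it is a single diagram
   of bidegree 0. *)
have -> : tensD one << resD z >> = tensD (idem S) << resD z >>.
  have yS : idem_lact << S >> << resD z >> = << resD z >> :> modD.
    by rewrite idem_lactU res_disjoint.
  by rewrite -{1}yS /tensD -tensB /idem_ract idem_inclU alg_mul1r.
have [e xex ->] := @idemE N k hk (resA z) S erefl.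
rewrite -[Defs.degD _ _]add0r -(deg_idem xex).
by apply: TensHomU; apply: free_homU.
Qed.

Lemma to_tensor_hom e u : free_hom (degCP H) e u -> hT e (to_tensor u).
Proof.
move=> hu; rewrite -[e]addr0.
apply: fglift_hom hu.
- exact: TensHom0.
- by move=> *; apply: TensHomD.
- by move=> e' m q; apply: tens_homX => ? ? ?; apply: free_homX.
move=> z; rewrite addr0 (degCP_res k).
by apply: TensHomU; [apply: free_homU | apply: gen_hom].
Qed.

Lemma glue_hom e1 e2 (p : CPA) (v : modD) : hA e1 p -> hD e2 v ->
  free_hom (degCP H) (e1 + e2) (glue p v).
Proof.
move=> hp hv; apply: fglift_hom hp; [exact: free_hom0|exact: free_homD|exact:
  free_homX|].
move=> x; rewrite addrC.
apply: fglift_hom hv; [exact: free_hom0|exact: free_homD|exact: free_homX|] => y.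
apply: big_ind => [||z /andP[/eqP <- /eqP <-]];
  [exact: free_hom0|exact: free_homD|].
by rewrite addrC -degCP_res; apply: free_homU.
Qed.

Lemma of_tensor_map_hom e1 e2 p q : hA e1 p -> hCPD e2 q ->
  free_hom (degCP H) (e1 + e2) (of_tensor_map act p q).
Proof.
move=> hp; apply: (tens_hom_lin (F := of_tensor_map act p)).
- exact: tens_lift_lin (glue_balanced hk actP p).
- exact: free_hom0.
- exact: free_homD.
move=> e e' a v ha hv; rewrite -/(tensD a v) (of_tensor_mapE hk actP) addrA.
by apply: glue_hom hv; apply: action_hom.
Qed.

Lemma of_tensor_hom e (t : tensAD) : hT e t -> free_hom (degCP H) e (of_tensor t).
Proof.
move=> ht; rewrite -[e]add0r; 
  apply: (@tens_hom_lin N _ _ _ _ _ _ _ _ (free_hom (degCP H)) (@of_tensor N k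
    act) 0) ht.
- exact: tens_lift_lin (of_tensor_balanced hk actP).
- exact: free_hom0.
- exact: free_homD.
move=> e1 e2 p q hp hq; rewrite add0r (of_tensorE hk actP).
exact: of_tensor_map_hom.
Qed.

Lemma CP_iso_CPA_CPD : complex_iso (CP H) (CPA_CPD H act).
Proof.
have fh e u : bg_hom (b := CP H) e u <-> bg_hom (b := CPA_CPD H act) e
  (to_tensor u).
  by split=> [|/of_tensor_hom]; [exact: to_tensor_hom | rewrite (to_tensorK hk
    actP)].
have pK : cancel to_tensor (@of_tensor N k act) := to_tensorK hk actP.
have uK : cancel (@of_tensor N k act) to_tensor := of_tensorK hk actP.
have fd u : to_tensor (bg_d (b := CP H) u) = bg_d (b := CPA_CPD H act)
  (to_tensor u).
  exact: to_tensor_diff.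
have cCP := CP_is_complex H.
split=> //.
  exact: (@is_complex_transport N (CP H) (CPA_CPD H act) to_tensor (@of_tensor
    N k act)
    (@to_tensor_linear N k act) pK uK fd fh cCP).
pose F : CP H -> CPA_CPD H act := to_tensor.
pose phi : {linear CP H -> CPA_CPD H act} := HB.pack F
  (GRing.isLinear.Build A (CP H) (CPA_CPD H act) *:%R F (@to_tensor_linear N k
    act)).
by exists phi; split=> //; exists (@of_tensor N k act).
Qed.

End Isomorphism.

(** The balance clauses certify that the maps defined by [tens_lift] are independent of
    representatives, and the existence clause keeps the last one from being vacuous. *)
Theorem theorem2 (N k : nat) (hk : (k <= N)%N) (H : grid N) :
  [/\ forall b : alg N k,
        balanced (@idem_ract N k) (@idem_lact N k) (lactD_map b),
      balanced (@idem_ract N k) (@idem_lact N k) (diffD_map H (k := k)),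
      exists act : CPA N k -> alg N k -> CPA N k, is_CPA_action H act
    & forall act : CPA N k -> alg N k -> CPA N k, is_CPA_action H act ->
        balanced act (@lactD N k) (diffAD_map H act) /\
        complex_iso (CP H) (CPA_CPD H act)].
Proof.
split=> [b||| act actP].
- exact: lactD_map_balanced.
- exact: diffD_map_balanced.
- by exists (strand_act H); apply: strand_act_action.
- by split; [apply: diffAD_map_balanced | apply: CP_iso_CPA_CPD].
Qed.
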